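(* Every link which is the closure of a $3$-braid is semiadequate, and so every non-trivial such link has non-trivial Jones polynomial up to units: if an $n$-component link $L$ is the closure of a $3$-braid and is not the $n$-component unlink, then its Jones polynomial is not equal to $(-t^{1/2}-t^{-1/2})^{n-1}$ up to multiplication by a unit $\pm t^{m/2}$, $m\in\mathbb{Z}$.
   Context: A link diagram $D$ is $A$-adequate (resp. $B$-adequate) if no crossing, once $A$-spliced (resp. $B$-spliced), has the same loop of the $A$-state (resp. $B$-state) on both sides of the spliced spot; here the $A$-splicing joins the two corners of a crossing passed by the overcrossing strand when rotated counterclockwise towards the undercrossing strand, the $B$-splicing joins the other two corners, and the $A$-state ($B$-state) is the collection of loops obtained by $A$-splicing ($B$-splicing) all crossings. $D$ is semiadequate if it is $A$-adequate or $B$-adequate, and a link is semiadequate if it has a semiadequate diagram. *)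

(* Defs.v *)
(* Plane link diagrams are given in Morse position: cut by horizontal lines into
   slices, each containing exactly one local minimum, local maximum or crossing,
   and read from bottom to top.  Every link diagram is plane-isotopic to one of
   this form.  Links are such diagrams up to isotopy, that is, up to plane
   isotopy and the Reidemeister moves. *)
From HB Require Import structures.
From mathcomp Require Import all_boot all_order all_algebra.
From Stdlib Require Import Relation_Operators.
Set Implicit Arguments.
Unset Strict Implicit.
Unset Printing Implicit Defensive.
Import GRing.Theory.
Local Open Scope nat_scope.

(* [Cross true] is the crossing whose overcrossing strand has positive slope
   (bottom left to top right); in [Cross false] the overcrossing strand has
   negative slope (bottom right to top left). *)
Inductive shape := Cup | Cap | Cross of bool.

Definition ins (s : shape) : nat := if s is Cup then 0 else 2.
Definition outs (s : shape) : nat := if s is Cap then 0 else 2.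
Definition is_cross (s : shape) : bool := if s is Cross _ then true else false.

(* [Slice s i]: [s] is preceded by [i] vertical strands on its left, and followed
   by as many vertical strands on its right as there remain. *)
Record slice := Slice { kind : shape; pos : nat }.

Definition next_width (n : nat) (l : slice) : nat :=
  n - ins (kind l) + outs (kind l).

Fixpoint closed_from (n : nat) (w : seq slice) : bool :=
  if w is l :: w' then
    (pos l + ins (kind l) <= n) && closed_from (next_width n l) w'
  else n == 0.

Record link_diagram := LinkDiagram {
  slices :> seq slice;
  slicesP : closed_from 0 slices
}.

(* Isotopies of Morse diagrams: exchange of the heights of two distant slices,
   straightening of a zigzag, sliding a strand across a local extremum, and the
   three Reidemeister moves.  Together with their inverses these generate plane
   isotopy and all variants of the Reidemeister moves. *)
Inductive move : seq slice -> seq slice -> Prop :=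
| move_exchange (a b : shape) (i d : nat) :
    move [:: Slice a i; Slice b (i + outs a + d)]
         [:: Slice b (i + ins a + d); Slice a i]
| move_zigzag_l (i : nat) : move [:: Slice Cup i; Slice Cap i.+1] [::]
| move_zigzag_r (i : nat) : move [:: Slice Cup i.+1; Slice Cap i] [::]
| move_cup_slide (b : bool) (i : nat) :
    move [:: Slice Cup i; Slice (Cross b) i.+1]
         [:: Slice Cup i.+1; Slice (Cross (~~ b)) i]
| move_cap_slide (b : bool) (i : nat) :
    move [:: Slice (Cross b) i.+1; Slice Cap i]
         [:: Slice (Cross (~~ b)) i; Slice Cap i.+1]
| move_R1_cup (b : bool) (i : nat) :
    move [:: Slice Cup i; Slice (Cross b) i] [:: Slice Cup i]
| move_R1_cap (b : bool) (i : nat) :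
    move [:: Slice (Cross b) i; Slice Cap i] [:: Slice Cap i]
| move_R2 (b : bool) (i : nat) :
    move [:: Slice (Cross b) i; Slice (Cross (~~ b)) i] [::]
| move_R3 (b : bool) (i : nat) :
    move [:: Slice (Cross b) i; Slice (Cross b) i.+1; Slice (Cross b) i]
         [:: Slice (Cross b) i.+1; Slice (Cross b) i; Slice (Cross b) i.+1].

(* Both sides being well-formed diagrams ensures that the strands on which a
   move such as the inverse of [move_zigzag_l] acts are present. *)
Definition isotopy_step (D D' : link_diagram) : Prop :=
  exists u v l r : seq slice,
    [/\ move l r, slices D = u ++ l ++ v & slices D' = u ++ r ++ v].

(* [D] and [D'] are diagrams of the same (unoriented) link. *)
Definition isotopic : link_diagram -> link_diagram -> Prop :=
  clos_refl_sym_trans link_diagram isotopy_step.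

(* The point [(k, j)] is the intersection of the [k]-th horizontal line with the
   [j]-th strand, so that slice [k] lies between lines [k] and [k.+1]. *)
Definition width (w : seq slice) (k : nat) : nat :=
  foldl next_width 0 (take k w).

Definition points (w : seq slice) : seq (nat * nat) :=
  [seq (k, j) | k <- iota 0 (size w).+1, j <- iota 0 (width w k)].

Inductive treatment := Unspliced | ASpliced | BSpliced.

(* Rotating counterclockwise, the strand of positive slope sweeps the top and
   bottom corners of the crossing before meeting the other strand, while the
   strand of negative slope sweeps the left and right corners.  Hence the
   A-splicing of [Cross true] and the B-splicing of [Cross false] consist of two
   vertical arcs; the other two splicings consist of a lower and an upper arc. *)
Definition crossing_arcs (b : bool) (t : treatment) (bl br tl tr : nat * nat) :
    seq ((nat * nat) * (nat * nat)) :=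
  let vertical := [:: (bl, tl); (br, tr)] in
  let horizontal := [:: (bl, br); (tl, tr)] in
  match t with
  | Unspliced => [:: (bl, tr); (br, tl)]
  | ASpliced => if b then vertical else horizontal
  | BSpliced => if b then horizontal else vertical
  end.

Definition inner_arcs (l : slice) (t : treatment) (k : nat) :
    seq ((nat * nat) * (nat * nat)) :=
  let bl := (k, pos l) in let br := (k, (pos l).+1) in
  let tl := (k.+1, pos l) in let tr := (k.+1, (pos l).+1) in
  match kind l with
  | Cup => [:: (tl, tr)]
  | Cap => [:: (bl, br)]
  | Cross b => crossing_arcs b t bl br tl tr
  end.

Definition side_arc (l : slice) (k : nat) (p q : nat * nat) : bool :=
  [&& p.1 == k, q.1 == k.+1 &
      ((p.2 < pos l) && (q.2 == p.2)) ||
      ((pos l + ins (kind l) <= p.2) &&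
       (q.2 + ins (kind l) == p.2 + outs (kind l)))].

Section Diagram.
Variable D : link_diagram.

Definition slice_at (k : 'I_(size D)) : slice := tnth (in_tuple D) k.

Definition crossings : {set 'I_(size D)} :=
  [set k | is_cross (kind (slice_at k))].

Definition point := seq_sub (points D).

(* A state prescribes a treatment of every crossing (its values at the other
   slices are irrelevant). *)
Definition arc (s : 'I_(size D) -> treatment) (p q : point) : bool :=
  [exists k, side_arc (slice_at k) k (val p) (val q) ||
             ((val p, val q) \in inner_arcs (slice_at k) (s k) k)].

Definition joined (s : 'I_(size D) -> treatment) : rel point :=
  fun p q => arc s p q || arc s q p.

Definition loops (s : 'I_(size D) -> treatment) : nat := n_comp (joined s) predT.

Definition components : nat := loops (fun _ => Unspliced).

(* For either splicing of the crossing at slice [k], its bottom left and top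
   right points lie on different arcs of the spliced spot. *)
Definition self_touching (s : 'I_(size D) -> treatment) (k : 'I_(size D)) : bool :=
  [exists p : point, exists q : point,
    [&& val p == (val k, pos (slice_at k)),
        val q == (k.+1, (pos (slice_at k)).+1) & connect (joined s) p q]].

Definition A_adequate : bool :=
  [forall k in crossings, ~~ self_touching (fun _ => ASpliced) k].

Definition B_adequate : bool :=
  [forall k in crossings, ~~ self_touching (fun _ => BSpliced) k].

Definition semiadequate : bool := A_adequate || B_adequate.

(* An orientation tells for every point whether the strand through it is directed
   upwards; it changes exactly along the arcs through a local extremum. *)
Definition orientation (o : nat * nat -> bool) : Prop :=
  forall p q : point, arc (fun _ => Unspliced) p q ->
    o (val q) = if (val p).1 == (val q).1 then ~~ o (val p) else o (val p).

(* The bottom left point is on the strand of positive slope and the bottom right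
   point on the other one. *)
Definition writhe (o : nat * nat -> bool) : int :=
  (\sum_(k < size D)
    if kind (slice_at k) is Cross b then
      if (o (val k, pos (slice_at k)) == o (val k, (pos (slice_at k)).+1)) == b
      then 1 else -1
    else 0)%R.

End Diagram.

Local Open Scope ring_scope.

(* Laurent polynomials in t^(1/4) are seen inside rational functions. *)
Definition jones_field := {fraction {poly int}}.

Definition quarter_t : jones_field := FracField.tofrac 'X.
Definition half_t : jones_field := quarter_t ^+ 2.

(* The variable A of the Kauffman bracket is t^(-1/4). *)
Definition bracket_A : jones_field := quarter_t^-1.

Definition kauffman_state (D : link_diagram) (S : {set 'I_(size D)}) :
    'I_(size D) -> treatment :=
  fun k => if k \in S then ASpliced else BSpliced.

(* The sum is over the sets S of crossings that are A-spliced. *)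
Definition kauffman_bracket (D : link_diagram) : jones_field :=
  \sum_(S : {set 'I_(size D)} | S \subset crossings D)
    bracket_A ^ (#|S|%:Z - #|crossings D :\: S|%:Z) *
    (- bracket_A ^+ 2 - bracket_A ^- 2) ^+ (loops (kauffman_state S)).-1.

(* V = (- t^(3/4))^writhe <D>. *)
Definition jones (D : link_diagram) (o : nat * nat -> bool) : jones_field :=
  (- quarter_t ^+ 3) ^ writhe D o * kauffman_bracket D.

Definition jones_unit (u : jones_field) : Prop :=
  exists (e : bool) (m : int), u = (-1) ^+ e * half_t ^ m.

Local Open Scope nat_scope.

Fixpoint unlink_slices (n : nat) : seq slice :=
  if n is n'.+1 then [:: Slice Cup 0, Slice Cap 0 & unlink_slices n'] else [::].

Lemma unlink_closed (n : nat) : closed_from 0 (unlink_slices n).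
Proof. by elim: n. Qed.

Definition unlink (n : nat) : link_diagram := LinkDiagram (unlink_closed n).

(* Words in the generators of the braid group on [n] strands: [(i, true)] is the
   [i]-th generator and [(i, false)] its inverse. *)
Definition braid_word (n : nat) := seq ('I_n.-1 * bool).

(* [n] nested minima, the braid on the [n] leftmost strands, [n] nested maxima. *)
Definition closure_slices (n : nat) (beta : braid_word n) : seq slice :=
  [seq Slice Cup i | i <- iota 0 n] ++
  [seq Slice (Cross g.2) (val g.1) | g <- beta] ++
  rev [seq Slice Cap i | i <- iota 0 n].

Lemma closure_closed (n : nat) (beta : braid_word n) :
  closed_from 0 (closure_slices beta).
Proof.
have cupsP m c w : c.*2 = m.*2 -> closed_from (m + n).*2 w ->
    closed_from c.*2 ([seq Slice Cup i | i <- iota m n] ++ w).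
  move=> /double_inj ->; elim: n m w {beta} => [|k IHk] m w /=; first by rewrite addn0.
  rewrite addn0 /next_width /= subn0 addn2 -doubleS addnS -addSn => Hw.
  by rewrite -addnn leq_addr IHk.
have capsP k : closed_from k.*2 (rev [seq Slice Cap i | i <- iota 0 k]).
  elim: k => [|k IHk] //.
  rewrite -addn1 iotaD map_cat rev_cat /= add0n /next_width /= addn0.
  by rewrite addn1 doubleS !subSS subn0 IHk andbT -addnn addn2 !ltnS leq_addr.
rewrite /closure_slices; apply: (cupsP 0 0) => //; rewrite add0n.
elim: beta => [|[i b] beta IHb] /=; first exact: capsP.
have lt_i : i.+1 < n by rewrite -ltn_predRL.
have le_n : n <= n.*2 by rewrite -addnn leq_addr.
rewrite /next_width /= addn2 (leq_trans lt_i) //= subnK //.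
exact: leq_trans (leq_trans lt_i le_n).
Qed.

Definition braid_closure (n : nat) (beta : braid_word n) : link_diagram :=
  LinkDiagram (closure_closed beta).

Definition is_closed_braid (n : nat) (L : link_diagram) : Prop :=
  exists beta : braid_word n, isotopic L (braid_closure beta).

Definition semiadequate_link (L : link_diagram) : Prop :=
  exists D : link_diagram, isotopic L D /\ semiadequate D.

(* Main.v *)
Require Import Defs.
From HB Require Import structures.
From mathcomp Require Import all_boot all_order all_algebra.
From mathcomp Require Import all_field zify ring.
From Stdlib Require Import Relation_Operators Setoid Morphisms.
Set Implicit Arguments.
Unset Strict Implicit.
Unset Printing Implicit Defensive.
Import GRing.Theory Num.Theory.

(* Modulo the centre of the braid group B_3, generated by Delta^2, every element
   is conjugate to a word in a = sigma_1 and b = sigma_2^-1, possibly times one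
   half twist Delta, because a Delta^-1 a = b, b Delta b = a and
   a Delta^(odd) b = Delta^(odd); if Delta does not disappear, the word has at most
   one letter.

   Semiadequacy.  An alternating word is adequate on the side where at least two
   crossings are spliced horizontally.  For Delta^(-2d) alpha with d > 0, pairs of
   letters a absorb the twists through a b^k a Delta^-2 = b sigma_1^-(k+2) b.
   Either all letters become negative, or all blocks of negative letters have
   length at least two; one loop of the A-state then meets all the blocks and the
   other loops are small circles inside the blocks.  Adequacy is certified by
   colouring the loops.  The case d < 0 is the mirror image.

   Jones polynomial.  If N = - A^2 - A^-2 is a positive integer, the state sum
   counts N-colourings of the states, hence is a composition of local operators,
   one for each slice, on functions of the N-colourings of the strands.  This
   proves its invariance and, for a closed braid, expresses it by the trace of
   the Burau matrix.  There are infinitely many such values of A, so that this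
   determines the bracket as a Laurent polynomial.  For Delta^(2d) alpha, up to a
   unit and with y = - A^4, the bracket is
     T(y) - (-1)^d (y^(3d+1) + y^(3d-1)),
   where T(y) is the trace of the product of the matrices [[1/y, 1], [0, 1]] and
   [[1, 0], [1, y]] for the letters a and b.  If both letters occur, T(1) >= 3,
   whereas the bracket of an unlink is a unit or vanishes at y = 1; hence
   alpha = ab and then d = 0.  The other words have explicit polynomials, and
   comparing coefficients leaves only words closing to unlinks.  The number of
   components is read off from the bracket. *)

Local Open Scope nat_scope.

(** * Isotopies of closed 3-braids *)

(** Isotopy of bare lists of slices: the proofs of closedness are hidden in existentials, so that
    lists can be rewritten freely. Boolean proofs being irrelevant, their choice does not matter. *)
Definition iso (w w' : seq slice) : Prop :=
  exists h h', isotopic (@LinkDiagram w h) (@LinkDiagram w' h').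

Lemma link_diagram_eta (D : link_diagram) (h : closed_from 0 D) : LinkDiagram h = D.
Proof. by case: D h => w wP h; rewrite (bool_irrelevance h wP). Qed.

Lemma iso_refl w : closed_from 0 w -> iso w w.
Proof. by move=> h; exists h, h; apply: rst_refl. Qed.

Lemma iso_sym w w' : iso w w' -> iso w' w.
Proof. by move=> [h [h' H]]; exists h', h; apply: rst_sym. Qed.

Lemma iso_trans w2 w1 w3 : iso w1 w2 -> iso w2 w3 -> iso w1 w3.
Proof.
move=> [h1 [h2 H12]] [h2' [h3 H23]]; exists h1, h3.
by apply: rst_trans H12 _; rewrite (bool_irrelevance h2 h2').
Qed.

Lemma iso_move u v l r : move l r -> closed_from 0 (u ++ l ++ v) ->
  closed_from 0 (u ++ r ++ v) -> iso (u ++ l ++ v) (u ++ r ++ v).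
Proof. by move=> m h h'; exists h, h'; apply: rst_step; exists u, v, l, r. Qed.

Lemma iso_move_eq u v l r w w' : move l r -> w = u ++ l ++ v -> w' = u ++ r ++ v ->
  closed_from 0 w -> closed_from 0 w' -> iso w w'.
Proof. by move=> m -> ->; apply: iso_move. Qed.

Definition gen := (bool * bool)%type.

(* [(i, s)] is the generator of position [i : bool], read as 0 or 1, with sign [s]. *)
Definition gslice (g : gen) := Slice (Cross g.2) g.1.

Definition cl (w : seq gen) : seq slice :=
  [:: Slice Cup 0; Slice Cup 1; Slice Cup 2] ++ map gslice w ++
  [:: Slice Cap 2; Slice Cap 1; Slice Cap 0].

Lemma closed_crosses n x v : all (fun l => is_cross (kind l) && (pos l + 2 <= n)) x ->
  closed_from n (x ++ v) = closed_from n v.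
Proof.
elim: x => [|[s i] x IHx] //= /andP[/andP[cs le_in] allx].
by case: s cs => // b _; rewrite /next_width /= le_in subnK ?IHx //; lia.
Qed.

Lemma closed_gens n w v : 2 < n -> closed_from n (map gslice w ++ v) = closed_from n v.
Proof.
move=> n_gt; apply: closed_crosses; rewrite all_map; apply/allP=> -[i s] _ /=.
by case: i => /=; lia.
Qed.

Lemma closed_cl w : closed_from 0 (cl w).
Proof. by rewrite /cl /= closed_gens. Qed.

(** Equality in the braid group B_3, given by its presentation. The contexts [u] and [v] are part of
    the relations, so that each relation is one Reidemeister move of type II or III on the
    closure. *)
Inductive beq : seq gen -> seq gen -> Prop :=
| beq_refl w : beq w w
| beq_sym w w' : beq w w' -> beq w' w
| beq_trans w1 w2 w3 : beq w1 w2 -> beq w2 w3 -> beq w1 w3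
| beq_cancel u v i s : beq (u ++ [:: (i, s); (i, ~~ s)] ++ v) (u ++ v)
| beq_braid u v i s : beq (u ++ [:: (i, s); (~~ i, s); (i, s)] ++ v)
                          (u ++ [:: (~~ i, s); (i, s); (~~ i, s)] ++ v).

#[export] Instance beq_equiv : Equivalence beq.
Proof. split; [exact: beq_refl | exact: beq_sym | exact: beq_trans]. Qed.

Lemma beq_ctx u v w w' : beq w w' -> beq (u ++ w ++ v) (u ++ w' ++ v).
Proof.
elim=> {w w'} [w|w w' _|w1 w2 w3 _ IH1 _ IH2|u' v' i s|u' v' i s].
- exact: beq_refl.
- exact: beq_sym.
- exact: beq_trans IH1 IH2.
- by rewrite -!catA !(catA u); apply: beq_cancel.
- by rewrite -!catA !(catA u); apply: beq_braid.
Qed.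

#[export] Instance beq_cat : Proper (beq ==> beq ==> beq) (@cat gen).
Proof.
move=> u u' Hu v v' Hv; transitivity (u' ++ v).
  by have := beq_ctx [::] v Hu.
by have := beq_ctx u' [::] Hv; rewrite !cats0.
Qed.

#[export] Instance beq_cons g : Proper (beq ==> beq) (cons g).
Proof. by move=> u u' Hu; have := beq_ctx [:: g] [::] Hu; rewrite !cats0. Qed.

Lemma iso_beq w w' : beq w w' -> iso (cl w) (cl w').
Proof.
elim=> {w w'} [w|w w' _|w1 w2 w3 _ IH1 _ IH2|u v i s|u v i s].
- exact/iso_refl/closed_cl.
- exact: iso_sym.
- exact: iso_trans IH1 IH2.
- apply: (iso_move_eq (move_R2 s i)
    (u := [:: Slice Cup 0; Slice Cup 1; Slice Cup 2] ++ map gslice u)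
    (v := map gslice v ++ [:: Slice Cap 2; Slice Cap 1; Slice Cap 0]));
  by rewrite ?closed_cl // /cl !map_cat /= -!catA.
- have R3 b := move_R3 b 0.
  (* [move_R3] starts from the word whose outer letters have the lower position; for [i = true] it
     is read backwards. *)
  case: i; first apply: iso_sym;
  apply: (iso_move_eq (R3 s)
    (u := [:: Slice Cup 0; Slice Cup 1; Slice Cup 2] ++ map gslice u)
    (v := map gslice v ++ [:: Slice Cap 2; Slice Cap 1; Slice Cap 0]));
  by rewrite ?closed_cl // /cl !map_cat /= -!catA.
Qed.

(* A crossing next to the nested minima slides across them to the strands on the
   other side, rises there past the braid, and comes back across the maxima. *)
Lemma iso_rot1 g w : iso (cl (g :: w)) (cl (w ++ [:: g])).
Proof.
(* Strand [5 - m] is the return of strand [m], so that a crossing of the strands [i] and [i + 1]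
   reappears at position [4 - i]. Its sign changes an even number of times on the way. *)
case: g => i s; set j := 4 - i.
set bot := [:: Slice Cup 0; Slice Cup 1; Slice Cup 2].
set top := [:: Slice Cap 2; Slice Cap 1; Slice Cap 0].
set X := Slice (Cross s) i; set Y := Slice (Cross s) j.
have clX k x v : k <= 4 -> closed_from 6 ([:: Slice (Cross x) k] ++ v) = closed_from 6 v.
  by move=> le_k; rewrite closed_crosses //= andbT; lia.
have clG v : closed_from 6 (map gslice w ++ v) = closed_from 6 v by apply: closed_gens.
have le_j : j <= 4 by rewrite /j; lia.
have low v : closed_from 6 v -> iso (bot ++ X :: v) (bot ++ Y :: v).
  move=> clv; rewrite /X /Y /j; case: (i) => /=.
  - apply: (@iso_trans [:: Slice Cup 0, Slice Cup 1, Slice Cup 1, Slice (Cross (~~ s)) 2 & v]).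
      apply: iso_sym; have := move_cup_slide (~~ s) 1; rewrite negbK => m.
      by apply: (iso_move_eq m (u := [:: Slice Cup 0; Slice Cup 1]) (v := v));
         rewrite //= ?clX.
    apply: (@iso_trans [:: Slice Cup 0, Slice Cup 1, Slice Cup 3, Slice (Cross (~~ s)) 2 & v]).
      apply: iso_sym.
      by apply: (iso_move_eq (move_exchange Cup Cup 1 0) (u := [:: Slice Cup 0])
        (v := Slice (Cross (~~ s)) 2 :: v)); rewrite //= ?clX.
    apply: iso_sym.
    by apply: (iso_move_eq (move_cup_slide s 2) (u := [:: Slice Cup 0; Slice Cup 1]) (v := v));
      rewrite //= ?clX.
  - apply: (@iso_trans [:: Slice Cup 0, Slice Cup 1, Slice (Cross s) 0, Slice Cup 2 & v]).
      apply: iso_sym.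
      by apply: (iso_move_eq (move_exchange (Cross s) Cup 0 0)
        (u := [:: Slice Cup 0; Slice Cup 1]) (v := v)); rewrite //= ?clX.
    apply: (@iso_trans [:: Slice Cup 0, Slice Cup 0, Slice (Cross (~~ s)) 1, Slice Cup 2 & v]).
      apply: iso_sym; have := move_cup_slide (~~ s) 0; rewrite negbK => m.
      by apply: (iso_move_eq m (u := [:: Slice Cup 0]) (v := Slice Cup 2 :: v));
         rewrite //= ?clX.
    apply: (@iso_trans [:: Slice Cup 0, Slice Cup 2, Slice (Cross (~~ s)) 1, Slice Cup 2 & v]).
      apply: iso_sym.
      by apply: (iso_move_eq (move_exchange Cup Cup 0 0) (u := [::])
        (v := [:: Slice (Cross (~~ s)) 1, Slice Cup 2 & v])); rewrite //= ?clX.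
    apply: (@iso_trans [:: Slice Cup 0, Slice Cup 1, Slice (Cross s) 2, Slice Cup 2 & v]).
      apply: iso_sym.
      by apply: (iso_move_eq (move_cup_slide s 1) (u := [:: Slice Cup 0])
        (v := Slice Cup 2 :: v)); rewrite //= ?clX.
    apply: iso_sym.
    by apply: (iso_move_eq (move_exchange Cup (Cross s) 2 0)
        (u := [:: Slice Cup 0; Slice Cup 1]) (v := v)); rewrite //= ?clX.
have high u : (forall v, closed_from 6 v -> closed_from 0 (u ++ v)) ->
    iso (u ++ X :: top) (u ++ Y :: top).
  move=> clu; rewrite /X /Y /j; case: (i) => /=.
  - apply: (@iso_trans (u ++ [:: Slice (Cross (~~ s)) 2; Slice Cap 1; Slice Cap 1; Slice Cap 0])).
      apply: iso_sym; have := move_cap_slide (~~ s) 1; rewrite negbK => m.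
      by apply: (iso_move_eq m (u := u) (v := [:: Slice Cap 1; Slice Cap 0]));
         rewrite //= ?clu.
    apply: (@iso_trans (u ++ [:: Slice (Cross (~~ s)) 2; Slice Cap 3; Slice Cap 1; Slice Cap 0])).
      by apply: (iso_move_eq (move_exchange Cap Cap 1 0)
        (u := u ++ [:: Slice (Cross (~~ s)) 2]) (v := [:: Slice Cap 0]));
        rewrite -?catA //= clu.
    apply: iso_sym.
    by apply: (iso_move_eq (move_cap_slide s 2) (u := u) (v := [:: Slice Cap 1; Slice Cap 0]));
      rewrite -?catA //= clu.
  - apply: (@iso_trans (u ++ [:: Slice Cap 2; Slice (Cross s) 0; Slice Cap 1; Slice Cap 0])).
      by apply: (iso_move_eq (move_exchange (Cross s) Cap 0 0) (u := u)
        (v := [:: Slice Cap 1; Slice Cap 0])); rewrite -?catA //= clu.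
    apply: (@iso_trans (u ++ [:: Slice Cap 2; Slice (Cross (~~ s)) 1; Slice Cap 0; Slice Cap 0])).
      apply: iso_sym; have := move_cap_slide (~~ s) 0; rewrite negbK => m.
      by apply: (iso_move_eq m (u := u ++ [:: Slice Cap 2]) (v := [:: Slice Cap 0]));
         rewrite -?catA //= clu.
    apply: (@iso_trans (u ++ [:: Slice Cap 2; Slice (Cross (~~ s)) 1; Slice Cap 2; Slice Cap 0])).
      by apply: (iso_move_eq (move_exchange Cap Cap 0 0)
        (u := u ++ [:: Slice Cap 2; Slice (Cross (~~ s)) 1]) (v := [::]));
        rewrite -?catA //= clu.
    apply: (@iso_trans (u ++ [:: Slice Cap 2; Slice (Cross s) 2; Slice Cap 1; Slice Cap 0])).
      apply: iso_sym.
      by apply: (iso_move_eq (move_cap_slide s 1) (u := u ++ [:: Slice Cap 2])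
        (v := [:: Slice Cap 0])); rewrite -?catA //= clu.
    by apply: (iso_move_eq (move_exchange Cap (Cross s) 2 0) (u := u)
        (v := [:: Slice Cap 1; Slice Cap 0])); rewrite -?catA //= clu.
have mid : iso (bot ++ Y :: map gslice w ++ top) (bot ++ map gslice w ++ Y :: top).
  rewrite -[map gslice w ++ Y :: top]/([::] ++ map gslice w ++ Y :: top).
  rewrite -[Y :: map gslice w ++ top]/([::] ++ Y :: map gslice w ++ top).
  (* The list [u] collects the letters already passed. Every letter has position at most 1 and [j]
     is at least 3, so the slices exchanged are distant. *)
  elim: w ([::] : seq slice) (isT : all (fun l => is_cross (kind l) && (pos l + 2 <= 6)) [::])
    clG => [|[i' s'] w' IHw] u cu clG /=.
    apply: iso_refl; rewrite /= closed_crosses // -cat1s clX //.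
  have clu v : closed_from 6 (u ++ v) = closed_from 6 v by apply: closed_crosses.
  have clG' v : closed_from 6 (map gslice w' ++ v) = closed_from 6 v.
    by apply: closed_gens.
  pose G := Slice (Cross s') i'.
  have cu' : all (fun l => is_cross (kind l) && (pos l + 2 <= 6)) (u ++ [:: G]).
    by rewrite all_cat cu /=; case: (i').
  apply: (@iso_trans (bot ++ u ++ G :: Y :: map gslice w' ++ top)).
    apply: iso_sym; have := move_exchange (Cross s') (Cross s) i' (j - i' - 2).
    have -> : i' + outs (Cross s') + (j - i' - 2) = j.
      by rewrite /j /=; case: (i); case: (i').
    move=> m; apply: (iso_move_eq m (u := bot ++ u) (v := map gslice w' ++ top));
      rewrite -?catA //= clu -cat1s clX ?(leq_trans (leq_b1 _)) //;
      rewrite -cat1s clX ?clG' // ?(leq_trans (leq_b1 _)) //.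
  by have := IHw (u ++ [:: G]) cu' clG'; rewrite -!catA.
apply: (@iso_trans (bot ++ Y :: map gslice w ++ top)).
  by apply: low; rewrite clG.
apply: iso_trans mid _.
rewrite /cl map_cat /= -catA -/bot -/top.
apply: iso_sym; have := high (bot ++ map gslice w); rewrite -!catA; apply.
by move=> v clv; rewrite -!catA /= clG.
Qed.

(** Conjugate braids have isotopic closures: the letters of [u] go round the closure one at a
    time. *)
Lemma iso_rot u v : iso (cl (u ++ v)) (cl (v ++ u)).
Proof.
elim: u v => [|g u IHu] v; first by rewrite cats0; apply/iso_refl/closed_cl.
apply: (@iso_trans (cl (u ++ (v ++ [:: g])))); first by rewrite catA; apply: iso_rot1.
by rewrite -[v ++ g :: u]/(v ++ [:: g] ++ u) (catA v); apply: IHu.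
Qed.

(** * A normal form up to conjugation *)

Infix "≡" := beq (at level 70).
#[export] Hint Resolve beq_refl : core.

(* [sigma_1] for [true] and [sigma_2^-1] for [false]. *)
Definition letter (c : bool) : gen := (~~ c, c).
(** The effect of conjugation by the half twist Delta: the two generators are exchanged and signs
    are kept. *)
Definition flip (g : gen) : gen := (~~ g.1, g.2).
Definition half_twist (s : bool) : seq gen := [:: (false, s); (true, s); (false, s)].

Lemma flipK : involutive flip.
Proof. by case=> i s; rewrite /flip /= negbK. Qed.

Lemma beq_inv i s : [:: (i, s); (i, ~~ s)] ≡ [::].
Proof. by have := beq_cancel [::] [::] i s. Qed.

Lemma beq_invl i s : [:: (i, ~~ s); (i, s)] ≡ [::].
Proof. by have := beq_inv i (~~ s); rewrite negbK. Qed.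

Lemma half_twistE i s : half_twist s ≡ [:: (i, s); (~~ i, s); (i, s)].
Proof. by case: i; [have := beq_braid [::] [::] false s | reflexivity]. Qed.

Lemma half_twist_inv s : half_twist s ++ half_twist (~~ s) ≡ [::].
Proof.
rewrite (half_twistE false s) (half_twistE false (~~ s)) /=.
apply: beq_trans (beq_cancel [:: (false, s); (true, s)]
  [:: (true, ~~ s); (false, ~~ s)] false s) _.
apply: beq_trans (beq_cancel [:: (false, s)] [:: (false, ~~ s)] true s) _.
exact: beq_inv.
Qed.

Lemma half_twist_invl s : half_twist (~~ s) ++ half_twist s ≡ [::].
Proof. by have := half_twist_inv (~~ s); rewrite negbK. Qed.

(** A letter with the sign of the twist passes because Delta can be written with either generator
    first. The opposite sign is reduced to this case by inserting a cancelling pair in front. *)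
Lemma half_twist_comm s g : half_twist s ++ [:: g] ≡ [:: flip g] ++ half_twist s.
Proof.
case: g => i t; rewrite /flip /=.
have same j : half_twist s ++ [:: (j, s)] ≡ [:: (~~ j, s)] ++ half_twist s.
  apply: beq_trans (beq_ctx [::] [:: (j, s)] (half_twistE (~~ j) s)) _.
  by rewrite (half_twistE j s) /= negbK.
have [->|ne_ts] := eqVneq t s; first exact: same.
have -> : t = ~~ s by case: (t) (s) ne_ts => [] [].
transitivity ([:: (~~ i, ~~ s); (~~ i, s)] ++ half_twist s ++ [:: (i, ~~ s)]).
  by rewrite beq_invl.
have := same i; rewrite -cat1s -[[:: (~~ i, ~~ s); _]]/([:: (~~ i, ~~ s)] ++ [:: _]).
rewrite -catA (catA [:: (~~ i, s)]) => <-.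
exact: (beq_ctx [:: (~~ i, ~~ s)] [::] (beq_cancel (half_twist s) [::] i s)).
Qed.

(** A half twist can be made to begin with either generator, hence cancels any letter of the
    opposite sign and leaves two letters of its own sign. *)
Lemma gen_half_twist i c :
  (i, c) :: half_twist (~~ c) ≡ [:: (~~ i, ~~ c); (i, ~~ c)].
Proof. rewrite (half_twistE i); exact: (beq_cancel [::] [:: (~~ i, ~~ c); (i, ~~ c)] i c).
Qed.

Local Open Scope ring_scope.

Definition twist_pow (k : int) : seq gen :=
  match k with
  | Posz m => flatten (nseq m (half_twist true))
  | Negz m => flatten (nseq m.+1 (half_twist false))
  end.

Definition sgb (s : bool) : int := if s then 1 else -1.

Lemma twist_powS s k : half_twist s ++ twist_pow k ≡ twist_pow (sgb s + k).
Proof.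
case: s; rewrite /sgb.
- case: k => [m|[|m]].
  + by have -> : 1 + Posz m = Posz m.+1 by lia.
  + have -> : 1 + Negz 0 = 0 by lia.
    exact: (half_twist_inv true).
  + have -> : 1 + Negz m.+1 = Negz m by lia.
    rewrite {1}/twist_pow -[flatten _]/(half_twist false ++ twist_pow (Negz m)) catA.
    by rewrite (half_twist_inv true).
- case: k => [[|m]|m].
  + by have -> : -1 + Posz 0 = Negz 0 by lia.
  + have -> : -1 + Posz m.+1 = Posz m by lia.
    rewrite {1}/twist_pow -[flatten _]/(half_twist true ++ twist_pow m) catA.
    by rewrite (half_twist_invl true).
  + by have -> : -1 + Negz m = Negz m.+1 by lia.
Qed.

Lemma twist_pow1 s : twist_pow (sgb s) = half_twist s.
Proof. by case: s; rewrite /sgb /= ?cats0. Qed.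

Lemma int_step_ind (P : int -> Prop) : P 0 ->
  (forall s k, P k -> P (sgb s + k)) -> forall k, P k.
Proof.
move=> P0 PS; elim/int_ind => // m Pm.
- by rewrite -addn1 PoszD addrC; apply: (PS true).
- by rewrite -addn1 PoszD opprD addrC; apply: (PS false).
Qed.

Lemma twist_powD j k : twist_pow j ++ twist_pow k ≡ twist_pow (j + k).
Proof.
elim/int_step_ind: j => [|s j IHj]; first by rewrite add0r.
by rewrite -twist_powS -catA IHj twist_powS addrA.
Qed.

Definition oddz (k : int) : bool := odd `|k|%N.

Lemma oddzS s k : oddz (sgb s + k) = ~~ oddz k.
Proof. by rewrite /oddz; case: s; rewrite /sgb; lia. Qed.

Definition flips (b : bool) : seq gen -> seq gen := map (if b then flip else id).

Lemma half_twist_flips s w : half_twist s ++ w ≡ flips true w ++ half_twist s.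
Proof.
elim: w => [|g w IHw]; first by rewrite cats0.
by rewrite -cat1s catA half_twist_comm -catA IHw.
Qed.

Lemma twist_pow_comm k w : twist_pow k ++ w ≡ flips (oddz k) w ++ twist_pow k.
Proof.
elim/int_step_ind: k w => [|s k IHk] w; first by rewrite /flips map_id cats0.
rewrite -twist_powS -catA IHk catA half_twist_flips -catA oddzS.
suff -> : flips true (flips (oddz k) w) = flips (~~ oddz k) w by [].
rewrite /flips -map_comp; case: (oddz k) => /=; apply: eq_map => //= x.
exact: flipK.
Qed.

Lemma twist_pow_central k w : ~~ oddz k -> twist_pow k ++ w ≡ w ++ twist_pow k.
Proof. by move=> /negbTE ev; rewrite twist_pow_comm ev /flips map_id. Qed.

Lemma letter_twist_same c :
  [:: letter c] ++ half_twist (~~ c) ++ [:: letter c] ≡ [:: letter (~~ c)].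
Proof.
rewrite catA; apply: beq_trans (beq_cat (gen_half_twist _ _) (beq_refl _)) _.
rewrite /letter negbK.
by have := beq_cancel [:: (c, ~~ c)] [::] (~~ c) (~~ c); rewrite negbK.
Qed.

(* Modulo the centre, a half twist between two letters is always absorbed. *)
Lemma letter_twist_letter c x i : oddz i ->
  [:: letter c] ++ twist_pow i ++ [:: letter x] ≡
  if x == c then twist_pow (i + sgb c) ++ [:: letter (~~ c)] else twist_pow i.
Proof.
move=> odd_i; have [->|ne] := eqVneq x c.
  have {1}-> : i = (i + sgb c) + sgb (~~ c) by rewrite /sgb; case: (c) => /=; lia.
  have ev : ~~ oddz (i + sgb c) by rewrite addrC oddzS odd_i.
  rewrite -twist_powD twist_pow1 -catA [X in X ≡ _]catA -(twist_pow_central _ ev).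
  by rewrite -catA letter_twist_same.
have -> : x = ~~ c by case: (x) (c) ne => [] [].
rewrite twist_pow_comm odd_i catA /flips /= /letter /flip /= negbK.
exact: (beq_cancel [::] (twist_pow i)).
Qed.

Definition letters : seq bool -> seq gen := map letter.

(** Twists are allowed at both ends because moving an odd power across a letter would turn it into
    its [flip], which is not a letter. Conjugation later unites the two powers. *)
Definition has_nf (w : seq gen) :=
  exists i al j, w ≡ twist_pow i ++ letters al ++ twist_pow j.

Lemma has_nf_beq w w' : w ≡ w' -> has_nf w' -> has_nf w.
Proof. by move=> e [i [al [j H]]]; exists i, al, j; rewrite e. Qed.

Lemma has_nf_twist s w : has_nf w -> has_nf (half_twist s ++ w).
Proof.
by move=> [i [al [j H]]]; exists (sgb s + i), al, j; rewrite H catA twist_powS.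
Qed.

Lemma has_nf_letter c w : has_nf w -> has_nf (letter c :: w).
Proof.
move=> [i [al [j H]]]; rewrite -cat1s.
have [odd_i|ev_i] := boolP (oddz i); last first.
  exists i, (c :: al), j.
  by rewrite H catA -(twist_pow_central _ ev_i) -catA.
case: al H => [|x al] H.
  by exists 0, [:: c], (i + j); rewrite H -twist_powD.
have H' : [:: letter c] ++ w ≡
    ([:: letter c] ++ twist_pow i ++ [:: letter x]) ++ letters al ++ twist_pow j.
  by rewrite H -!catA.
apply: has_nf_beq H' _; case: (x == c) (letter_twist_letter c x odd_i) => E.
- by exists (i + sgb c), (~~ c :: al), j; rewrite E -!catA.
- by exists i, al, j; rewrite E.
Qed.

Lemma has_nfP w : has_nf w.
Proof.
elim: w => [|[i s] w IHw]; first by exists 0, [::], 0.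
have [->|ne] := eqVneq i (~~ s); first exact: has_nf_letter.
(* The two generators outside the alphabet are conjugates of the letters by a half twist. *)
have -> : (i, s) = flip (letter s) by case: (i) (s) ne => [] [].
have e : flip (letter s) :: w ≡ half_twist true ++ letter s :: half_twist false ++ w.
  rewrite -[letter s :: _]/([:: letter s] ++ _) catA half_twist_comm -catA.
  by rewrite (catA (half_twist true)) half_twist_inv.
by apply: has_nf_beq e _; apply/has_nf_twist/has_nf_letter/has_nf_twist.
Qed.

(** A rotation puts an odd twist power between the last and the first letter. Equal letters merge
    into one and make the power even; distinct letters both disappear, which shortens the word. *)
Lemma conj_nf w : exists al k, iso (cl w) (cl (letters al ++ twist_pow k)) /\
  (~~ oddz k || (size al <= 1)%N).
Proof.
have [i [al [j /iso_beq H]]] := has_nfP w.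
have {H} : iso (cl w) (cl (letters al ++ twist_pow (j + i))).
  apply: iso_trans H _; apply: iso_trans (iso_rot _ _) _.
  by apply: iso_beq; rewrite -catA twist_powD.
move: {i j}(j + i) => k H.
have [n] := ubnP (size al); elim: n al k H => // n IHn al k H le_al.
have [odd_k|ev_k] := boolP (oddz k); last by exists al, k; rewrite ev_k.
case/lastP: al H le_al => [|al y] H le_al; first by exists [::], k; rewrite orbT.
case: al H le_al => [|x al] H le_al; first by exists [:: y], k; rewrite orbT.
have H' : iso (cl w) (cl (([:: letter y] ++ twist_pow k ++ [:: letter x]) ++ letters al)).
  apply: iso_trans H _; rewrite /letters map_rcons -cats1 -catA.
  apply: iso_trans (iso_rot _ _) _; rewrite -!catA /=.
  exact/iso_refl/closed_cl.
have {H'} := iso_trans H' (iso_beq (beq_ctx [::] (letters al) (letter_twist_letter y x odd_k))).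
rewrite !cat0s size_rcons in le_al *; case: eqP => [_|_] H'.
- exists (~~ y :: al), (k + sgb y); split; last by rewrite addrC oddzS odd_k.
  apply: iso_trans H' _; rewrite -catA.
  exact: iso_rot.
- by apply: (IHn al k); [exact: iso_trans H' (iso_rot _ _) | apply: ltnW].
Qed.

(** * Adequacy from colourings *)

Local Open Scope nat_scope.

(* [step v g r r']: the colouring passes from [r] to [r'] across the crossing
   [g], which is spliced vertically if its sign is [v], so that it is constant
   along the arcs of the splicing and distinguishes the two arcs. *)
Definition step (v : bool) (g : gen) (r r' : nat -> nat) : Prop :=
  if g.2 == v then (forall j, j < 3 -> r' j = r j) /\ r g.1 != r g.1.+1
  else [/\ r g.1 = r g.1.+1, r' g.1 = r' g.1.+1, r g.1 != r' g.1 &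
           forall j, j < 3 -> j != g.1 -> j != g.1.+1 -> r' j = r j].

Fixpoint run (v : bool) (r : nat -> nat) (w : seq gen) (r' : nat -> nat) : Prop :=
  if w is g :: w' then exists2 r1, step v g r r1 & run v r1 w' r'
  else r = r'.

Lemma run_rows v r w r' : run v r w r' -> exists R : nat -> nat -> nat,
  [/\ R 0 = r, R (size w) = r' &
      forall k, k < size w -> step v (nth (false, false) w k) (R k) (R k.+1)].
Proof.
elim: w r => [|g w IHw] r /= => [H|[r1 st /IHw[R [R0 Rn Rs]]]]; first by exists (fun _ => r).
exists (fun k => if k is k'.+1 then R k' else r); split=> // -[|k] lt_k /=.
  by rewrite R0.
exact: Rs.
Qed.

Lemma size_cl w : size (cl w) = size w + 6.
Proof. by rewrite /cl !size_cat size_map /= addnC -addnA. Qed.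

Lemma nth_cl d w k : k < size (cl w) ->
  nth d (cl w) k = if k < 3 then Slice Cup k else
                   if k < size w + 3 then gslice (nth (false, false) w (k - 3))
                   else Slice Cap (size w + 5 - k).
Proof.
rewrite size_cl /cl => lt_k; rewrite nth_cat /=.
case: ltnP => [|le3k]; first by case: k lt_k => [|[|[|k]]].
rewrite nth_cat size_map; have -> : (k - 3 < size w) = (k < size w + 3) by lia.
case: ltnP => [lt|le]; first by rewrite (nth_map ((false, false) : gen)) //; lia.
have e : k = size w + 3 + (k - 3 - size w) by lia.
have lt3 : k - 3 - size w < 3 by lia.
have -> : size w + 5 - k = 2 - (k - 3 - size w) by lia.
by case: (k - 3 - size w) lt3 => [|[|[|m]]].
Qed.

Lemma connect_colour (T : finType) (e : rel T) (C : eqType) (f : T -> C) :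
  (forall x y, e x y -> f x = f y) -> forall x y, connect e x y -> f x = f y.
Proof.
move=> fe x y /connectP[p + ->]; elim: p x => //= z p IHp x /andP[/fe-> /IHp].
by [].
Qed.

Section Adequate.
Variables (v : bool) (r : nat -> nat) (w : seq gen).
Hypothesis run_w : run v r w r.
Let D := LinkDiagram (closed_cl w).
Let s : 'I_(size D) -> treatment := fun _ => if v then ASpliced else BSpliced.

(** The rows of the run extend to a colouring [F] of all points that is constant along arcs, hence
    on loops of the state. The two arcs at each crossing have different colours, so they lie on
    different loops. The run must end with its initial row for the colouring to close up. *)
Lemma run_adequate : [forall k in crossings D, ~~ self_touching s k].
Proof.
have [R [R0 Rn Rs]] := run_rows run_w; set n := size w in Rn Rs.
(* Line [k < 3] has [2 * k] points, joined in nested pairs [j] and [2 * k - 1 - j]; the lines among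
   the maxima are symmetric, with [k'] in place of [k]. In between, the left three strands carry the
   rows, and point [5 - j] has the constant colour [r j]. *)
pose F (p : nat * nat) := let k := p.1 in let j := p.2 in
  if k < 3 then r (if j < k then j else 2 * k - 1 - j)
  else if k <= n + 3 then (if j < 3 then R (k - 3) j else r (5 - j))
  else let k' := n + 6 - k in r (if j < k' then j else 2 * k' - 1 - j).
have slE (k : 'I_(size D)) : slice_at k = if k < 3 then Slice Cup k else
     if k < n + 3 then gslice (nth (false, false) w (k - 3)) else Slice Cap (n + 5 - k).
  by rewrite /slice_at (tnth_nth (Slice Cup 0)) nth_cl.
have FE k j : F (k, j) = if k < 3 then r (if j < k then j else 2 * k - 1 - j)
  else if k <= n + 3 then (if j < 3 then R (k - 3) j else r (5 - j))
  else r (if j < n + 6 - k then j else 2 * (n + 6 - k) - 1 - j) by [].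
have Fmid k j : k <= n -> F (k + 3, j) = if j < 3 then R k j else r (5 - j).
  by move=> le_kn; rewrite FE ifF 1?ifT ?addnK //; lia.
have Farc (p q : point D) : Defs.arc s p q -> F (val p) = F (val q).
  case/existsP=> k; case: (val p) (val q) => [k1 j1] [k2 j2]; move: k1 j1 k2 j2.
  suff H (k1 j1 k2 j2 : nat) : side_arc (slice_at k) k (k1, j1) (k2, j2)
    || (((k1, j1), (k2, j2)) \in inner_arcs (slice_at k) (s k) k) ->
    F (k1, j1) = F (k2, j2) by exact: H.
  have := ltn_ord k; rewrite {2}size_cl slE -/n /s.
  move: (nat_of_ord k) => {}k lt_k.
  case: (ltnP k 3) => [lt_k3|le3k].
    have F3 j : F (k.+1, j) = r (if j < k.+1 then j else 2 * k.+1 - 1 - j).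
      rewrite FE; case: (ltnP k.+1 3) => // le; have e : k = 2 by lia.
      rewrite e ifT //; last by lia.
      by rewrite R0; case: ltnP.
    have F0 j : F (k, j) = r (if j < k then j else 2 * k - 1 - j).
      by rewrite FE lt_k3.
    case/orP => [/and3P[/= /eqP-> /eqP->]|].
      rewrite F3 F0 /= => H; congr r; do 2!case: ifP; lia.
    rewrite inE => /eqP[-> -> -> ->]; rewrite !F3 ltnSn ltnn; congr r; lia.
  case: (ltnP k (n + 3)) => [lt_kn|le_nk]; last first.
    have F0 j : F (k, j) =
        r (if j < n + 6 - k then j else 2 * (n + 6 - k) - 1 - j).
      rewrite FE ifF; last by lia.
      case: ifP => // le; have e : k = n + 3 by lia.
      rewrite e addnK; case: ltnP => [lt|le']; first by rewrite Rn // ifT //; lia.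
      rewrite ifF; last by lia.
      by congr r; lia.
    have F1 j : F (k.+1, j) =
        r (if j < n + 5 - k then j else 2 * (n + 5 - k) - 1 - j).
      rewrite FE ifF; last by lia.
      rewrite ifF; last by lia.
      by congr r; have -> : n + 6 - k.+1 = n + 5 - k by lia.
    case/orP => [/and3P[/= /eqP-> /eqP->]|].
      rewrite F1 F0 /= => H; congr r; do 2!case: ifP; lia.
    rewrite inE => /eqP[-> -> -> ->]; rewrite !F0; congr r.
    do 2!case: ifP; lia.
  have := Rs (k - 3); rewrite -/n; case: (nth _ w (k - 3)) => i b /=.
  have e : k = (k - 3) + 3 by lia.
  have le_k : k - 3 < n by lia.
  move: (k - 3) e le_k => m e le_m /(_ le_m); rewrite /step /= => st.
  have F0 j : F (k, j) = if j < 3 then R m j else r (5 - j).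
    by rewrite e Fmid // ltnW.
  have F1 j : F (k.+1, j) = if j < 3 then R m.+1 j else r (5 - j).
    by rewrite e -addSn Fmid.
  have i3 : nat_of_bool i < 3 by case: (i).
  have i3' : i.+1 < 3 by case: (i).
  case/orP => [/and3P[/= /eqP-> /eqP->]|].
    rewrite F1 F0 /= => H.
    have -> : j2 = j1 by lia.
    case: ifP => // lt_j; case: eqP st => [_ [-> //]|_ [_ _ _ -> //]]; lia.
  rewrite /crossing_arcs /=; case: eqP st => [->|/eqP ne] st.
    case: st => st _.
    by case: (v); rewrite !inE => /orP[] /eqP[-> -> -> ->]; rewrite F0 F1 ?i3 ?i3' st.
  case: st => st1 st2 _ _.
  by case: (v) (b) ne => [] [] //= _; rewrite !inE => /orP[] /eqP[-> -> -> ->];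
    rewrite ?F0 ?F1 ?i3 ?i3'.
have Fconn (p q : point D) : connect (joined s) p q -> F (val p) = F (val q).
  apply: (@connect_colour _ (joined s) _ (fun p => F (val p))) => {}p {}q.
  by rewrite /joined => /orP[/Farc|/Farc].
apply/forallP=> k; apply/implyP; rewrite inE slE => crk.
apply/existsP=> -[p] /existsP[q] /and3P[/eqP ep /eqP eq /Fconn].
rewrite ep eq slE /=; move: (nat_of_ord k) crk => {ep eq}k; case: ifP => // lt3; case: ifP => // ltn _.
have := Rs (k - 3); rewrite -/n; case: (nth _ w (k - 3)) => i b /=.
have e : k = (k - 3) + 3 by lia.
have le_k : k - 3 < n by lia.
move: (k - 3) e le_k => m e le_m /(_ le_m); rewrite /step /= => st.
rewrite e -addSn !Fmid //; last exact: ltnW.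
have -> : nat_of_bool i < 3 by case: (i).
have i3' : i.+1 < 3 by case: (i).
rewrite i3' => E; case: eqP st => _ st.
- by case: st => st /eqP[]; rewrite E st.
- by case: st => _ st /eqP[]; rewrite E st.
Qed.
End Adequate.

Lemma run_semiadequate v r w : run v r w r -> semiadequate (LinkDiagram (closed_cl w)).
Proof.
by case: v => /run_adequate H; apply/orP; [left | right]; exact: H.
Qed.

(** * Semiadequacy of closed 3-braids *)

Fixpoint fits (n : nat) (w : seq slice) : bool :=
  if w is l :: w' then (pos l + ins (kind l) <= n) && fits (next_width n l) w' else true.

Lemma closed_cat n u w :
  closed_from n (u ++ w) = fits n u && closed_from (foldl next_width n u) w.
Proof. by elim: u n => //= l u IHu n; rewrite IHu andbA. Qed.

(** * Local isotopies, kinks, free circles and unlinks *)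

Definition stays (n : nat) (w : seq slice) : bool :=
  fits n w && (foldl next_width n w == n).

Lemma iso_local w1 w2 l r u v : move l r -> closed_from 0 (u ++ v) ->
  stays (foldl next_width 0 u) (w1 ++ l ++ w2) ->
  stays (foldl next_width 0 u) (w1 ++ r ++ w2) ->
  iso (u ++ (w1 ++ l ++ w2) ++ v) (u ++ (w1 ++ r ++ w2) ++ v).
Proof.
move=> m; rewrite closed_cat; set N := foldl _ _ _ => /andP[fu clv] sl sr.
have E w : stays N w -> closed_from 0 (u ++ w ++ v).
  by move=> /andP[fw /eqP ew]; rewrite closed_cat fu closed_cat -/N fw ew.
apply: (iso_move_eq m (u := u ++ w1) (v := w2 ++ v)); rewrite -?catA //.
- by have := E _ sl; rewrite -!catA.
- by have := E _ sr; rewrite -!catA.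
Qed.

(** Sliding the crossing across the maximum puts it on the two strands of the minimum, where
    Reidemeister I removes it; the zigzag left is straightened. *)
Lemma iso_remove_kink u v i s : i < foldl next_width 0 u -> closed_from 0 (u ++ v) ->
  iso (u ++ [:: Slice Cup i.+1; Slice (Cross s) i; Slice Cap i.+1] ++ v) (u ++ v).
Proof.
move=> lt_iN cl_uv.
apply: (@iso_trans (u ++ [:: Slice Cup i.+1; Slice (Cross (~~ s)) i.+1; Slice Cap i] ++ v)).
  apply: iso_sym; have := move_cap_slide (~~ s) i; rewrite negbK => m.
  apply: (iso_local (w1 := [:: Slice Cup i.+1]) (w2 := [::]) m) => //;
  by move: lt_iN; rewrite /stays /= /next_width /=; lia.
apply: (@iso_trans (u ++ [:: Slice Cup i.+1; Slice Cap i] ++ v)).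
  apply: (iso_local (w1 := [::]) (w2 := [:: Slice Cap i]) (move_R1_cup (~~ s) i.+1)) => //;
  by move: lt_iN; rewrite /stays /= /next_width /=; lia.
apply: (iso_local (w1 := [::]) (w2 := [::]) (move_zigzag_r i)) => //;
by move: lt_iN; rewrite /stays /= /next_width /=; lia.
Qed.

(** The circle is pulled across the strand: Reidemeister II creates two crossings, these slide past
    the minimum and the maximum, and a second Reidemeister II removes them. *)
Lemma iso_circle_left u v i : i < foldl next_width 0 u -> closed_from 0 (u ++ v) ->
  iso (u ++ [:: Slice Cup i.+1; Slice Cap i.+1] ++ v)
      (u ++ [:: Slice Cup i; Slice Cap i] ++ v).
Proof.
move=> lt_iN cl_uv.
apply: (@iso_trans (u ++ [:: Slice Cup i.+1; Slice (Cross true) i;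
    Slice (Cross false) i; Slice Cap i.+1] ++ v)).
  apply: iso_sym; apply: (iso_local (w1 := [:: Slice Cup i.+1])
    (w2 := [:: Slice Cap i.+1]) (move_R2 true i)) => //;
  by move: lt_iN; rewrite /stays /= /next_width /=; lia.
apply: (@iso_trans (u ++ [:: Slice Cup i; Slice (Cross false) i.+1;
    Slice (Cross false) i; Slice Cap i.+1] ++ v)).
  apply: iso_sym; apply: (iso_local (w1 := [::])
    (w2 := [:: Slice (Cross false) i; Slice Cap i.+1]) (move_cup_slide false i)) => //;
  by move: lt_iN; rewrite /stays /= /next_width /=; lia.
apply: (@iso_trans (u ++ [:: Slice Cup i; Slice (Cross false) i.+1;
    Slice (Cross true) i.+1; Slice Cap i] ++ v)).
  apply: iso_sym; apply: (iso_local (w1 := [:: Slice Cup i; Slice (Cross false) i.+1])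
    (w2 := [::]) (move_cap_slide true i)) => //;
  by move: lt_iN; rewrite /stays /= /next_width /=; lia.
apply: (iso_local (w1 := [:: Slice Cup i]) (w2 := [:: Slice Cap i])
  (move_R2 false i.+1)) => //;
by move: lt_iN; rewrite /stays /= /next_width /=; lia.
Qed.

(** A circle at the far left has no strand beside it on the left, so it is exchanged with the slices
    above it one by one. *)
Lemma iso_circle_up u v : closed_from 0 (u ++ v) ->
  iso (u ++ [:: Slice Cup 0; Slice Cap 0] ++ v) (u ++ v ++ [:: Slice Cup 0; Slice Cap 0]).
Proof.
have cl_circle x n y : closed_from n (y ++ x) ->
    closed_from n (y ++ [:: Slice Cup 0; Slice Cap 0] ++ x).
  rewrite !closed_cat; set N := foldl _ _ _ => /andP[-> H].
  rewrite /= /next_width /= (_ : N - 0 + 2 - 2 + 0 = N); last by lia.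
  by rewrite H andbT; lia.
elim: v u => [|[s i] v IHv] u cl_uv.
  by rewrite !cats0; apply: iso_refl; have := cl_circle _ _ _ cl_uv; rewrite cats0.
have cl' : closed_from 0 ((u ++ [:: Slice s i]) ++ v) by rewrite -catA.
have := IHv _ cl'; rewrite -!catA => H; apply: iso_trans H => {IHv}.
have [/andP[fi clv] fu] : (i + ins s <= foldl next_width 0 u) &&
    closed_from (next_width (foldl next_width 0 u) (Slice s i)) v /\ fits 0 u.
  by move: cl_uv; rewrite closed_cat /= => /andP[].
apply: (@iso_trans (u ++ [:: Slice Cup 0; Slice s (i + 2); Slice Cap 0] ++ v)).
  apply: (iso_move_eq (move_exchange Cap s 0 i) (u := u ++ [:: Slice Cup 0]) (v := v)) => /=.
  - by rewrite -!catA /= addn0.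
  - by rewrite -!catA /= add0n addnC.
  - by apply: cl_circle.
  - move: clv; rewrite closed_cat fu /= /next_width /= subn0.
    set N := foldl _ _ _ in fi *; move=> clv; rewrite !andbA; apply/andP; split; first by lia.
    by rewrite (_ : N + 2 - ins s + outs s - 2 + 0 = N - ins s + outs s) //; lia.
apply: (iso_move_eq (move_exchange Cup s 0 i) (u := u) (v := Slice Cap 0 :: v)) => /=.
- by rewrite add0n addnC.
- by rewrite addn0 add0n.
- move: clv; rewrite closed_cat fu /= /next_width /= subn0.
  set N := foldl _ _ _ in fi *; move=> clv; rewrite !andbA; apply/andP; split; first by lia.
  by rewrite (_ : N + 2 - ins s + outs s - 2 + 0 = N - ins s + outs s) //; lia.
- by have := cl_circle _ _ _ cl'; rewrite -catA.
Qed.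

Lemma iso_low_crossing s w : iso (cl ((false, s) :: w))
  ([:: Slice Cup 0; Slice Cup 1; Slice (Cross s) 0; Slice Cup 2] ++ map gslice w ++
   [:: Slice Cap 2; Slice Cap 1; Slice Cap 0]).
Proof.
apply: iso_sym; apply: (iso_move_eq (move_exchange (Cross s) Cup 0 0)
    (u := [:: Slice Cup 0; Slice Cup 1]) (v := map gslice w ++ [:: Slice Cap 2;
      Slice Cap 1; Slice Cap 0])) => //=;
by rewrite /= closed_gens.
Qed.

(** Two destabilizations: once the crossing of the first two strands is moved below the third
    minimum, the other crossing is a kink on the second strand, and then the first crossing becomes
    a kink too. *)
Lemma iso_unknot i s s' : iso (cl [:: (i, s); (~~ i, s')]) (unlink_slices 1).
Proof.
suff low t t' : iso (cl [:: (false, t); (true, t')]) (unlink_slices 1).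
  by case: i; [apply: iso_trans (iso_rot [:: _] [:: _]) (low s' s) | apply: low].
apply: iso_trans (iso_low_crossing _ _) _.
apply: iso_trans (@iso_remove_kink [:: Slice Cup 0; Slice Cup 1; Slice (Cross t) 0]
  [:: Slice Cap 1; Slice Cap 0] 1 t' _ _) _ => //.
exact: (@iso_remove_kink [:: Slice Cup 0] [:: Slice Cap 0] 0 t).
Qed.

Lemma iso_outer_circle : iso [:: Slice Cup 0; Slice Cup 1; Slice Cap 1; Slice Cap 0]
  (unlink_slices 2).
Proof.
apply: iso_trans (@iso_circle_left [:: Slice Cup 0] [:: Slice Cap 0] 0 _ _) _ => //.
exact: (@iso_circle_up [:: Slice Cup 0] [:: Slice Cap 0]).
Qed.

Lemma iso_unlink2 i s : iso (cl [:: (i, s)]) (unlink_slices 2).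
Proof.
case: i.
  apply: iso_trans (@iso_remove_kink [:: Slice Cup 0; Slice Cup 1]
    [:: Slice Cap 1; Slice Cap 0] 1 s _ _) _ => //.
  exact: iso_outer_circle.
apply: iso_trans (iso_low_crossing _ _) _; set u := [:: Slice Cup 0; Slice Cup 1; Slice (Cross s) 0].
apply: iso_trans (@iso_circle_left u [:: Slice Cap 1; Slice Cap 0] 1 _ _) _ => //.
apply: iso_trans (@iso_circle_left u [:: Slice Cap 1; Slice Cap 0] 0 _ _) _ => //.
apply: iso_trans (@iso_circle_up u [:: Slice Cap 1; Slice Cap 0] _) _ => //.
exact: (@iso_remove_kink [:: Slice Cup 0] [:: Slice Cap 0; Slice Cup 0; Slice Cap 0] 0 s).
Qed.

Lemma iso_unlink3 : iso (cl [::]) (unlink_slices 3).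
Proof.
set u := [:: Slice Cup 0; Slice Cup 1]; set v := [:: Slice Cap 1; Slice Cap 0].
apply: iso_trans (@iso_circle_left u v 1 _ _) _ => //.
apply: iso_trans (@iso_circle_left u v 0 _ _) _ => //.
apply: iso_trans (@iso_circle_up u v _) _ => //.
set c := [:: Slice Cup 0; Slice Cap 0].
apply: iso_trans (@iso_circle_left [:: Slice Cup 0] (Slice Cap 0 :: c) 0 _ _) _ => //.
exact: (@iso_circle_up [:: Slice Cup 0] (Slice Cap 0 :: c)).
Qed.

(** * Colourings of one-signed and alternating words *)

Definition one_signed (s : bool) (w : seq gen) := all (fun g => g.2 == s) w.

Definition zero_row (j : nat) : nat := 0.

(** The typical row next to horizontal splicings at position [i]: their two strands share the colour
    [x] of a small circle, and the third strand has the colour 0 of the large loop. *)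
Definition pair_row (i : bool) (x j : nat) : nat :=
  if (j == i) || (j == i.+1) then x else 0.

Lemma run_cat v r u r1 w r' : run v r u r1 -> run v r1 w r' -> run v r (u ++ w) r'.
Proof.
elim: u r => [|g u IHu] r /=; first by move=> ->.
by move=> [r2 st rn] rn'; exists r2 => //; apply: IHu.
Qed.

(** With all crossings spliced vertically the state consists of three nested circles, so a constant
    run suffices. *)
Lemma run_mono s w (r : nat -> nat) : r 0 != r 1 -> r 1 != r 2 ->
  one_signed s w -> run s r w r.
Proof.
rewrite /one_signed => r01 r12; elim: w => [|[i t] w IHw] //= /andP[/= /eqP-> mw].
by exists r; [rewrite /step /= (eqxx s); split=> //; case: i | apply: IHw].
Qed.

Lemma step_vertical v i x : 0 < x -> step v (~~ i, v) (pair_row i x) (pair_row i x).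
Proof. by move=> x0; rewrite /step /= (eqxx v) /pair_row; split=> //; case: i => /=; lia. Qed.

Lemma step_horizontal v i x y : x != y ->
  step v (i, ~~ v) (pair_row i x) (pair_row i y).
Proof.
move=> ne; rewrite /step /= ifF; last by case: v.
by rewrite /pair_row !eqxx !orbT /=; split=> // j _ /negbTE-> /negbTE->.
Qed.

Lemma step_to_zero v i x : 0 < x -> step v (i, ~~ v) (pair_row i x) zero_row.
Proof.
move=> x0; rewrite /step /= ifF; last by case: v.
rewrite /pair_row !eqxx !orbT /=; split=> //; first by rewrite -lt0n.
by move=> j _ /negbTE-> /negbTE->.
Qed.

Lemma step_from_zero v i x : 0 < x -> step v (i, ~~ v) zero_row (pair_row i x).
Proof.
move=> x0; rewrite /step /= ifF; last by case: v.
rewrite /pair_row !eqxx !orbT /=; split=> //; first by rewrite eq_sym -lt0n.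
by move=> j _ /negbTE-> /negbTE->.
Qed.

Lemma run_to_zero v i x l : 0 < x ->
  run v (pair_row i x) (nseq l.+1 (i, ~~ v)) zero_row.
Proof.
elim: l x => [|l IHl] x x0; first by exists zero_row => //; apply: step_to_zero.
exists (pair_row i x.+1); last exact: IHl.
by apply: step_horizontal; lia.
Qed.

(** The letters [~~ c] are spliced horizontally and each must change the positive colour; the
    letters [c] keep it. Hence the condition compares [x] and [y] only when there are fewer than two
    changes. *)
Lemma run_letters c x y al : 0 < x -> 0 < y ->
  (let t := count_mem (~~ c) al in
   [|| 1 < t, (t == 1) && (x != y) | (t == 0) && (x == y)]) ->
  run c (pair_row c x) (letters al) (pair_row c y).
Proof.
move=> + y0; elim: al x => [|d al IHal] x x0 /=; first by move=> /eqP->.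
have [->|/negbTE ne] := eqVneq d (~~ c).
- rewrite /letter /= negbK => H.
  (* The new colour [z] depends on the number [t] of changes still to come: with none, [z = y]; with
     one, [z] must avoid both [x] and [y], as [x + y] does; with more, any other positive colour
     will do. *)
  have [z z0 Hz] : exists2 z, 0 < z & (x != z) && (let t := count_mem (~~ c) al in
     [|| 1 < t, (t == 1) && (z != y) | (t == 0) && (z == y)]).
    move: (count_mem _ _) H => t H.
    case: (ltngtP t 1) H => [|lt1|->] H /=.
    + by case: t H => // _; rewrite /= => H; exists y => //; rewrite eqxx; lia.
    + by exists x.+1 => //; lia.
    + by exists (x + y); lia.
  case/andP: Hz => xz Hz; exists (pair_row c z); last exact: IHal.
  exact: step_horizontal.
- rewrite add0n => H; have -> : d = c by case: (d) (c) ne => [] [].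
  by exists (pair_row c x); [apply: step_vertical | apply: IHal].
Qed.

(** * Absorption of half twists by letters of the opposite sign *)

Definition twists (s : bool) (n : nat) : seq gen := flatten (nseq n (half_twist s)).

Lemma twist_pow_twists k : exists s n, twist_pow k = twists s n /\ n = `|k|%N.
Proof. by case: k => n; [exists true, n | exists false, n.+1]. Qed.


Lemma count_flips (c b : bool) w :
  count (fun g : gen => g.2 == c) (flips b w) = count (fun g => g.2 == c) w.
Proof. by rewrite count_map; apply: eq_count; case: b => -[]. Qed.

(** Each half twist is moved left to a letter of sign [c], flipping what it passes, and cancels it
    by [gen_half_twist]. Flipping keeps signs, so the count of such letters drops by exactly one. *)
Lemma beq_mono c w n : count (fun g : gen => g.2 == c) w <= n ->
  exists2 w', w ++ twists (~~ c) n ≡ w' & one_signed (~~ c) w'.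
Proof.
elim: n w => [|n IHn] w H.
  exists w; first by rewrite cats0.
  rewrite /one_signed -[all _ _]negbK -has_predC has_count.
  rewrite -leqNgt (leq_trans _ H) // sub_count // => g /=.
  by case: (g.2) (c) => [] [].
have [mw|] := boolP (one_signed (~~ c) w).
  exists (w ++ twists (~~ c) n.+1) => //.
  rewrite /one_signed all_cat -/(one_signed _ w) mw /=.
  by rewrite !eqxx /=; elim: (n) => //= m ->; rewrite !eqxx.
rewrite /one_signed -has_predC => /hasP[[i d] gw /= ne].
case/splitPr: gw H => u1 u2; have {ne} -> : d = c by case: (d) (c) ne => [] [].
rewrite count_cat /= eqxx => H.
have [|w' E mw'] := IHn (u1 ++ [:: (~~ i, ~~ c); (i, ~~ c)] ++ flips true u2).
  rewrite !count_cat /= count_flips; have -> : (~~ c == c) = false by case: (c).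
  by move: H; rewrite addnCA.
exists w' => //; rewrite -E -!catA; apply: beq_cat => //.
rewrite -[(_ :: u2) ++ _]/([:: (i, c)] ++ u2 ++ half_twist (~~ c) ++ twists (~~ c) n).
transitivity ([:: (i, c)] ++ half_twist (~~ c) ++ flips true u2 ++ twists (~~ c) n).
  apply: beq_cat => //; rewrite !catA; apply: beq_cat => //.
  rewrite half_twist_flips /flips -map_comp (@eq_map _ _ _ id) ?map_id //.
  exact: flipK.
rewrite (catA [:: (i, c)]); apply: beq_cat => //; exact: gen_half_twist.
Qed.

(** For [c = true], write a and b for the letters and s for the flip of b. Then a Delta^-1 = b s,
    used at the second a; the other half twist moves left through b^k b s, turning it into s^k s b,
    and is absorbed by the first a. *)
Lemma half_twist_sandwich c k :
  [:: letter c] ++ nseq k (letter (~~ c)) ++ [:: letter c] ++ twists (~~ c) 2 ≡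
  [:: letter (~~ c)] ++ nseq k.+2 (flip (letter (~~ c))) ++ [:: letter (~~ c)].
Proof.
have E : [:: letter c] ++ half_twist (~~ c) ≡
    [:: letter (~~ c); flip (letter (~~ c))].
  by have := gen_half_twist (~~ c) c; rewrite /letter /flip /= negbK.
have -> : twists (~~ c) 2 = half_twist (~~ c) ++ half_twist (~~ c) by rewrite /twists /= ?cats0.
rewrite (catA [:: letter c] (half_twist _)) E.
transitivity ([:: letter c] ++ half_twist (~~ c) ++
    flips true (nseq k (letter (~~ c)) ++ [:: letter (~~ c); flip (letter (~~ c))])).
  apply: beq_cat => //; rewrite half_twist_flips !catA; apply: beq_cat => //.
  rewrite /flips -map_comp (@eq_map _ _ _ id) ?map_id //.
  exact: flipK.
rewrite catA E /flips map_cat map_nseq /= flipK -[_ :: _ :: nseq _ _ ++ _]/([:: _] ++ _).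
move: (letter (~~ c)) (flip (letter (~~ c))) => b fb.
have -> : [:: b] ++ fb :: nseq k fb ++ [:: fb; b] =
    b :: fb :: (nseq k fb ++ nseq 1 fb) ++ [:: b] by rewrite -catA.
by rewrite -nseqD addn1.
Qed.

Lemma split_letter c al : 0 < count_mem c al -> exists k al',
  al = nseq k (~~ c) ++ c :: al' /\ count_mem c al = (count_mem c al').+1.
Proof.
elim: al => //= d al IHal; have [->|/negbTE ne] := eqVneq d c.
  by exists 0, al.
rewrite add0n => /IHal[k [al' [-> ->]]]; exists k.+1, al'.
by have -> : d = ~~ c by case: (d) (c) ne => [] [].
Qed.

Lemma twists_central s n w : w ++ twists s n.+2 ≡ twists s 2 ++ w ++ twists s n.
Proof.
rewrite -[twists s n.+2]/(half_twist s ++ half_twist s ++ twists s n).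
rewrite -[twists s 2]/(half_twist s ++ half_twist s) -catA.
have comm u v : u ++ half_twist s ++ v ≡ half_twist s ++ flips true u ++ v.
  rewrite !catA half_twist_flips /flips -map_comp (@eq_map _ _ _ id) ?map_id //.
  exact: flipK.
rewrite comm comm /flips -map_comp (@eq_map _ _ _ id) ?map_id //.
exact: flipK.
Qed.

Lemma absorb_twists c l k al n :
  letters (nseq l (~~ c) ++ c :: nseq k (~~ c) ++ c :: al) ++ twists (~~ c) n.+2 ≡
  nseq l.+1 (letter (~~ c)) ++ nseq k.+2 (flip (letter (~~ c))) ++
  [:: letter (~~ c)] ++ letters al ++ twists (~~ c) n.
Proof.
have -> : letters (nseq l (~~ c) ++ c :: nseq k (~~ c) ++ c :: al) =
    nseq l (letter (~~ c)) ++ [:: letter c] ++ nseq k (letter (~~ c)) ++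
    [:: letter c] ++ letters al.
  by rewrite /letters map_cat /= map_cat /= !map_nseq.
have -> : nseq l.+1 (letter (~~ c)) = nseq l (letter (~~ c)) ++ [:: letter (~~ c)].
  by rewrite -[[:: _]]/(nseq 1 _) -nseqD addn1.
rewrite -!catA twists_central; apply: beq_cat => //.
have := half_twist_sandwich c k; rewrite !catA => H.
by apply: beq_cat => //; apply: beq_cat.
Qed.

Lemma run_letters_to c y al : 0 < y ->
  exists2 x, 0 < x & run c (pair_row c x) (letters al) (pair_row c y).
Proof.
move=> y0; case: (posnP (count_mem (~~ c) al)) => [e0|gt0].
  by exists y => //; apply: run_letters => //; rewrite /= e0 eqxx.
exists y.+1 => //; apply: run_letters => //=; move: (count_mem _ _) gt0 => t; lia.
Qed.

(** Each pair of letters [c] absorbs a full twist. Between the blocks so created the row is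
    [zero_row], the colour of the one large loop, so the colours at the two ends can be prescribed
    independently. *)
Lemma run_absorbed c m al : 2 * m.+1 <= count_mem c al ->
  exists2 w, letters al ++ twists (~~ c) (2 * m.+1) ≡ w &
  forall x y, 0 < x -> 0 < y -> run c (pair_row c x) w (pair_row c y).
Proof.
elim: m al => [|m IHm] al le_m;
  (have [|l [al1 [e1 c1]]] := @split_letter c al; first by move: (count_mem _ _) le_m => t; lia);
  (have [|k [al2 [e2 c2]]] := @split_letter c al1;
     first by move: c1 le_m; do 2!move: (count_mem _ _) => ?; lia).
- exists (nseq l.+1 (letter (~~ c)) ++ nseq k.+2 (flip (letter (~~ c))) ++
    [:: letter (~~ c)] ++ letters al2).
    rewrite e1 e2 /= -[2 * 1]/2 absorb_twists.
    by have -> : twists (~~ c) 0 = [::] by []; rewrite cats0.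
  move=> x y x0 y0; have [z z0 rz] := run_letters_to c al2 y0.
  apply: run_cat; first by rewrite /letter negbK; apply: run_to_zero.
  have -> : flip (letter (~~ c)) = (~~ c, ~~ c) by rewrite /flip /letter /= negbK.
  apply: (@run_cat _ _ _ zero_row).
    by exists (pair_row (~~ c) 1); [apply: step_from_zero | apply: run_to_zero].
  exists (pair_row c z); last exact: rz.
  by rewrite /letter negbK; apply: step_from_zero.
- have [|w Ew rw] := IHm al2.
    by move: c1 c2 le_m; do 3!move: (count_mem _ _) => ?; lia.
  exists (nseq l.+1 (letter (~~ c)) ++ nseq k.+2 (flip (letter (~~ c))) ++
    [:: letter (~~ c)] ++ w).
    rewrite e1 e2 (_ : 2 * m.+2 = (2 * m.+1).+2); last by lia.
    by rewrite absorb_twists Ew.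
  move=> x y x0 y0.
  apply: run_cat; first by rewrite /letter negbK; apply: run_to_zero.
  have -> : flip (letter (~~ c)) = (~~ c, ~~ c) by rewrite /flip /letter /= negbK.
  apply: (@run_cat _ _ _ zero_row).
    by exists (pair_row (~~ c) 1); [apply: step_from_zero | apply: run_to_zero].
  exists (pair_row c 1); last exact: rw.
  by rewrite /letter negbK; apply: step_from_zero.
Qed.

(** * Semiadequacy of the normal forms *)

Definition semiadequate_word (w : seq gen) :=
  exists w' h, iso (cl w) w' /\ semiadequate (@LinkDiagram w' h).

Lemma semiadequate_run v r w w' : w ≡ w' -> run v r w' r -> semiadequate_word w.
Proof.
move=> /iso_beq i /run_semiadequate sa.
by exists (cl w'), (closed_cl w').
Qed.

Lemma semiadequate_mono s w w' : w ≡ w' -> one_signed s w' ->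
  semiadequate_word w.
Proof.
by move=> e m; apply: (semiadequate_run e (run_mono (r := id) _ _ m)).
Qed.

Lemma semiadequate_alternating c al : 1 < count_mem (~~ c) al ->
  semiadequate_word (letters al).
Proof.
move=> lt1; apply: (@semiadequate_run c (pair_row c 1) _ (letters al)) => //.
by apply: run_letters; rewrite //= lt1.
Qed.

Lemma semiadequate_unknot i s s' : semiadequate_word [:: (i, s); (~~ i, s')].
Proof.
exists (unlink_slices 1), (unlink_closed 1); split; first exact: iso_unknot.
apply/orP; left; apply/forallP=> k; apply/implyP; rewrite inE /slice_at (tnth_nth (Slice Cup 0)).
by case: k => [[|[|k]] lt_k].
Qed.

Lemma count_memC c (al : seq bool) : count_mem (~~ c) al = size al - count_mem c al.
Proof.
rewrite -(count_predC (pred1 c)) addKn; apply: eq_count => d /=.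
by case: d c => [] [].
Qed.

(** Two equal letters make one of the two states adequate. Otherwise each letter occurs at most
    once: if one is absent the word is one-signed, and if both occur the closure is an unknot. *)
Lemma semiadequate_letters al : semiadequate_word (letters al).
Proof.
have mono c : count_mem c al = 0 -> semiadequate_word (letters al).
  move=> c0; apply: (@semiadequate_mono (~~ c) _ (letters al)) => //.
  rewrite /one_signed all_map; apply/allP=> d dal /=.
  by apply: contraLR dal => ne; apply/count_memPn; rewrite -c0; case: (d) (c) ne => [] [].
have := count_memC false al; have := count_size (pred1 false) al => /=.
case: (ltnP 1 (count_mem true al)) => [/(@semiadequate_alternating false)//|].
case: (ltnP 1 (count_mem false al)) => [/(@semiadequate_alternating true)//|].
case e1: (count_mem true al) => [|[|//]]; first by move=> *; apply: (mono true).
case e0: (count_mem false al) => [|[|//]]; first by move=> *; apply: (mono false).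
move=> _ _ _ sz; have {sz} : size al = 2 by move: sz; case: (size al) => [|[|[|]]].
case: al e0 e1 {mono} => [|x [|y []]] //; case: x; case: y => // _ _ _.
- exact: (semiadequate_unknot false true false).
- exact: (semiadequate_unknot true false true).
Qed.

(** Let [c] be the sign opposite to the [n] half twists. If at most [n] letters have sign [c], they
    are all cancelled and the word becomes one-signed; otherwise they absorb the twists in pairs. *)
Lemma semiadequate_nf al k : ~~ oddz k || (size al <= 1) ->
  semiadequate_word (letters al ++ twist_pow k).
Proof.
have [s [n [-> ->]]] := twist_pow_twists k; rewrite -[s]negbK; move: (~~ s) => c {s}.
rewrite /oddz; move: (`|k|%N) => {k n}n.
have count_letters : count (fun g : gen => g.2 == c) (letters al) = count_mem c al.
  by rewrite /letters count_map; apply: eq_count.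
case: (leqP (count_mem c al) n) => [le_n _|lt_n H].
  have [|w e m] := @beq_mono c (letters al) n; first by rewrite count_letters.
  exact: semiadequate_mono e m.
(* Were [n] odd, there would be at most one letter, whereas more than [n] of them have sign [c]. *)
have {H}ev : ~~ odd n.
  case/orP: H => // le1; have := leq_trans lt_n (leq_trans (count_size _ _) le1).
  by rewrite ltnS leqn0 => /eqP->.
have En : n = 2 * n./2 by rewrite mul2n -{1}(odd_double_half n) (negbTE ev).
case: (n./2) En lt_n => [|m] -> lt_n; first by rewrite cats0; apply: semiadequate_letters.
have [w e rw] := run_absorbed (ltnW lt_n).
exact: semiadequate_run e (rw 1 1 isT isT).
Qed.

Lemma closure_gens (beta : braid_word 3) :
  exists w, closure_slices beta = cl w.
Proof.
exists [seq (val g.1 == 1, g.2) | g <- beta].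
rewrite /closure_slices /cl /= -map_comp; congr [:: _, _, _ & _ ++ _].
by apply: eq_map => -[[[|[|i]] lt_i] b].
Qed.

Lemma closed_braid_word (L : link_diagram) : is_closed_braid 3 L ->
  exists w, iso (slices L) (cl w).
Proof.
move=> [beta iL]; have [w e] := closure_gens beta; exists w; rewrite -e.
by exists (slicesP L), (Defs.closure_closed beta); rewrite link_diagram_eta.
Qed.

Lemma semiadequate_closed_braid (L : link_diagram) : is_closed_braid 3 L ->
  semiadequate_link L.
Proof.
move=> /closed_braid_word[w iL]; have [al [k [iw ev]]] := conj_nf w.
have [w' [h [iw' sa]]] := semiadequate_nf ev.
have [h1 [h2 H]] := iso_trans iL (iso_trans iw iw'); exists (LinkDiagram h); split=> //.
by rewrite (bool_irrelevance h h2) -(link_diagram_eta h1).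
Qed.

(** * Counting colourings *)

Local Open Scope ring_scope.

(** A colouring constant along edges is determined by its values at the roots of the components, and
    these are arbitrary. *)
Lemma card_colourings (T C : finType) (e : rel T) : connect_sym e ->
  #|[set f : {ffun T -> C} | [forall x, forall y, e x y ==> (f x == f y)]]| =
  (#|C| ^ n_comp e predT)%N.
Proof.
move=> sym_e; pose R : finType := {x : T | roots e x}.
pose phi (h : {ffun R -> C}) : {ffun T -> C} :=
  [ffun x => h (exist _ (fingraph.root e x) (roots_root sym_e x))].
have phi_inj : injective phi.
  move=> h h' /ffunP eh; apply/ffunP=> -[x rx]; have := eh x; rewrite !ffunE.
  suff -> : exist _ (fingraph.root e x) (roots_root sym_e x) = exist _ x rx :> R by [].
  by apply: val_inj => /=; apply/eqP.
transitivity #|phi @: [set: {ffun R -> C}]|; last first.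
  rewrite card_imset // cardsT card_ffun card_sig; congr (_ ^ _)%N.
  by apply: eq_card => x; rewrite !inE andbT.
congr #|pred_of_set _|; apply/setP=> f; rewrite inE; apply/forallP/imsetP.
- move=> Hf; exists [ffun x : R => f (val x)] => //.
  apply/ffunP=> x; rewrite !ffunE /=; apply: (@connect_colour _ e) (connect_root e x).
  by move=> y z eyz; have /forallP/(_ z)/implyP/(_ eyz)/eqP := Hf y.
- move=> [h _ ->] x; apply/forallP=> y; apply/implyP=> exy; rewrite !ffunE.
  apply/eqP; congr (h _); apply: val_inj => /=.
  by apply/(fingraph.rootP sym_e)/connect1.
Qed.

(** * Nested sums over colours *)

Section NestedSums.
Variables (R : comNzRingType) (C : finType).

Fixpoint row_sum (n : nat) (H : seq C -> R) : R :=
  if n is n'.+1 then \sum_c row_sum n' (fun t => H (c :: t)) else H [::].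

Lemma eq_row_sum n H H' : (forall t, size t = n -> H t = H' t) ->
  row_sum n H = row_sum n H'.
Proof.
elim: n H H' => [|n IHn] H H' e /=; first exact: e.
by apply: eq_bigr => c _; apply: IHn => t sz; apply: e; rewrite /= sz.
Qed.

Lemma row_sum_cat a b H :
  row_sum (a + b) H = row_sum a (fun u => row_sum b (fun v => H (u ++ v))).
Proof. by elim: a H => //= a IHa H; apply: eq_bigr => c _; rewrite IHa. Qed.

Lemma row_sumZ n x H : row_sum n (fun t => x * H t) = x * row_sum n H.
Proof.
elim: n H => //= n IHn H; rewrite mulr_sumr.
by apply: eq_bigr => c _; rewrite IHn.
Qed.

Lemma row_sumD n H H' : row_sum n (fun t => H t + H' t) = row_sum n H + row_sum n H'.
Proof.
elim: n H H' => //= n IHn H H'; rewrite -big_split.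
by apply: eq_bigr => c _; rewrite IHn.
Qed.

Lemma row_sum0 n : row_sum n (fun=> 0) = 0.
Proof. by elim: n => //= n IHn; rewrite big1. Qed.

Lemma row_sum_sum b (G : C -> seq C -> R) :
  \sum_c row_sum b (G c) = row_sum b (fun v => \sum_c G c v).
Proof.
elim: b G => //= b IHb G; rewrite exchange_big /=.
by apply: eq_bigr => c _; apply: (IHb (fun d v => G d (c :: v))).
Qed.

Lemma row_sum_exchange a b (H : seq C -> seq C -> R) :
  row_sum a (fun u => row_sum b (H u)) = row_sum b (fun v => row_sum a (H^~ v)).
Proof.
elim: a H => //= a IHa H; rewrite -row_sum_sum.
by apply: eq_bigr => c _; rewrite (IHa (fun u => H (c :: u))).
Qed.

Lemma row_sum_eq c0 n (H : seq C -> R) : size c0 = n ->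
  row_sum n (fun u => (u == c0)%:R * H u) = H c0.
Proof.
elim: n c0 H => [|n IHn] [|x c0] //= H; first by rewrite mul1r.
move=> [sz]; rewrite (bigD1 x) //= [X in _ + X]big1 ?addr0 => [|y ne].
  under eq_row_sum => t _ do rewrite eqseq_cons eqxx /=.
  by rewrite (IHn c0 (fun t => H (x :: t))).
rewrite -[RHS](row_sum0 n); apply: eq_row_sum => t _.
by rewrite eqseq_cons (negbTE ne) mul0r.
Qed.

Variable (P : eqType).
Implicit Types (g : P -> C) (s : seq P).

Definition upd g x c : P -> C := fun p => if p == x then c else g p.

(** The colours of the points of [s] are summed one after the other, while [g] supplies those of all
    other points; a state sum can thus be evaluated line by line. *)
Fixpoint point_sum (s : seq P) (Phi : (P -> C) -> R) (g : P -> C) : R :=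
  if s is x :: s' then \sum_c point_sum s' Phi (upd g x c) else Phi g.

Lemma point_sum_cat s1 s2 Phi g :
  point_sum (s1 ++ s2) Phi g = point_sum s1 (point_sum s2 Phi) g.
Proof. by elim: s1 g => //= x s1 IH g; apply: eq_bigr => c _. Qed.

Lemma eq_point_sum s Phi Psi g :
  (forall g', (forall p, p \notin s -> g' p = g p) -> Phi g' = Psi g') ->
  point_sum s Phi g = point_sum s Psi g.
Proof.
elim: s g => [|x s IHs] g e /=; first exact: e.
apply: eq_bigr => c _; apply: IHs => g' e'; apply: e => p.
rewrite inE => /norP[ne ps]; rewrite e' // /upd (negbTE ne) //.
Qed.

Lemma point_sumZ s x Phi g : point_sum s (fun g' => x * Phi g') g = x * point_sum s Phi g.
Proof.
elim: s g => //= y s IHs g; rewrite mulr_sumr.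
by apply: eq_bigr => c _; rewrite IHs.
Qed.
End NestedSums.

Section Extension.
Variables (R : comNzRingType) (C : finType) (P : choiceType).

Definition extend (s : seq P) (f : {ffun seq_sub s -> C}) (g : P -> C) (p : P) : C :=
  if insub p is Some x then f x else g p.

Lemma extend_in s f g (x : seq_sub s) : extend f g (val x) = f x.
Proof. by rewrite /extend valK. Qed.

Lemma extend_out s (f : {ffun seq_sub s -> C}) g p : p \notin s -> extend f g p = g p.
Proof. by move=> ps; rewrite /extend insubN. Qed.

(** Colourings of [x :: s] correspond to pairs of a colour of [x] and a colouring of [s], by the
    bijections [h] and [h']. *)
Lemma sum_extend (s : seq P) (Phi : (P -> C) -> R) g : uniq s ->
  (forall g1 g2, g1 =1 g2 -> Phi g1 = Phi g2) ->
  \sum_(f : {ffun seq_sub s -> C}) Phi (extend f g) = point_sum s Phi g.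
Proof.
move=> + ePhi; elim: s g => [|x s IHs] g /= => [_|/andP[xs us]].
  have f0 : {ffun seq_sub ([::] : seq P) -> C} by apply: finfun => -[].
  rewrite (bigD1 f0) //= big1 ?addr0 => [|f /eqP[]].
    by apply: ePhi => p; rewrite extend_out.
  by apply/ffunP=> -[].
under [RHS]eq_bigr => c _ do rewrite -IHs //.
rewrite pair_big /=.
pose h (cf : C * {ffun seq_sub s -> C}) : {ffun seq_sub (x :: s) -> C} :=
  [ffun y => extend cf.2 (upd g x cf.1) (val y)].
pose h' (k : {ffun seq_sub (x :: s) -> C}) : C * {ffun seq_sub s -> C} :=
  (extend k g x, [ffun z => extend k g (val z)]).
have hE cf p : extend (h cf) g p = extend cf.2 (upd g x cf.1) p.
  rewrite {1}/extend; case: insubP => [y _ <-|]; first by rewrite ffunE.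
  by rewrite inE => /norP[ne ps]; rewrite extend_out // /upd (negbTE ne).
have K1 : cancel h h'.
  case=> c f; congr (_, _); first by rewrite hE /= extend_out // /upd eqxx.
  by apply/ffunP=> z; rewrite ffunE hE extend_in.
have K2 : cancel h' h.
  move=> k; apply/ffunP=> y; rewrite ffunE /=.
  rewrite {1}/extend; case: insubP => [z _ ez|ys]; first by rewrite ffunE ez extend_in.
  have := valP y; rewrite inE (negbTE ys) orbF => /eqP e.
  by rewrite /upd e eqxx -(extend_in k g) e.
rewrite (reindex h) /=; last by exists h' => ? _.
by apply: eq_bigr => cf _; apply: ePhi => p; rewrite hE.
Qed.
End Extension.

(** * The state sum as a transfer operator *)

Section Rows.
Variables (C : finType) (c0 : C).
Implicit Type (g : nat * nat -> C).

Definition row_of g k n : seq C := mkseq (fun j => g (k, j)) n.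

Lemma take_row_eq g k k' n n' i : (i <= n)%N -> (i <= n')%N ->
  (take i (row_of g k' n') == take i (row_of g k n)) =
  all (fun j => g (k', j) == g (k, j)) (iota 0 i).
Proof.
move=> le_n le_n'; have takeE h m : (i <= m)%N -> take i (row_of g h m) = row_of g h i.
  by move=> le_m; rewrite /row_of /mkseq -map_take take_iota (minn_idPl le_m).
rewrite !takeE //; apply/eqP/allP => [e j|H].
  rewrite mem_iota add0n => /andP[_ lt_j]; apply/eqP.
  by have := congr1 (nth c0 ^~ j) e; rewrite !nth_mkseq.
by apply/eq_in_map => j /H/eqP.
Qed.

Lemma drop_row_eq g k k' a b m :
  (drop a (row_of g k' (a + m)) == drop b (row_of g k (b + m))) =
  all (fun j => g (k', a + j) == g (k, b + j))%N (iota 0 m).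
Proof.
have dropE h i : drop i (row_of g h (i + m)) = mkseq (fun j => g (h, i + j)%N) m.
  rewrite /row_of /mkseq -map_drop drop_iota addKn add0n -{1}[i]addn0 iotaDl -map_comp.
  exact: eq_map.
rewrite !dropE; apply/eqP/allP => [e j|H].
  rewrite mem_iota add0n => /andP[_ lt_j]; apply/eqP.
  by have := congr1 (nth c0 ^~ j) e; rewrite !nth_mkseq.
by apply/eq_in_map => j /H/eqP.
Qed.

Lemma cut_row g k n i : (i + 2 <= n)%N ->
  take 2 (drop i (row_of g k n)) = [:: g (k, i); g (k, i.+1)].
Proof.
move=> le_in; rewrite /row_of /mkseq -map_drop -map_take drop_iota take_iota.
by rewrite (minn_idPl _) //; lia.
Qed.

Definition eq2 (p : seq C) := nth c0 p 0 == nth c0 p 1.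

Definition splice_ok (s : Defs.shape) (t : treatment) (p p' : seq C) : bool :=
  match s, t with
  | Cup, _ => eq2 p'
  | Cap, _ => eq2 p
  | Cross b, Unspliced => p == rev p'
  | Cross true, ASpliced | Cross false, BSpliced => p == p'
  | _, _ => eq2 p && eq2 p'
  end.

Definition side_ok (l : slice) (c c' : seq C) : bool :=
  (take (pos l) c' == take (pos l) c) &&
  (drop (pos l + outs (kind l)) c' == drop (pos l + ins (kind l)) c).

Definition cut_in (l : slice) (c : seq C) := take (ins (kind l)) (drop (pos l) c).
Definition cut_out (l : slice) (c : seq C) := take (outs (kind l)) (drop (pos l) c).

Lemma mem_points (w : seq slice) k j :
  ((k, j) \in points w) = (k <= size w)%N && (j < width w k)%N.
Proof.
apply/allpairsPdep/andP => [[k' [j' [Hk Hj [-> ->]]]]|[lek ltj]].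
  by move: Hk Hj; rewrite !mem_iota !add0n !ltnS.
by exists k, j; rewrite !mem_iota !add0n !ltnS.
Qed.

Lemma uniq_points (w : seq slice) : uniq (points w).
Proof.
apply: allpairs_uniq_dep => [|k _|[k j] [k' j'] _ _ /= [-> ->]] //; exact: iota_uniq.
Qed.

Lemma width_fits (D : link_diagram) (k : 'I_(size D)) :
  (pos (slice_at k) + ins (kind (slice_at k)) <= width D k)%N /\
  width D k.+1 = next_width (width D k) (slice_at k).
Proof.
have lt_k := ltn_ord k; rewrite /slice_at (tnth_nth (Slice Cup 0)) /width.
rewrite [in take k.+1 _](take_nth (Slice Cup 0)) // -cats1 foldl_cat /=; split=> //.
case: D k lt_k => w /= clw k lt_k; move: clw; rewrite -{1}(cat_take_drop k w).
by rewrite closed_cat (drop_nth (Slice Cup 0)) //= => /and3P[].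
Qed.

(** The arcs of a slice only join points of its two bounding lines, so respecting them is a
    condition on two rows: the side strands transport their colours, and the remaining strands
    satisfy [splice_ok]. *)
Lemma arcs_respected (D : link_diagram) (k : 'I_(size D)) t
    (f : {ffun point D -> C}) g0 :
  let l := slice_at k in
  let c := row_of (extend f g0) k (width D k) in
  let c' := row_of (extend f g0) k.+1 (width D k.+1) in
  [forall p : point D, forall q : point D,
    (side_arc l k (val p) (val q) || ((val p, val q) \in inner_arcs l t k)) ==>
    (f p == f q)] =
  side_ok l c c' && splice_ok (kind l) t (cut_in l c) (cut_out l c').
Proof.
move=> l; set g := extend f g0; move=> c c'.
have [] := width_fits k; rewrite -/l; set n := width D k => le_n ew.
rewrite /c' ew {c'}; set n' := next_width n l; set c' := row_of g k.+1 n'.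
have inpt h j : (h <= size D)%N -> (j < width D h)%N ->
    exists2 p : point D, val p = (h, j) & f p = g (h, j).
  move=> leh ltj; have hp : (h, j) \in points D by rewrite mem_points leh.
  by exists (SeqSub hp) => //; rewrite /g -(extend_in f g0).
have fg (p : point D) : f p = g (val p) by rewrite /g extend_in.
have le_k : (k <= size D)%N by apply: ltnW.
have [m em] : exists m, n = (pos l + ins (kind l) + m)%N.
  by exists (n - (pos l + ins (kind l)))%N; rewrite subnKC.
have em' : n' = (pos l + outs (kind l) + m)%N.
  by rewrite /n' /next_width em; lia.
have sideE : side_ok l c c' =
    all (fun j => g (k.+1, j) == g (nat_of_ord k, j)) (iota 0 (pos l)) &&
    all (fun j => g (k.+1, pos l + outs (kind l) + j)%N ==
                  g (nat_of_ord k, pos l + ins (kind l) + j)%N) (iota 0 m).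
  rewrite /side_ok take_row_eq; [|lia|lia].
  by rewrite /c /c' -/n em em' drop_row_eq.
have innerE : splice_ok (kind l) t (cut_in l c) (cut_out l c') =
    all (fun a => g a.1 == g a.2) (inner_arcs l t k).
  rewrite /cut_in /cut_out /c /c' -/n /inner_arcs /crossing_arcs.
  move: le_n em em'; case: (kind l) => [||b] /= le_n em em'.
  - rewrite cut_row /eq2 /= ?andbT //; lia.
  - rewrite cut_row /eq2 /= ?andbT //; lia.
  - rewrite !cut_row /eq2 /=; [|lia|lia].
    by case: t b => [] [] /=; rewrite ?eqseq_cons /= ?andbT //; rewrite andbC.
rewrite sideE innerE; apply/forallP/idP => [H|/andP[/andP[/allP H1 /allP H2] /allP H3] p].
- have {}H p q : side_arc l k (val p) (val q) || ((val p, val q) \in inner_arcs l t k) ->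
      f p = f q by move=> pq; have /forallP/(_ q)/implyP/(_ pq)/eqP := H p.
  apply/andP; split; first (apply/andP; split; apply/allP=> j;
      rewrite mem_iota add0n => /andP[_ lt_j]).
  + have [||p ep fp] := inpt k j => //; first by rewrite -/n; lia.
    have [||q eq fq] := inpt k.+1 j => //; first by rewrite ew -/n'; lia.
    rewrite -fp -fq; by apply/eqP/esym/H; rewrite ep eq /side_arc /= !eqxx lt_j.
  + have [||p ep fp] := inpt k (pos l + ins (kind l) + j)%N => //; first by rewrite -/n; lia.
    have [||q eq fq] := inpt k.+1 (pos l + outs (kind l) + j)%N => //.
      by rewrite ew -/n'; lia.
    rewrite -fp -fq; apply/eqP/esym/H; rewrite ep eq /side_arc /= !eqxx leq_addr /=.
    apply/orP; left; apply/orP; right; apply/eqP; lia.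
  + apply/allP=> -[[h1 j1] [h2 j2]] /= hj.
    have [b1 b2] : ((h1 <= size D)%N && (j1 < width D h1)%N) /\
       ((h2 <= size D)%N && (j2 < width D h2)%N).
      move: hj; rewrite /inner_arcs /crossing_arcs.
      have lts := ltn_ord k.
      have Ek : (pos l + ins (kind l) <= width D k)%N by rewrite -/n; lia.
      have Ek1 : (pos l + outs (kind l) <= width D k.+1)%N by rewrite ew -/n'; lia.
      move: Ek Ek1; case: (kind l) => [||b] /= Ek Ek1.
      * rewrite inE => /eqP[-> -> -> ->]; split; lia.
      * rewrite inE => /eqP[-> -> -> ->]; split; lia.
      * by case: t b {H innerE} => [] [] /=; rewrite !inE => /orP[] /eqP[-> -> -> ->]; split; lia.
    case/andP: b1 => b1 b1'; case/andP: b2 => b2 b2'.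
    have [p ep fp] := inpt _ _ b1 b1'; have [q eq fq] := inpt _ _ b2 b2'.
    by rewrite -fp -fq; apply/eqP/H; rewrite ep eq hj orbT.
- apply/forallP=> q; apply/implyP; rewrite !fg.
  have := valP p; have := valP q; case: (val p) (val q) => [k1 j1] [k2 j2].
  rewrite /= !mem_points => bq bp /orP[|/H3 //].
  case/and3P=> /= /eqP e1 /eqP e2; subst k1 k2.
  case/orP=> /andP[lt /eqP e].
    by rewrite e eq_sym; apply: H1; rewrite mem_iota.
  have := H2 (j1 - (pos l + ins (kind l)))%N; rewrite mem_iota subnKC // add0n eq_sym.
  have -> : (pos l + outs (kind l) + (j1 - (pos l + ins (kind l))) = j2)%N by lia.
  apply; have := bp; rewrite -/n; lia.
Qed.
End Rows.

Section Transfer.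
Variables (R : comNzRingType) (C : finType) (c0 : C) (A Ai : R).

Definition weight (b : bool) : R := if b then A else Ai.

(** For a crossing this is the Kauffman skein relation: [weight b] goes with the vertical splicing
    and [weight (~~ b)] with the horizontal one. [Ai] stands for the inverse of [A]. *)
Definition kernel (s : Defs.shape) (p p' : seq C) : R :=
  match s with
  | Cup => (eq2 c0 p')%:R
  | Cap => (eq2 c0 p)%:R
  | Cross b => weight b * (p == p')%:R + weight (~~ b) * (eq2 c0 p && eq2 c0 p')%:R
  end.

(** The weighted number of colourings of [w] whose bottom row is [c]; only the colours of the
    strands that leave each slice's own spot are summed. *)
Fixpoint transfer (w : seq slice) (c : seq C) : R :=
  if w is l :: w' then
    row_sum (outs (kind l)) (fun p => kernel (kind l) (cut_in l c) p *
      transfer w' (take (pos l) c ++ p ++ drop (pos l + ins (kind l)) c))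
  else 1.

Definition full_kernel (l : slice) (c c' : seq C) : R :=
  (side_ok l c c')%:R * kernel (kind l) (cut_in l c) (cut_out l c').

(** The side strands force their colours, so the sum over the whole next row collapses to the
    strands leaving the slice. *)
Lemma row_sum_full_kernel l c (psi : seq C -> R) :
  (pos l + ins (kind l) <= size c)%N ->
  row_sum (next_width (size c) l) (fun t => full_kernel l c t * psi t) =
  row_sum (outs (kind l)) (fun p => kernel (kind l) (cut_in l c) p *
    psi (take (pos l) c ++ p ++ drop (pos l + ins (kind l)) c)).
Proof.
move=> le_c; set i := pos l; set a := ins _ in le_c *; set b := outs _.
have -> : next_width (size c) l = (i + (b + (size c - (i + a))))%N.
  by rewrite /next_width -/a -/b; lia.
rewrite row_sum_cat.
have szt : size (take i c) = i by rewrite size_takel //; lia.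
have szd : size (drop (i + a) c) = (size c - (i + a))%N by rewrite size_drop.
rewrite -[RHS](row_sum_eq (fun u => row_sum b (fun p => kernel (kind l) (cut_in l c) p *
    psi (u ++ p ++ drop (i + a) c))) szt).
apply: eq_row_sum => u szu; rewrite -row_sumZ row_sum_cat.
apply: eq_row_sum => p szp.
rewrite -[X in _ * (_ * X)](row_sum_eq (fun v => psi (u ++ p ++ v)) szd).
rewrite -!row_sumZ; apply: eq_row_sum => v szv.
rewrite /full_kernel /side_ok -/i -/a -/b /cut_out -/b -/i.
have -> : drop (i + b) (u ++ p ++ v) = v.
  by rewrite catA drop_size_cat // size_cat szu szp.
rewrite take_size_cat // drop_size_cat // take_size_cat //.
by rewrite -mulnb natrM; ring.
Qed.

Lemma point_sum_row (H : seq C -> R) k m n (g : nat * nat -> C) :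
  point_sum [seq (k, j) | j <- iota m n] (fun g' => H [seq g' (k, j) | j <- iota m n]) g =
  row_sum n H.
Proof.
elim: n m H g => [|n IHn] m H g //=.
apply: eq_bigr => c _; rewrite -(IHn m.+1 _ (upd g (k, m) c)).
apply: eq_point_sum => g' e; congr (H (_ :: _)).
rewrite e /upd ?eqxx //; apply/mapP=> -[j + [ej]].
by rewrite mem_iota ej ltnn.
Qed.

Fixpoint level_prod (k n : nat) (w : seq slice) (g : nat * nat -> C) : R :=
  if w is l :: w' then
    full_kernel l (row_of g k n) (row_of g k.+1 (next_width n l)) *
    level_prod k.+1 (next_width n l) w' g
  else 1.

Fixpoint tail_points (k n : nat) (w : seq slice) : seq (nat * nat) :=
  if w is l :: w' then [seq (k.+1, j) | j <- iota 0 (next_width n l)] ++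
                       tail_points k.+1 (next_width n l) w'
  else [::].

Lemma tail_points_gt k n w p : p \in tail_points k n w -> (k < p.1)%N.
Proof.
elim: w k n => //= l w IHw k n; rewrite mem_cat => /orP[/mapP[j _ ->]|/IHw] //=.
exact: ltnW.
Qed.

Lemma eq_row (g g' : nat * nat -> C) k n : (forall j, g (k, j) = g' (k, j)) -> row_of g k n = row_of g' k n.
Proof. by move=> e; apply: eq_map. Qed.

Lemma point_sum_transfer w k n (g : nat * nat -> C) : closed_from n w ->
  point_sum (tail_points k n w) (level_prod k n w) g = transfer w (row_of g k n).
Proof.
elim: w k n g => [|l w IHw] k n g //= /andP[fit clw].
rewrite point_sum_cat; set n' := next_width n l in clw *.
have szr : size (row_of g k n) = n by rewrite /row_of size_mkseq.
have := @row_sum_full_kernel l (row_of g k n) (transfer w).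
rewrite szr => /(_ fit) <-; rewrite -/n'.
rewrite -(point_sum_row _ k.+1 0 n' g).
apply: eq_point_sum => g' e'; rewrite -(IHw _ _ g' clw) -point_sumZ.
apply: eq_point_sum => g'' e''; congr (_ * _); congr (full_kernel l _ _).
- apply: eq_row => j; rewrite e''.
    by rewrite e' //; apply/mapP=> -[j' _ [/n_Sn]].
  by apply/negP=> /tail_points_gt /=; rewrite ltnNge leqnSn.
- apply: eq_row => j; rewrite e'' //.
  by apply/negP=> /tail_points_gt /=; rewrite ltnn.
Qed.

Lemma points_tail (w : seq slice) :
  points w = tail_points 0 0 w.
Proof.
suff H k n v : [seq (i, j) | i <- iota k (size v).+1,
      j <- iota 0 (foldl next_width n (take (i - k) v))] =
    [seq (k, j) | j <- iota 0 n] ++ tail_points k n v.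
  rewrite /points /width -[RHS]/([seq (0, j) | j <- iota 0 0]%N ++ tail_points 0 0 w).
  rewrite -H; congr flatten; apply: eq_map => i; by rewrite subn0.
elim: v k n => [|l v IHv] k n; first by [].
rewrite -[iota k _]/(k :: iota k.+1 (size v).+1) allpairs_cons subnn take0.
congr (_ ++ _); rewrite -[tail_points _ _ _]/([seq (k.+1, j) | j <- iota 0 (next_width n l)] ++
  tail_points k.+1 (next_width n l) v) -IHv.
apply: (congr1 flatten); apply/eq_in_map => i; rewrite mem_iota => /andP[lt_ki _].
by rewrite -(subnSK lt_ki).
Qed.

Lemma level_prodE k n w g : level_prod k n w g =
  \prod_(i < size w) full_kernel (nth (Slice Cup 0) w i)
    (row_of g (k + i) (foldl next_width n (take i w)))
    (row_of g (k + i.+1) (foldl next_width n (take i.+1 w))).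
Proof.
elim: w k n => [|l w IHw] k n; first by rewrite big_ord0.
rewrite big_ord_recl /= take0 /= addn0 addn1; congr (_ * _).
by rewrite IHw; apply: eq_bigr => i _; rewrite !addSnnS.
Qed.

(** The exponent is the full number of loops, as a state contributes the number of its colourings.
    For a nonempty diagram this is the bracket multiplied by one more loop value. *)
Definition state_sum (D : link_diagram) : R :=
  \sum_(S : {set 'I_(size D)} | S \subset crossings D)
    A ^+ #|S| * Ai ^+ #|crossings D :\: S| *
    #|C|%:R ^+ loops (kauffman_state S).

Lemma joined_sym (D : link_diagram) s : connect_sym (@joined D s).
Proof. by apply/sym_connect_sym => p q; rewrite /joined orbC. Qed.

Lemma colourings_of_state (D : link_diagram) (s : 'I_(size D) -> treatment) :
  (#|C| ^ loops s)%N%:R = \sum_(f : {ffun point D -> C}) \prod_(k < size D)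
    ([forall p : point D, forall q : point D,
      (side_arc (slice_at k) k (val p) (val q) ||
       ((val p, val q) \in inner_arcs (slice_at k) (s k) k)) ==> (f p == f q)])%:R :> R.
Proof.
rewrite -card_colourings; last exact: joined_sym.
rewrite -sum1dep_card natr_sum big_mkcond /=; apply: eq_bigr => f _.
set b := [forall x, _]; pose Q (k : 'I_(size D)) := [forall p : point D, forall q : point D,
      (side_arc (slice_at k) k (val p) (val q) ||
       ((val p, val q) \in inner_arcs (slice_at k) (s k) k)) ==> (f p == f q)].
have -> : b = [forall k, Q k].
  apply/forallP/forallP => [H k|H p].
  - apply/forallP=> p; apply/forallP=> q; apply/implyP=> pq.
    have /forallP/(_ q)/implyP := H p; apply.
    by apply/orP; left; apply/existsP; exists k.
  - apply/forallP=> q; apply/implyP=> /orP[] /existsP[k kpq];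
    have /forallP := H k; [move=> /(_ p) | move=> /(_ q)] => /forallP;
    [move=> /(_ q) | move=> /(_ p)] => /implyP/(_ kpq)/eqP-> //.
case: (boolP [forall k, Q k]) => [/forallP H|].
  by rewrite big1 // => k _; move: (H k); rewrite /Q => ->.
rewrite negb_forall => /existsP[k /negbTE Qk].
by rewrite (bigD1 k) //=; move: Qk; rewrite /Q => ->; rewrite mul0r.
Qed.

Lemma full_kernel_splices l c c' : full_kernel l c c' =
  if is_cross (kind l) then
    A * (side_ok l c c' && splice_ok c0 (kind l) ASpliced (cut_in l c) (cut_out l c'))%:R +
    Ai * (side_ok l c c' && splice_ok c0 (kind l) BSpliced (cut_in l c) (cut_out l c'))%:R
  else (side_ok l c c' && splice_ok c0 (kind l) BSpliced (cut_in l c) (cut_out l c'))%:R.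
Proof.
rewrite /full_kernel; case: (kind l) => [||[]] /=; rewrite -!mulnb !natrM //;
  rewrite /weight /=; ring.
Qed.

Lemma eq_level_prod k n w g g' : g =1 g' -> level_prod k n w g = level_prod k n w g'.
Proof.
move=> e; elim: w k n => //= l w IHw k n; rewrite IHw.
by congr (full_kernel _ _ _ * _); apply: eq_row.
Qed.

(** Each power of [#|C|] is expanded over colourings and the two sums are exchanged; for a fixed
    colouring the sum over states is then a product of local sums. *)
Lemma state_sum_transfer (D : link_diagram) : state_sum D = transfer D [::].
Proof.
pose g0 (p : nat * nat) := c0.
have := point_sum_transfer 0 g0 (slicesP D); rewrite -points_tail => <-.
rewrite -sum_extend; last 2 first.
- exact: uniq_points.
- by move=> g1 g2 e; apply: eq_level_prod.
rewrite /state_sum.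
pose ok (f : {ffun point D -> C}) t (k : 'I_(size D)) : R :=
  (side_ok (slice_at k) (row_of (extend f g0) k (width D k)) (row_of (extend f g0) k.+1 (width D k.+1)) &&
   splice_ok c0 (kind (slice_at k)) t
     (cut_in (slice_at k) (row_of (extend f g0) k (width D k)))
     (cut_out (slice_at k) (row_of (extend f g0) k.+1 (width D k.+1))))%:R.
(* [F] vanishes at slices that are not crossings, so that sets [S] not made of crossings contribute
   0 and distributivity can run over all sets. *)
pose F f k := if k \in crossings D then A * ok f ASpliced k else 0.
pose G f k := if k \in crossings D then Ai * ok f BSpliced k else ok f BSpliced k.
have weightE (S : {set 'I_(size D)}) : A ^+ #|S| * Ai ^+ #|crossings D :\: S| =
    \prod_(k < size D) (if k \in S then A else if k \in crossings D then Ai else 1).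
  rewrite (bigID (mem S)) /=; congr (_ * _).
    by rewrite (eq_bigr (fun=> A)) ?prodr_const // => k /= ->.
  rewrite (eq_bigr (fun k => if k \in crossings D then Ai else 1)) => [|k /negbTE-> //].
  rewrite -big_mkcondr /= prodr_const; congr (_ ^+ _).
  by apply: eq_card => k; rewrite in_setD unfold_in.
transitivity (\sum_(S : {set 'I_(size D)}) \sum_(f : {ffun point D -> C})
    \prod_k (if k \in S then F f k else G f k)).
  rewrite big_mkcond; apply: eq_bigr => S _; case: ifPn => [sub|nsub]; last first.
    case/subsetPn: nsub => k kS kC; rewrite big1 // => f _.
    by rewrite (bigD1 k) //= kS /F (negbTE kC) mul0r.
  rewrite -natrX (colourings_of_state (kauffman_state S)) mulr_sumr.
  apply: eq_bigr => f _.
  rewrite [X in _ * X](eq_bigr (fun k => ok f (kauffman_state S k) k)) => [|k _]; last first.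
    by have := arcs_respected c0 k (kauffman_state S k) f g0; cbv zeta => ->.
  rewrite weightE.
  rewrite -big_split /=; apply: eq_bigr => k _.
  rewrite /F /G /kauffman_state; case: ifP => [kS|_].
    by rewrite (subsetP sub).
  by case: ifP; rewrite ?mul1r.
rewrite exchange_big /=; apply: eq_bigr => f _.
rewrite -bigA_distr level_prodE; apply: eq_bigr => k _.
have -> : nth (Slice Cup 0) D k = slice_at k by rewrite /slice_at (tnth_nth (Slice Cup 0)).
rewrite !add0n full_kernel_splices /F /G inE; case: ifP => // _.
exact: add0r.
Qed.
End Transfer.

(** * Invariance of the state sum *)

Section Moves.
Variables (F : fieldType) (C : finType) (c0 : C) (A : F).
Hypotheses (A0 : A != 0) (loop_value : #|C|%:R = - A ^+ 2 - A ^- 2).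

Let T := transfer c0 A A^-1.
Let wt := weight A A^-1.

Lemma wtM b : wt b * wt (~~ b) = 1.
Proof. by case: b; rewrite /wt /= ?mulfV ?mulVf. Qed.

Lemma loop_wt b : #|C|%:R = - wt b ^+ 2 - wt (~~ b) ^+ 2.
Proof. by rewrite loop_value; case: b; rewrite /wt /= exprVn // addrC. Qed.

Lemma sum_eq_l (x : C) (G : C -> F) : \sum_a (a == x)%:R * G a = G x.
Proof.
rewrite (bigD1 x) //= eqxx mul1r big1 ?addr0 // => a /negbTE->.
exact: mul0r.
Qed.

Lemma sum_eq_r (x : C) (G : C -> F) : \sum_a (x == a)%:R * G a = G x.
Proof. by rewrite -[RHS](sum_eq_l x); apply: eq_bigr => a _; rewrite eq_sym. Qed.

Lemma transfer_cons l w u p v : size u = pos l -> size p = ins (kind l) ->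
  T (l :: w) (u ++ p ++ v) =
  row_sum (outs (kind l)) (fun p' => kernel c0 A A^-1 (kind l) p p' * T w (u ++ p' ++ v)).
Proof.
move=> su sp; rewrite /T /=; apply: eq_row_sum => p' _.
have -> : cut_in l (u ++ p ++ v) = p.
  by rewrite /cut_in drop_size_cat // take_size_cat.
have -> : drop (pos l + ins (kind l)) (u ++ p ++ v) = v.
  by rewrite catA drop_size_cat // size_cat su sp.
by rewrite take_size_cat.
Qed.

#[local] Arguments transfer : simpl never.

Lemma transfer_cup i w u v : size u = i ->
  T (Slice Cup i :: w) (u ++ v) = \sum_a T w (u ++ [:: a, a & v]).
Proof.
move=> su; rewrite -[u ++ v]/(u ++ [::] ++ v) transfer_cons //=.
apply: eq_bigr => a _; under eq_bigr => b _ do rewrite /eq2 /=.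
exact: (sum_eq_r a (fun b => T w (u ++ [:: a, b & v]))).
Qed.

Lemma transfer_cap i w u x y v : size u = i ->
  T (Slice Cap i :: w) (u ++ [:: x, y & v]) = (x == y)%:R * T w (u ++ v).
Proof. by move=> su; rewrite -[_ ++ _]/(u ++ [:: x; y] ++ v) transfer_cons. Qed.

Lemma transfer_cross b i w u x y v : size u = i ->
  T (Slice (Cross b) i :: w) (u ++ [:: x, y & v]) =
  wt b * T w (u ++ [:: x, y & v]) +
  wt (~~ b) * ((x == y)%:R * \sum_a T w (u ++ [:: a, a & v])).
Proof.
move=> su; rewrite -[_ ++ [:: x, y & v]]/(u ++ [:: x; y] ++ v) transfer_cons //.
rewrite /kernel -/wt.
under eq_row_sum => p' _ do rewrite mulrDl -!mulrA.
rewrite row_sumD !row_sumZ; congr (_ * _ + _ * _).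
  under eq_row_sum => p' _ do rewrite eq_sym.
  exact: (@row_sum_eq _ _ [:: x; y] 2 (fun p' => T w (u ++ p' ++ v))).
under eq_row_sum => p' _ do rewrite -mulnb natrM -mulrA.
rewrite row_sumZ; congr (_ * _) => /=.
apply: eq_bigr => a _; exact: (sum_eq_r a (fun b => T w (u ++ [:: a, b & v]))).
Qed.

(** Invariance up to the factor [x] in local form, for every continuation [w] above and every row
    [c] below. *)
Definition unit_factor (l : seq slice) (r : seq slice) (x : F) : Prop :=
  forall w c, fits (size c) l -> fits (size c) r -> T (l ++ w) c = x * T (r ++ w) c.

Lemma split_row (c : seq C) i k : (i + k <= size c)%N ->
  exists u p v, [/\ c = u ++ p ++ v, size u = i & size p = k].
Proof.
move=> le; exists (take i c), (take k (drop i c)), (drop k (drop i c)).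
rewrite !cat_take_drop; split=> //; rewrite size_takel ?size_drop //; lia.
Qed.

(** The two kernels act on disjoint groups of strands, so their sums commute. *)
Lemma factor_exchange a b i d :
  unit_factor [:: Slice a i; Slice b (i + outs a + d)]
              [:: Slice b (i + ins a + d); Slice a i] 1.
Proof.
move=> w c _ /= /andP[fc _]; rewrite mul1r.
have [|u [p [v0 [ec su sp]]]] := @split_row c i (ins a); first by lia.
have szc : size c = (i + ins a + size v0)%N by rewrite ec !size_cat su sp addnA.
have [|m [q [v [ev sm sq]]]] := @split_row v0 d (ins b); first by lia.
rewrite {}ec {}ev.
rewrite transfer_cons //=.
have E (p' : seq C) : size p' = outs a -> T (Slice b (i + outs a + d) :: w) (u ++ p' ++ m ++ q ++ v) =
    row_sum (outs b) (fun q' => kernel c0 A A^-1 b q q' * T w (u ++ p' ++ m ++ q' ++ v)).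
  move=> sp'; have := @transfer_cons (Slice b (i + outs a + d)) w (u ++ p' ++ m) q v.
  rewrite !size_cat su sp' sm addnA -!catA => -> //=.
  by apply: eq_row_sum => q' _; rewrite -!catA.
under eq_row_sum => p' sp' do rewrite (E p' sp') -row_sumZ.
rewrite row_sum_exchange.
have := @transfer_cons (Slice b (i + ins a + d)) (Slice a i :: w) (u ++ p ++ m) q v.
rewrite !size_cat su sp sm addnA -!catA => -> //=.
apply: eq_row_sum => q' _; rewrite -!catA transfer_cons //= -row_sumZ.
by apply: eq_row_sum => p' _; rewrite mulrCA.
Qed.

Lemma split1 (c : seq C) i : (i < size c)%N -> exists u x v, c = u ++ x :: v /\ size u = i.
Proof.
move=> lt; have [|u [p [v [-> su]]]] := @split_row c i 1; first by rewrite addn1.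
by case: p => [|x []] // _; exists u, x, v.
Qed.

Lemma split2 (c : seq C) i : (i.+1 < size c)%N ->
  exists u x y v, c = u ++ [:: x, y & v] /\ size u = i.
Proof.
move=> lt; have [|u [p [v [-> su]]]] := @split_row c i 2; first by rewrite addn2.
by case: p => [|x [|y []]] // _; exists u, x, y, v.
Qed.

Lemma split3 (c : seq C) i : (i.+2 < size c)%N ->
  exists u x y z v, c = u ++ [:: x, y, z & v] /\ size u = i.
Proof.
move=> lt; have [|u [p [v [-> su]]]] := @split_row c i 3; first by rewrite addn3.
by case: p => [|x [|y [|z []]]] // _; exists u, x, y, z, v.
Qed.

Lemma shift1 (u : seq C) x v : u ++ x :: v = (u ++ [:: x]) ++ v.
Proof. by rewrite -catA. Qed.

Lemma size_shift (u : seq C) x i : size u = i -> size (u ++ [:: x]) = i.+1.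
Proof. by rewrite size_cat addn1 => ->. Qed.

Lemma factor_zigzag_l i : unit_factor [:: Slice Cup i; Slice Cap i.+1] [::] 1.
Proof.
move=> w c /= /andP[_ /andP[fc _]] _; rewrite mul1r.
have [|u [x [v [-> su]]]] := @split1 c i; first by move: fc; rewrite /next_width /=; lia.
rewrite transfer_cup //.
under eq_bigr => a _ do rewrite shift1 (transfer_cap _ _ _ _ (size_shift _ su)) -catA.
exact: (sum_eq_l x (fun a => T w (u ++ a :: v))).
Qed.

Lemma factor_zigzag_r i : unit_factor [:: Slice Cup i.+1; Slice Cap i] [::] 1.
Proof.
move=> w c /= /andP[fc _] _; rewrite mul1r.
have [|u [x [v [-> su]]]] := @split1 c i; first by move: fc; rewrite /=; lia.
rewrite shift1 transfer_cup; last exact: size_shift.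
under eq_bigr => a _ do rewrite -catA (transfer_cap _ _ _ _ su).
rewrite -[in RHS]shift1.
exact: (sum_eq_r x (fun a => T w (u ++ a :: v))).
Qed.

Lemma factor_cup_slide b i : unit_factor [:: Slice Cup i; Slice (Cross b) i.+1]
  [:: Slice Cup i.+1; Slice (Cross (~~ b)) i] 1.
Proof.
move=> w c /= _ /andP[fc _]; rewrite mul1r.
have [|u [x [v [-> su]]]] := @split1 c i; first by move: fc; rewrite /=; lia.
rewrite transfer_cup // [in RHS]shift1 transfer_cup; last exact: size_shift.
under eq_bigr => a _.
  rewrite shift1 (transfer_cross _ _ _ _ _ (size_shift _ su)) -catA /=.
  under [X in _ + _ * (_ * X)]eq_bigr => z _ do rewrite -catA /=.
  over.
under [RHS]eq_bigr => a _ do rewrite -catA (transfer_cross _ _ _ _ _ su) negbK.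
rewrite !big_split /= -!mulr_sumr addrC.
rewrite (sum_eq_l x (fun a => \sum_z T w (u ++ [:: a, z, z & v]))).
by rewrite (sum_eq_r x (fun a => \sum_z T w (u ++ [:: z, z, a & v]))).
Qed.

Lemma factor_cap_slide b i : unit_factor [:: Slice (Cross b) i.+1; Slice Cap i]
  [:: Slice (Cross (~~ b)) i; Slice Cap i.+1] 1.
Proof.
move=> w c /= /andP[fc _] _; rewrite mul1r.
have [|u [x [y [z [v [-> su]]]]]] := @split3 c i; first by move: fc; rewrite /=; lia.
rewrite (transfer_cross _ _ _ _ _ su) [in RHS]shift1 (transfer_cap _ _ _ _ (size_shift _ su)).
rewrite [in LHS]shift1 (transfer_cross _ _ _ _ _ (size_shift _ su)) -!catA /=.
rewrite (transfer_cap _ _ _ _ su) negbK.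
under eq_bigr => a _ do rewrite -catA (transfer_cap _ _ _ _ su).
under [in RHS]eq_bigr => a _ do rewrite shift1 (transfer_cap _ _ _ _ (size_shift _ su)) -catA.
rewrite (sum_eq_r x (fun a => T w (u ++ a :: v))).
by rewrite (sum_eq_l z (fun a => T w (u ++ a :: v))) addrC.
Qed.

Lemma loop_factor b : wt b + wt (~~ b) * #|C|%:R = - wt (~~ b) ^+ 3.
Proof.
rewrite (loop_wt b); have := wtM b; move: (wt b) (wt (~~ b)) => x y e.
have -> : y * (- x ^+ 2 - y ^+ 2) = - (x * (x * y)) - y ^+ 3 by ring.
by rewrite e; ring.
Qed.

Lemma sum_const (x : F) : \sum_(a : C) x = #|C|%:R * x.
Proof. by rewrite sumr_const mulr_natl. Qed.

Lemma factor_R1_cup b i : unit_factor [:: Slice Cup i; Slice (Cross b) i]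
  [:: Slice Cup i] (- wt (~~ b) ^+ 3).
Proof.
move=> w c /= /andP[fc _] _; rewrite -loop_factor.
have [|u [p [v [-> su _]]]] := @split_row c i 0; first by move: fc => /=; lia.
rewrite !transfer_cup //.
under eq_bigr => a _ do rewrite (transfer_cross _ _ _ _ _ su) eqxx mul1r.
by rewrite big_split /= -mulr_sumr sum_const; ring.
Qed.

Lemma factor_R1_cap b i : unit_factor [:: Slice (Cross b) i; Slice Cap i]
  [:: Slice Cap i] (- wt (~~ b) ^+ 3).
Proof.
move=> w c /= /andP[fc _] _; rewrite -loop_factor.
have [|u [x [y [v [-> su]]]]] := @split2 c i; first by move: fc => /=; lia.
rewrite (transfer_cross _ _ _ _ _ su) !(transfer_cap _ _ _ _ su).
under eq_bigr => a _ do rewrite (transfer_cap _ _ _ _ su) eqxx mul1r.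
by rewrite sum_const; ring.
Qed.

(** With p and q the two weights, the identity has coefficient p q = 1, and the horizontal term p^2
    + q^2 + p q N = 0, where N is the loop value. *)
Lemma factor_R2 b i : unit_factor [:: Slice (Cross b) i; Slice (Cross (~~ b)) i] [::] 1.
Proof.
move=> w c /= /andP[fc _] _; rewrite mul1r.
have [|u [x [y [v [-> su]]]]] := @split2 c i; first by move: fc => /=; lia.
rewrite !(transfer_cross _ _ _ _ _ su) negbK.
under [X in _ + _ * (_ * X)]eq_bigr => a _ do
  rewrite (transfer_cross _ _ _ _ _ su) eqxx mul1r negbK.
rewrite big_split /= -mulr_sumr sum_const.
set S := \sum_a _; rewrite (loop_wt b).
have := wtM b; move: (wt b) (wt (~~ b)) => p q e.
transitivity ((p * q) * T w (u ++ [:: x, y & v]) +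
  (x == y)%:R * S * (p ^+ 2 + q ^+ 2 - p * q * (p ^+ 2 + q ^+ 2))); first by ring.
by rewrite e; ring.
Qed.

(** * Temperley-Lieb relations and the third Reidemeister move *)

Implicit Types G H : C -> C -> C -> F.

(** The Temperley-Lieb generator e_1 acting on functions of three colours; [cupcap2] is e_2. *)
Definition cupcap1 G : C -> C -> C -> F :=
  fun x y z => (x == y)%:R * \sum_a G a a z.
Definition cupcap2 G : C -> C -> C -> F :=
  fun x y z => (y == z)%:R * \sum_a G x a a.

Lemma cupcap1_lin p q G1 G2 H : (forall x y z, H x y z = p * G1 x y z + q * G2 x y z) ->
  forall x y z, cupcap1 H x y z = p * cupcap1 G1 x y z + q * cupcap1 G2 x y z.
Proof.
move=> e x y z; rewrite /cupcap1; under eq_bigr => a _ do rewrite e.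
by rewrite big_split /= -!mulr_sumr; ring.
Qed.

Lemma cupcap2_lin p q G1 G2 H : (forall x y z, H x y z = p * G1 x y z + q * G2 x y z) ->
  forall x y z, cupcap2 H x y z = p * cupcap2 G1 x y z + q * cupcap2 G2 x y z.
Proof.
move=> e x y z; rewrite /cupcap2; under eq_bigr => a _ do rewrite e.
by rewrite big_split /= -!mulr_sumr; ring.
Qed.

Lemma cupcap11 G x y z : cupcap1 (cupcap1 G) x y z = #|C|%:R * cupcap1 G x y z.
Proof.
rewrite /cupcap1; under eq_bigr => a _ do rewrite eqxx mul1r.
by rewrite sum_const mulrCA.
Qed.

Lemma cupcap22 G x y z : cupcap2 (cupcap2 G) x y z = #|C|%:R * cupcap2 G x y z.
Proof.
rewrite /cupcap2; under eq_bigr => a _ do rewrite eqxx mul1r.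
by rewrite sum_const mulrCA.
Qed.

Lemma cupcap121 G x y z : cupcap1 (cupcap2 (cupcap1 G)) x y z = cupcap1 G x y z.
Proof.
rewrite /cupcap1 /cupcap2 (sum_eq_l z (fun a => \sum_b (a == b)%:R * \sum_c G c c b)).
by rewrite (sum_eq_r z (fun b => \sum_c G c c b)).
Qed.

Lemma cupcap212 G x y z : cupcap2 (cupcap1 (cupcap2 G)) x y z = cupcap2 G x y z.
Proof.
rewrite /cupcap1 /cupcap2 (sum_eq_r x (fun a => \sum_b (b == a)%:R * \sum_c G b c c)).
by rewrite (sum_eq_l x (fun b => \sum_c G b c c)).
Qed.

(** Both sides are expanded as products of factors p + q e_i. They differ by (e_1 - e_2)(1 - p
    q)(p^2 q + q^3), which vanishes since p q = 1. *)
Lemma factor_R3 b i :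
  unit_factor [:: Slice (Cross b) i; Slice (Cross b) i.+1; Slice (Cross b) i]
    [:: Slice (Cross b) i.+1; Slice (Cross b) i; Slice (Cross b) i.+1] 1.
Proof.
move=> w c _ /= /andP[fc _]; rewrite mul1r.
have [|u [x [y [z [v [-> su]]]]]] := @split3 c i; first by move: fc => /=; lia.
pose V w' x y z := T w' (u ++ [:: x, y, z & v]).
have V1 w' : forall x y z, V (Slice (Cross b) i :: w') x y z =
    wt b * V w' x y z + wt (~~ b) * cupcap1 (V w') x y z.
  by move=> x' y' z'; rewrite /V (transfer_cross _ _ _ _ _ su).
have V2 w' : forall x y z, V (Slice (Cross b) i.+1 :: w') x y z =
    wt b * V w' x y z + wt (~~ b) * cupcap2 (V w') x y z.
  move=> x' y' z'; rewrite /V shift1 (transfer_cross _ _ _ _ _ (size_shift _ su)).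
  rewrite -catA /cupcap2 /=; congr (_ + _ * (_ * _)).
  by apply: eq_bigr => a _; rewrite -catA.
have E1 w' := cupcap1_lin (V1 w'); have E12 w' := cupcap1_lin (V2 w').
have E21 w' := cupcap2_lin (V1 w'); have E2 w' := cupcap2_lin (V2 w').
have E121 w' := cupcap1_lin (E21 w'); have E212 w' := cupcap2_lin (E12 w').
rewrite -/(V [:: Slice (Cross b) i, Slice (Cross b) i.+1, Slice (Cross b) i & w] x y z).
rewrite -/(V [:: Slice (Cross b) i.+1, Slice (Cross b) i, Slice (Cross b) i.+1 & w] x y z).
rewrite [LHS]V1 V2 E12 V1 E21 E1 E121 [RHS]V2 V1 E21 V2 E12 E2 E212.
rewrite cupcap11 cupcap22 cupcap121 cupcap212 (loop_wt b).
have := wtM b; move: (wt b) (wt (~~ b)) => p q e.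
move: (cupcap1 (cupcap2 (V w)) x y z) (cupcap2 (cupcap1 (V w)) x y z) => a12 a21.
move: (V w x y z) (cupcap1 (V w) x y z) (cupcap2 (V w) x y z) => a0 a1 a2.
set r := RHS.
transitivity (r + (a1 - a2) * (1 - p * q) * (p ^+ 2 * q + q ^+ 3)); first by rewrite /r; ring.
by rewrite e subrr mulr0 mul0r addr0.
Qed.
End Moves.

Local Open Scope nat_scope.
(** The sign and the exponent are chosen before the field, the colours and [A], so that one unit
    serves for all specializations at once. *)
Lemma move_factor l r : move l r -> exists (e : bool) (k : int),
  forall (F : fieldType) (C : finType) (c0 : C) (A : F), A != 0%R ->
  #|C|%:R%R = (- A ^+ 2 - A ^- 2)%R -> unit_factor c0 A l r ((-1) ^+ e * A ^ k)%R.
Proof.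
have unit1 (F : fieldType) (A : F) : ((-1) ^+ false * A ^ 0 = 1)%R by rewrite expr0 expr0z mulr1.
have unit3 (F : fieldType) (A : F) b :
    ((-1) ^+ true * A ^ (if b then - 3 else 3)%Z = - weight A A^-1 (~~ b) ^+ 3)%R.
  by rewrite expr1 mulN1r; case: b; rewrite /weight /= ?exprVn.
case=> [a b i d|i|i|b i|b i|b i|b i|b i|b i].
- by exists false, 0%R => F C c0 A A0 e; rewrite unit1; apply: factor_exchange.
- by exists false, 0%R => F C c0 A A0 e; rewrite unit1; apply: factor_zigzag_l.
- by exists false, 0%R => F C c0 A A0 e; rewrite unit1; apply: factor_zigzag_r.
- by exists false, 0%R => F C c0 A A0 e; rewrite unit1; apply: factor_cup_slide.
- by exists false, 0%R => F C c0 A A0 e; rewrite unit1; apply: factor_cap_slide.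
- exists true, (if b then - 3 else 3)%Z => F C c0 A A0 e; rewrite unit3.
  exact: factor_R1_cup.
- exists true, (if b then - 3 else 3)%Z => F C c0 A A0 e; rewrite unit3.
  exact: factor_R1_cap.
- by exists false, 0%R => F C c0 A A0 e; rewrite unit1; apply: factor_R2.
- by exists false, 0%R => F C c0 A A0 e; rewrite unit1; apply: factor_R3.
Qed.

Local Open Scope ring_scope.

Lemma transfer_ctx (F : fieldType) (C : finType) (c0 : C) (A x : F) u w1 w2 n :
  (forall c, size c = foldl next_width n u ->
     transfer c0 A A^-1 w1 c = x * transfer c0 A A^-1 w2 c) ->
  fits n u -> forall c, size c = n ->
  transfer c0 A A^-1 (u ++ w1) c = x * transfer c0 A A^-1 (u ++ w2) c.
Proof.
elim: u n => [|l u IHu] n /= H; first by move=> _ c; apply: H.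
move=> /andP[fl fu] c sc; rewrite -row_sumZ; apply: eq_row_sum => p sp.
rewrite mulrCA; congr (_ * _); apply: (IHu _ H fu).
by rewrite !size_cat sp size_takel ?size_drop ?sc /next_width; lia.
Qed.

Definition loop_sum (N : nat) (A : algC) (w : seq slice) : algC :=
  transfer (ord0 : 'I_N.+1) A A^-1 w [::].

(** The values of [A] at which the loop value is the positive integer [N.+1], so that the state sum
    counts colourings by [N.+1] colours. *)
Definition integral_loop (N : nat) (A : algC) := A != 0 /\ N.+1%:R = - A ^+ 2 - A ^- 2.

Lemma isotopic_loop_sum (D D' : link_diagram) : isotopic D D' ->
  exists (e : bool) (k : int), forall N A, integral_loop N A ->
    loop_sum N A D = (-1) ^+ e * A ^ k * loop_sum N A D'.
Proof.
elim=> {D D'} [D D' [u [v [l [r [m eD eD']]]]]|D|D D' _ [e [k H]]|D1 D2 D3 _ [e [k H]] _ [e' [k' H']]].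
- have [e [k H]] := move_factor m; exists e, k => N A [A0 eN].
  have := slicesP D; have := slicesP D'; rewrite eD eD' !closed_cat.
  move=> /and3P[_ fr _] /and3P[fu fl _].
  apply: (@transfer_ctx _ _ _ _ _ u (l ++ v) (r ++ v) 0) => // c sc.
  by apply: H; rewrite ?card_ord ?sc.
- by exists false, 0 => N A _; rewrite expr0 expr0z !mul1r.
- exists e, (- k) => N A gA; rewrite (H N A gA) mulrA.
  have A0 : A != 0 by case: gA.
  rewrite mulrACA -signr_addb addbb expr0 mul1r -expfzDr // addNr expr0z.
  by rewrite mul1r.
- exists (e (+) e'), (k + k') => N A gA; rewrite (H N A gA) (H' N A gA).
  have A0 : A != 0 by case: gA.
  by rewrite signr_addb expfzDr //; ring.
Qed.

(** * The Burau trace *)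

Section Matrix2.
Variable R : comNzRingType.

(** The entries are explicit fields, so that matrix identities reduce to [ring] or [field] on each
    entry. *)
Record mat2 := Mat2 { m11 : R; m12 : R; m21 : R; m22 : R }.

Definition mul2 (M N : mat2) : mat2 :=
  Mat2 (m11 M * m11 N + m12 M * m21 N) (m11 M * m12 N + m12 M * m22 N)
       (m21 M * m11 N + m22 M * m21 N) (m21 M * m12 N + m22 M * m22 N).

Definition scal2 (x : R) (M : mat2) := Mat2 (x * m11 M) (x * m12 M) (x * m21 M) (x * m22 M).
Definition one2 : mat2 := Mat2 1 0 0 1.
Definition tr2 (M : mat2) : R := m11 M + m22 M.

Lemma mul2A M N P : mul2 M (mul2 N P) = mul2 (mul2 M N) P.
Proof. by rewrite /mul2 /=; congr Mat2; ring. Qed.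

Lemma mul12 M : mul2 one2 M = M.
Proof. by case: M => a b c d; rewrite /mul2 /one2 /=; congr Mat2; ring. Qed.

Lemma mul2_scal x y M N : mul2 (scal2 x M) (scal2 y N) = scal2 (x * y) (mul2 M N).
Proof. by rewrite /mul2 /scal2 /=; congr Mat2; ring. Qed.

Lemma tr2_scal x M : tr2 (scal2 x M) = x * tr2 M.
Proof. by rewrite /tr2 /= mulrDr. Qed.

(* Up to the factors [A / y] and [A^-1], the Burau matrices of the first
   generator and of the inverse of the second one, at [y = - A^4]. *)
Definition letter_mat (y : R) (c : bool) : mat2 :=
  if c then Mat2 1 y 0 y else Mat2 1 0 1 y.

Definition letters_mat (y : R) (al : seq bool) : mat2 :=
  foldr (fun c => mul2 (letter_mat y c)) one2 al.

End Matrix2.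

Section Trace.
Variables (F : fieldType) (A : F).
Hypothesis A0 : A != 0.
Let n : F := - A ^+ 2 - A ^- 2.

(** The matrix p + q e_i, where e_1 = [[n, A^2], [0, 0]] and e_2 = [[0, 0], [A^-2, n]] satisfy the
    Temperley-Lieb relations. *)
Definition gen_mat (g : gen) : mat2 F :=
  let p := weight A A^-1 g.2 in let q := weight A A^-1 (~~ g.2) in
  if g.1 then Mat2 p 0 (q * A ^- 2) (p + q * n) else Mat2 (p + q * n) (q * A ^+ 2) 0 p.

Definition rho (w : seq gen) : mat2 F := foldr (fun g => mul2 (gen_mat g)) (one2 F) w.

Lemma rho_cat u v : rho (u ++ v) = mul2 (rho u) (rho v).
Proof. by elim: u => [|g u IHu] /=; rewrite ?mul12 // IHu mul2A. Qed.

Definition expo (w : seq gen) : int := \sum_(g <- w) sgb g.2.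

Lemma weightE s : weight A A^-1 s = A ^ (sgb s).
Proof. by case: s. Qed.

Section Closure.
Variables (C : finType) (c0 : C).
Hypothesis card_C : #|C|%:R = n.

Let T := transfer c0 A A^-1.
Let caps : seq slice := [:: Slice Cap 2; Slice Cap 1; Slice Cap 0].
Let phi (t : seq C) x y z := T caps [:: x, y, z & t].

(** The action of a general element of the Temperley-Lieb algebra on three strands, in the basis 1,
    e_1, e_2, e_1 e_2, e_2 e_1. *)
Definition combination x0 x1 x2 x12 x21 (f : C -> C -> C -> F) x y z : F :=
  x0 * f x y z + x1 * cupcap1 f x y z + x2 * cupcap2 f x y z +
  x12 * cupcap1 (cupcap2 f) x y z + x21 * cupcap2 (cupcap1 f) x y z.

Lemma cupcap1_combination x0 x1 x2 x12 x21 f x y z :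
  cupcap1 (combination x0 x1 x2 x12 x21 f) x y z =
  combination 0 (x0 + n * x1 + x21) 0 (x2 + n * x12) 0 f x y z.
Proof.
transitivity (x0 * cupcap1 f x y z + x1 * cupcap1 (cupcap1 f) x y z +
   x2 * cupcap1 (cupcap2 f) x y z + x12 * cupcap1 (cupcap1 (cupcap2 f)) x y z +
   x21 * cupcap1 (cupcap2 (cupcap1 f)) x y z).
  rewrite {1}/cupcap1 /combination !big_split /= -!mulr_sumr.
  by rewrite /cupcap1; ring.
by rewrite !cupcap11 cupcap121 card_C /combination; ring.
Qed.

Lemma cupcap2_combination x0 x1 x2 x12 x21 f x y z :
  cupcap2 (combination x0 x1 x2 x12 x21 f) x y z =
  combination 0 0 (x0 + n * x2 + x12) 0 (x1 + n * x21) f x y z.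
Proof.
transitivity (x0 * cupcap2 f x y z + x1 * cupcap2 (cupcap1 f) x y z +
   x2 * cupcap2 (cupcap2 f) x y z + x12 * cupcap2 (cupcap1 (cupcap2 f)) x y z +
   x21 * cupcap2 (cupcap2 (cupcap1 f)) x y z).
  rewrite {1}/cupcap2 /combination !big_split /= -!mulr_sumr.
  by rewrite /cupcap2; ring.
by rewrite !cupcap22 cupcap212 card_C /combination; ring.
Qed.

(** A braid word acts as an element of the Temperley-Lieb algebra. The coefficient [x0] is its image
    in the one-dimensional representation killing e_1 and e_2, and [rho w] its image in the
    two-dimensional one. *)
Lemma transfer_gens w : exists x0 x1 x2 x12 x21 : F,
  [/\ forall t x y z, T (map gslice w ++ caps) [:: x, y, z & t] =
        combination x0 x1 x2 x12 x21 (phi t) x y z,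
      x0 = A ^ expo w &
      rho w = Mat2 (x0 + n * x1 + x12) (A ^+ 2 * (x1 + n * x12))
                   (A ^- 2 * (x2 + n * x21)) (x0 + n * x2 + x21)].
Proof.
elim: w => [|[i s] w [x0 [x1 [x2 [x12 [x21 [H e0 er]]]]]]].
  exists 1, 0, 0, 0, 0; split.
  - by move=> t x y z; rewrite /combination /phi; ring.
  - by rewrite /expo big_nil expr0z.
  - by rewrite /rho /one2 /=; congr Mat2; ring.
set p := weight A A^-1 s; set q := weight A A^-1 (~~ s).
have ex : p * x0 = A ^ expo ((i, s) :: w).
  by rewrite e0 /expo big_cons expfzDr // /p weightE.
have A2 : A ^+ 2 * A ^- 2 = 1 by rewrite mulfV // expf_neq0.
case: i ex => ex.
- exists (p * x0), (p * x1), (p * x2 + q * (x0 + n * x2 + x12)), (p * x12),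
    (p * x21 + q * (x1 + n * x21)); split=> //.
  + move=> t x y z; have -> : map gslice ((true, s) :: w) ++ caps =
      Slice (Cross s) 1 :: (map gslice w ++ caps) by [].
    rewrite -[[:: x, y, z & t]]/([:: x] ++ [:: y, z & t]) /T.
    rewrite (@transfer_cross _ _ _ _ _ 1 _ [:: x] _ _ _ erefl) -/T -/p -/q /= H.
    under eq_bigr => a _ do rewrite H.
    rewrite -/(cupcap2 (combination x0 x1 x2 x12 x21 (phi t)) x y z).
    by rewrite cupcap2_combination /combination; ring.
  + rewrite [LHS]/= er /gen_mat /= -/p -/q /mul2 /=; congr Mat2.
    * by ring.
    * by ring.
    * transitivity (q * A ^- 2 * (x0 + n * x1 + x12) + (p + q * n) * (A ^- 2 * (x2 + n * x21))).
        by [].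
      by ring.
    * transitivity (p * (x0 + n * x2 + x21) +
        q * (n * (x0 + n * x2 + x21) + (A ^+ 2 * A ^- 2) * (x1 + n * x12))).
        by ring.
      by rewrite A2; ring.
- exists (p * x0), (p * x1 + q * (x0 + n * x1 + x21)), (p * x2),
    (p * x12 + q * (x2 + n * x12)), (p * x21); split=> //.
  + move=> t x y z; have -> : map gslice ((false, s) :: w) ++ caps =
      Slice (Cross s) 0 :: (map gslice w ++ caps) by [].
    rewrite -[[:: x, y, z & t]]/([::] ++ [:: x, y, z & t]) /T.
    rewrite (@transfer_cross _ _ _ _ _ 0 _ [::] _ _ _ erefl) -/T -/p -/q /= H.
    under eq_bigr => a _ do rewrite H.
    rewrite -/(cupcap1 (combination x0 x1 x2 x12 x21 (phi t)) x y z).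
    by rewrite cupcap1_combination /combination; ring.
  + rewrite [LHS]/= er /gen_mat /= -/p -/q /mul2 /=; congr Mat2; try by ring.
    transitivity (p * (x0 + n * x1 + x12) +
      q * (n * (x0 + n * x1 + x12) + (A ^+ 2 * A ^- 2) * (x2 + n * x21))).
      by ring.
    by rewrite A2; ring.
Qed.

(** Closing the five basis elements gives 3, 2, 2, 1 and 1 loops. The resulting sum is n times
    [tr2 (rho w) + (n ^+ 2 - 2) * x0], and n^2 - 2 = A^4 + A^-4. *)
Lemma transfer_closure w :
  T (cl w) [::] = n * (A ^ expo w * (A ^+ 4 + A ^- 4) + tr2 (rho w)).
Proof.
have [x0 [x1 [x2 [x12 [x21 [H e0 er]]]]]] := transfer_gens w.
have cup i u v x : size u = i -> T (Slice Cup i :: x) (u ++ v) = \sum_a T x (u ++ [:: a, a & v]).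
  exact: transfer_cup.
have -> : T (cl w) [::] = \sum_a \sum_b \sum_c T (map gslice w ++ caps) [:: a; b; c; c; b; a].
  rewrite (cup 0%N [::] [::]) //; apply: eq_bigr => a _.
  rewrite (cup 1%N [:: a] [:: a]) //; apply: eq_bigr => b _.
  by rewrite (cup 2%N [:: a; b] [:: b; a]).
under eq_bigr => a _ do under eq_bigr => b _ do under eq_bigr => c _ do rewrite H /combination.
have phiE (c b a x y z : C) : phi [:: c; b; a] x y z = (z == c)%:R * ((y == b)%:R * (x == a)%:R).
  rewrite /phi /caps /T -[[:: x, y, z & _]]/([:: x; y] ++ [:: z, c & [:: b; a]]).
  rewrite transfer_cap // -[_ ++ _]/([:: x] ++ [:: y, b & [:: a]]) transfer_cap //.
  by rewrite -[_ ++ _]/([::] ++ [:: x, a & [::]]) transfer_cap //= mulr1.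
have andR (P Q : bool) : P%:R * Q%:R = (P && Q)%:R :> F by rewrite -natrM mulnb.
have comb1 (c b a : C) : cupcap1 (phi [:: c; b; a]) a b c = (a == b)%:R.
  rewrite /cupcap1; under eq_bigr => d _ do rewrite phiE eqxx mul1r.
  by rewrite (sum_eq_l b (fun d => (d == a)%:R)) eq_sym andR andbb.
have comb2 (c b a : C) : cupcap2 (phi [:: c; b; a]) a b c = (b == c)%:R.
  rewrite /cupcap2; under eq_bigr => d _ do rewrite phiE eqxx mulr1.
  by rewrite (sum_eq_l c (fun d => (d == b)%:R)) eq_sym andR andbb.
have comb12 (c b a : C) : cupcap1 (cupcap2 (phi [:: c; b; a])) a b c =
    ((a == b) && (a == c))%:R.
  rewrite /cupcap1 /cupcap2.
  rewrite (sum_eq_l c (fun d => \sum_e phi [:: c; b; a] d e e)).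
  under eq_bigr => d _ do rewrite phiE.
  rewrite (sum_eq_l c (fun d => (d == b)%:R * (c == a)%:R)) !andR.
  by congr (_ %:R); rewrite (eq_sym c a); case: eqP => //= ->; rewrite (eq_sym c); case: eqP.
have comb21 (c b a : C) : cupcap2 (cupcap1 (phi [:: c; b; a])) a b c =
    ((a == b) && (a == c))%:R.
  rewrite /cupcap1 /cupcap2.
  rewrite (sum_eq_r a (fun d => \sum_e phi [:: c; b; a] e e d)).
  under eq_bigr => d _ do rewrite phiE mulrCA.
  rewrite (sum_eq_l b (fun d => (a == c)%:R * (d == a)%:R)) !andR.
  congr (_ %:R); rewrite (eq_sym b a) andbA andbC; case: eqP => //= ->.
  by case: eqP.
have comb0 (c b a : C) : phi [:: c; b; a] a b c = 1 by rewrite phiE !eqxx !mul1r.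
transitivity (\sum_(a : C) \sum_(b : C) \sum_(c : C) (x0 + x1 * (a == b)%:R +
    x2 * (b == c)%:R + x12 * ((a == b) && (a == c))%:R + x21 * ((a == b) && (a == c))%:R)).
  apply: eq_bigr => a _; apply: eq_bigr => b _; apply: eq_bigr => c _.
  by rewrite comb0 comb1 comb2 comb12 comb21 mulr1.
have sum1 (x : C) : \sum_(c : C) (x == c)%:R = 1 :> F.
  have := sum_eq_r x (fun=> 1 : F); under eq_bigr => c _ do rewrite mulr1.
  by [].
transitivity (\sum_(a : C) \sum_(b : C) (n * x0 + n * x1 * (a == b)%:R + x2 +
    (x12 + x21) * (a == b)%:R)).
  apply: eq_bigr => a _; apply: eq_bigr => b _.
  rewrite !big_split /= -!mulr_sumr !sum_const card_C sum1.
  have -> : \sum_c ((a == b) && (a == c))%:R = (a == b)%:R :> F.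
    by under eq_bigr => c _ do rewrite -andR; rewrite -mulr_sumr sum1 mulr1.
  by ring.
transitivity (\sum_(a : C) (n * n * x0 + n * x1 + n * x2 + x12 + x21)).
  apply: eq_bigr => a _.
  by rewrite !big_split /= -!mulr_sumr !sum_const card_C sum1; ring.
rewrite sum_const card_C er /tr2 /= -e0.
have -> : A ^+ 4 + A ^- 4 = n ^+ 2 - 2 * (A ^+ 2 * A ^- 2).
  by rewrite /n; field.
by rewrite mulfV ?expf_neq0 //; ring.
Qed.
End Closure.
End Trace.

(** * Exponent sums and traces of the normal forms *)

Lemma expo_cat u v : expo (u ++ v) = expo u + expo v.
Proof. by rewrite /expo big_cat. Qed.

Lemma expo_twists s m : expo (twists s m) = (sgb s *+ 3) *+ m.
Proof.
elim: m => [|m IHm]; first by rewrite /expo big_nil.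
rewrite -[twists s m.+1]/(half_twist s ++ twists s m) expo_cat IHm.
by rewrite /expo !big_cons big_nil mulrS; case: s {IHm} => /=; ring.
Qed.

Lemma expo_twist_pow k : expo (twist_pow k) = k * 3.
Proof.
case: k => m; first by rewrite -[twist_pow _]/(twists true m) expo_twists /sgb; lia.
by rewrite -[twist_pow _]/(twists false m.+1) expo_twists /sgb; lia.
Qed.

Lemma expo_letters al : expo (letters al) =
  (count_mem true al)%:Z - (count_mem false al)%:Z.
Proof.
elim: al => [|c al IHal]; first by rewrite /expo big_nil.
rewrite /expo big_cons -/(expo (letters al)) IHal /=.
by case: c; rewrite /sgb /=; lia.
Qed.

Section RhoNormalForm.
Variables (F : fieldType) (A : F).
Hypothesis A0 : A != 0.

Lemma mul2_one (M : mat2 F) : mul2 M (one2 F) = M.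
Proof. by case: M => a b c d; rewrite /mul2 /one2 /=; congr Mat2; ring. Qed.

Lemma scal12 (M : mat2 F) : scal2 1 M = M.
Proof. by case: M => a b c d; rewrite /scal2 /=; congr Mat2; ring. Qed.

Lemma gen_matE i s : gen_mat A (i, s) =
  match i, s with
  | false, true => Mat2 (- A ^- 3) A 0 A
  | true, true => Mat2 A 0 (A ^- 3) (- A ^- 3)
  | false, false => Mat2 (- A ^+ 3) (A ^+ 3) 0 A^-1
  | true, false => Mat2 A^-1 0 A^-1 (- A ^+ 3)
  end.
Proof. by case: i; case: s; rewrite /gen_mat /=; congr Mat2; field. Qed.

Lemma rho_half_twist s : rho A (half_twist s) =
  if s then Mat2 0 (- A^-1) (- A ^- 5) 0 else Mat2 0 (- A ^+ 5) (- A) 0.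
Proof.
have -> : rho A (half_twist s) =
    mul2 (gen_mat A (false, s)) (mul2 (gen_mat A (true, s)) (gen_mat A (false, s))).
  by rewrite /rho /= mul2_one.
by rewrite !gen_matE; case: s; rewrite /mul2 /=; congr Mat2; field.
Qed.

Lemma rho_full_twist s : rho A (half_twist s ++ half_twist s) =
  scal2 (A ^ (- (sgb s * 6))) (one2 F).
Proof.
rewrite rho_cat !rho_half_twist; case: s.
- rewrite (_ : A ^ _ = A ^- 6) //.
  by rewrite /mul2 /scal2 /=; congr Mat2; field.
- rewrite (_ : A ^ _ = A ^+ 6) //.
  by rewrite /mul2 /scal2 /=; congr Mat2; ring.
Qed.

Lemma rho_twists_even s m : rho A (twists s (2 * m)) =
  scal2 (A ^ (- (sgb s * 6 * m%:Z))) (one2 F).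
Proof.
elim: m => [|m IHm]; first by rewrite mulr0 oppr0 expr0z scal12.
have -> : (2 * m.+1 = (2 * m).+2)%N by lia.
rewrite -[twists s _]/(half_twist s ++ half_twist s ++ twists s (2 * m)) catA.
rewrite rho_cat rho_full_twist IHm mul2_scal mul12 -expfzDr //.
by congr (scal2 (A ^ _) _); lia.
Qed.

Lemma rho_twist_pow k : ~~ oddz k -> rho A (twist_pow k) = scal2 (A ^ (- (k * 3))) (one2 F).
Proof.
rewrite /oddz; case: k => m ev.
- rewrite -[twist_pow _]/(twists true m) (_ : m = 2 * m./2)%N; last first.
    by rewrite mul2n -{1}(odd_double_half m) (negbTE ev).
  by rewrite rho_twists_even; congr (scal2 (A ^ _) _); rewrite /sgb; lia.
- rewrite -[twist_pow _]/(twists false m.+1) (_ : m.+1 = 2 * m.+1./2)%N; last first.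
    by rewrite mul2n -{1}(odd_double_half m.+1) (negbTE ev).
  rewrite rho_twists_even; congr (scal2 (A ^ _) _); rewrite /sgb.
  have : m.+1 = (2 * m.+1./2)%N by rewrite mul2n -{1}(odd_double_half m.+1) (negbTE ev).
  lia.
Qed.

Lemma tr_rho_twist v k : ~~ oddz k ->
  tr2 (rho A (v ++ twist_pow k)) = A ^ (- (k * 3)) * tr2 (rho A v).
Proof.
move=> ev; rewrite rho_cat rho_twist_pow // -{1}(scal12 (rho A v)) mul2_scal mul2_one.
by rewrite mul1r tr2_scal.
Qed.

Lemma tr_rho_half_twist : tr2 (rho A (half_twist true)) = 0.
Proof. by rewrite rho_half_twist /tr2 addr0. Qed.

Lemma tr_rho_coxeter i s : tr2 (rho A [:: (i, s); (~~ i, s)]) = - A ^ (- (sgb s *+ 2)).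
Proof.
have e : A ^ (- (sgb s *+ 2)) = if s then A ^- 2 else A ^+ 2.
  by case: s.
by rewrite e /rho /= mul2_one !gen_matE /tr2 /mul2; case: i; case: s {e} => /=; field.
Qed.

(** All denominators are gathered in one scalar, so that the remaining matrix is polynomial in y and
    can be lifted to integer polynomials. *)
Lemma rho_letters al : let y := - A ^+ 4 in
  rho A (letters al) =
  scal2 (A ^ expo (letters al) * y ^- count_mem true al) (letters_mat y al).
Proof.
move=> y; have y0 : y != 0 by rewrite oppr_eq0 expf_neq0.
elim: al => [|c al IHal].
  by rewrite /expo big_nil expr0z invr1 mulr1 scal12.
have -> : rho A (letters (c :: al)) = mul2 (gen_mat A (letter c)) (rho A (letters al)) by [].
have -> : gen_mat A (letter c) = scal2 (A ^ sgb c * (if c then y^-1 else 1)) (letter_mat y c).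
  rewrite gen_matE /scal2 /letter_mat /y invrN; case: c => /=; rewrite /sgb ?expr1z.
  + by congr Mat2; field.
  + by rewrite (_ : A ^ (-1) = A^-1) //; congr Mat2; field.
rewrite IHal mul2_scal; congr (scal2 _ _).
rewrite /expo big_cons -/(expo (letters al)) expfzDr //=.
case: c => /=; rewrite ?add0n ?add1n ?exprS ?invfM; ring.
Qed.

End RhoNormalForm.

(** In the odd case one half twist is split off. With no letter left it stands alone; with one
    letter, its sign is chosen opposite and [gen_half_twist] gives a product of two generators. The
    remaining power is even, hence acts by a scalar. *)
Lemma normal_form w : exists v k, [/\ iso (cl w) (cl (v ++ twist_pow k)), ~~ oddz k &
  [\/ exists al, v = letters al, v = half_twist true |
      exists i s, v = [:: (i, s); (~~ i, s)]]].
Proof.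
have [al [k [iw H]]] := conj_nf w.
have [odd_k|ev] := boolP (oddz k); last by exists (letters al), k; split=> //; constructor 1; exists al.
move: H; rewrite odd_k /=; case: al iw => [|c []] // iw _.
- exists (half_twist true), (-1 + k); split; [|by rewrite (oddzS false) odd_k|by constructor 2].
  apply: iso_trans iw _; apply: iso_beq.
  by rewrite twist_powS /sgb addrA addrN add0r.
- exists [:: (c, ~~ c); (~~ c, ~~ c)], (sgb c + k); split.
  + apply: iso_trans iw _; apply: iso_beq.
    have e : twist_pow k ≡ half_twist (~~ c) ++ twist_pow (sgb c + k).
      by rewrite twist_powS /sgb; case: (c) => /=; rewrite addrA ?addNr ?addrN add0r.
    rewrite e catA; apply: beq_cat => //; rewrite -[letters _ ++ _]/(letter c :: half_twist (~~ c)).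
    by have := gen_half_twist (~~ c) c; rewrite negbK.
  + by rewrite oddzS odd_k.
  + by constructor 3; exists c, (~~ c).
Qed.

(** * Specialization of Laurent polynomials *)

Definition evalC (p : {poly int}) (z : algC) : algC := (map_poly intr p).[z].

Section Specialization.
Variable z : algC.
Hypothesis z0 : z != 0.

(* [f] is a Laurent polynomial in [quarter_t], with value [v] at [z]. *)
Definition specializes (f : jones_field) (v : algC) : Prop :=
  exists (P : {poly int}) (k : nat),
    f * quarter_t ^+ k = FracField.tofrac P /\ v * z ^+ k = evalC P z.

Lemma evalCD p q : evalC (p + q) z = evalC p z + evalC q z.
Proof. by rewrite /evalC rmorphD hornerD. Qed.
Lemma evalCM p q : evalC (p * q) z = evalC p z * evalC q z.
Proof. by rewrite /evalC rmorphM hornerM. Qed.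
Lemma evalCX k : evalC 'X^k z = z ^+ k.
Proof. by rewrite /evalC map_polyXn hornerXn. Qed.
Lemma evalCN p : evalC (- p) z = - evalC p z.
Proof. by rewrite /evalC rmorphN hornerN. Qed.
Lemma evalC1 : evalC 1 z = 1.
Proof. by rewrite /evalC rmorph1 hornerC. Qed.

Lemma quarter_tX k : quarter_t ^+ k = FracField.tofrac 'X^k.
Proof. by rewrite /quarter_t -rmorphXn. Qed.

Lemma quarter_t0 : quarter_t != 0.
Proof. by rewrite /quarter_t tofrac_eq0 polyX_eq0. Qed.

Lemma specializes_uniq f v v' : specializes f v -> specializes f v' -> v = v'.
Proof.
move=> [P [k [ef ev]]] [P' [k' [ef' ev']]].
have eP : P * 'X^k' = P' * 'X^k.
  apply/eqP; rewrite -tofrac_eq !rmorphM /= -!quarter_tX -ef -ef'; apply/eqP; ring.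
have zk : z ^+ (k + k') != 0 by rewrite expf_neq0.
apply: (mulIf zk); have := congr1 (evalC^~ z) eP; rewrite /= !evalCM !evalCX -ev -ev'.
by rewrite exprD !mulrA => ->; rewrite mulrAC.
Qed.

Lemma specializesD f g v w : specializes f v -> specializes g w ->
  specializes (f + g) (v + w).
Proof.
move=> [P [k [ef ev]]] [Q [l [eg ew]]]; exists (P * 'X^l + Q * 'X^k), (k + l)%N.
rewrite rmorphD !rmorphM /= -!quarter_tX -ef -eg evalCD !evalCM !evalCX -ev -ew !exprD.
by split; ring.
Qed.

Lemma specializesM f g v w : specializes f v -> specializes g w ->
  specializes (f * g) (v * w).
Proof.
move=> [P [k [ef ev]]] [Q [l [eg ew]]]; exists (P * Q), (k + l)%N.
rewrite rmorphM /= -ef -eg evalCM -ev -ew !exprD.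
by split; ring.
Qed.

Lemma specializesN f v : specializes f v -> specializes (- f) (- v).
Proof.
move=> [P [k [ef ev]]]; exists (- P), k.
by rewrite rmorphN /= -ef evalCN -ev !mulNr.
Qed.

Lemma specializes1 : specializes 1 1.
Proof. by exists 1, 0%N; rewrite rmorph1 evalC1 !mulr1. Qed.

Lemma specializes0 : specializes 0 0.
Proof. by have := specializesD specializes1 (specializesN specializes1); rewrite !subrr. Qed.

Lemma specializesX f v k : specializes f v -> specializes (f ^+ k) (v ^+ k).
Proof.
move=> s; elim: k => [|k IHk]; first exact: specializes1.
by rewrite !exprS; apply: specializesM.
Qed.

Lemma specializes_q : specializes quarter_t z.
Proof. by exists 'X, 0%N; rewrite !mulr1 (evalCX 1). Qed.

Lemma specializes_qV : specializes quarter_t^-1 z^-1.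
Proof.
by exists 1, 1%N; rewrite rmorph1 evalC1 !expr1 (mulVf quarter_t0) (mulVf z0).
Qed.

Lemma specializes_expz f v (k : int) : specializes f v -> specializes f^-1 v^-1 ->
  specializes (f ^ k) (v ^ k).
Proof.
move=> s si; case: k => k; first exact: specializesX.
by rewrite !NegzE -!exprz_inv; apply: specializesX.
Qed.

Lemma specializes_sum (I : finType) (P : pred I) (f : I -> jones_field) (v : I -> algC) :
  (forall i, P i -> specializes (f i) (v i)) ->
  specializes (\sum_(i | P i) f i) (\sum_(i | P i) v i).
Proof.
move=> H; apply: (big_ind2 specializes specializes0 _ H) => *.
exact: specializesD.
Qed.
End Specialization.

(** A nonempty closed diagram begins with a minimum and so has a point. This makes the predecessor
    in the bracket a true subtraction. *)
Lemma loops_gt0 (D : link_diagram) (s : 'I_(size D) -> treatment) :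
  slices D <> [::] -> (0 < loops s)%N.
Proof.
move=> ne; have [p] : inhabited (point D).
  case: D s ne => -[|[[||b] i] w] /= clD s // _; try by have := clD; rewrite /= addn2.
  have hp : (1, 0)%N \in points (Slice Cup i :: w) by rewrite mem_points /width /= take0.
  exact: inhabits (SeqSub hp).
rewrite /loops /n_comp_mem; apply/card_gt0P.
exists (fingraph.root (joined s) p); rewrite !inE andbT.
exact/roots_root/joined_sym.
Qed.

(** Specializing t^(1/4) to A^-1 sends both loop values to [N.+1]. The additional loop factor in the
    state sum accounts for the exponent [m.+1]. *)
Lemma jones_loop_sum (L : link_diagram) o u m :
  slices L <> [::] -> jones_unit u -> jones L o = u * (- half_t - half_t^-1) ^+ m ->
  exists (e : bool) (j : int), forall N A, integral_loop N A ->
    loop_sum N A L = (-1) ^+ e * A ^ j * N.+1%:R ^+ m.+1.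
Proof.
move=> ne [e [k ->]] eqV.
(* The writhe factor is the [writhe L o]-th power of - A^-3 and is moved to the other side; [half_t]
   becomes A^-2. *)
exists (odd `|writhe L o| (+) e), (3 * writhe L o - 2 * k) => N A [A0 eN].
have z0 : A^-1 != 0 by rewrite invr_eq0.
have sq := specializes_q A^-1; have sqV := specializes_qV z0; rewrite invrK in sqV.
have sq2 := specializesX 2 sq; have sq2V := specializesX 2 sqV.
have swr : specializes A^-1 ((- quarter_t ^+ 3) ^ writhe L o) ((- A^-1 ^+ 3) ^ writhe L o).
  apply: specializes_expz; first by apply/specializesN/specializesX.
  by rewrite !invrN -!exprVn invrK; apply/specializesN/specializesX.
have sloop : specializes A^-1 (- bracket_A ^+ 2 - bracket_A ^- 2) N.+1%:R.
  rewrite eN /bracket_A exprVn invrK -!exprVn; apply: specializesD; exact: specializesN.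
have sloop' : specializes A^-1 (- half_t - half_t^-1) N.+1%:R.
  rewrite eN addrC /half_t -!exprVn; apply: specializesD; exact: specializesN.
have sK : specializes A^-1 (kauffman_bracket L)
   (\sum_(S : {set 'I_(size L)} | S \subset crossings L)
    A ^ (#|S|%:Z - #|crossings L :\: S|%:Z) * N.+1%:R ^+ (loops (kauffman_state S)).-1).
  apply: specializes_sum => S _; apply: specializesM; last exact: specializesX.
  by apply: specializes_expz; rewrite /bracket_A ?invrK.
have sR : specializes A^-1 ((-1) ^+ e * half_t ^ k * (- half_t - half_t^-1) ^+ m)
    ((-1) ^+ e * (A^-1 ^+ 2) ^ k * N.+1%:R ^+ m).
  apply: specializesM; last exact: specializesX.
  apply: specializesM; first by apply/specializesX/specializesN/specializes1.
  by apply: specializes_expz; rewrite /half_t -?exprVn ?invrK.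
have := specializesM swr sK; rewrite -/(jones L o) eqV => /(specializes_uniq z0 sR) E.
have -> : loop_sum N A L = N.+1%:R * \sum_(S : {set 'I_(size L)} | S \subset crossings L)
    A ^ (#|S|%:Z - #|crossings L :\: S|%:Z) * N.+1%:R ^+ (loops (kauffman_state S)).-1.
  rewrite /loop_sum -state_sum_transfer /state_sum mulr_sumr; apply: eq_bigr => S _.
  rewrite card_ord mulrCA -exprS prednK ?loops_gt0 //.
  by rewrite expfzDr // -exprnN exprVn.
set X := \sum_(S | _) _ in E *.
have signz (w : int) : (-1) ^ w = (-1) ^+ odd `|w| :> algC.
  by case: w => w; rewrite ?NegzE -?exprz_inv ?invrN1 signr_odd.
have pow3 (w : int) : (A^-1 ^+ 3) ^ w = A ^ (- (3 * w)).
  by rewrite exprVn exprnN exprz_exp; congr (A ^ _); lia.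
have pow2 (w : int) : (A^-1 ^+ 2) ^ w = A ^ (- (2 * w)).
  by rewrite exprVn exprnN exprz_exp; congr (A ^ _); lia.
have wrE : (- A^-1 ^+ 3) ^ writhe L o = (-1) ^+ odd `|writhe L o| * A ^ (- (3 * writhe L o)).
  have -> : - A^-1 ^+ 3 = -1 * A^-1 ^+ 3 by rewrite mulN1r.
  by rewrite expfzMl signz pow3.
move: E; rewrite wrE pow2; set w := writhe L o => E.
have -> : X = (-1) ^+ odd `|w| * A ^ (3 * w) * ((-1) ^+ odd `|w| * A ^ (- (3 * w)) * X).
  have s2 : (-1) ^+ odd `|w| * (-1) ^+ odd `|w| = 1 :> algC by rewrite -signr_addb addbb.
  have a2 : A ^ (3 * w) * A ^ (- (3 * w)) = 1 by rewrite -expfzDr // addrN expr0z.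
  transitivity (((-1) ^+ odd `|w| * (-1) ^+ odd `|w|) *
      (A ^ (3 * w) * A ^ (- (3 * w))) * X); last by ring.
  by rewrite s2 a2 !mul1r.
rewrite -E signr_addb expfzDr // exprS; ring.
Qed.

(** * Identities between Laurent polynomials from integral loop values *)

Lemma integral_loop_exists N : exists A, integral_loop N A.
Proof.
(* Multiplied by A^2, the condition on the loop value reads A^4 = - 1 - (N + 1) A^2. *)
have [A eA] := @solve_monicpoly algC 4 (fun i => if i == 0%N then -1 else
  if i == 2 then - N.+1%:R else 0) isT.
move: eA; rewrite !big_ord_recl big_ord0 /= !mul0r !add0r !addr0 expr0 mulr1.
move=> eA; exists A.
have A0 : A != 0.
  by apply: contra_eq_neq eA => ->; rewrite !expr0n /= mulr0 addr0 eq_sym oppr_eq0 oner_eq0.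
split=> //; apply: (mulIf (expf_neq0 2 A0)).
rewrite mulrBl mulVf ?expf_neq0 // mulNr -exprD eA /bump /=.
by rewrite -[(1 + (1 + 0))%N]/(2%N); ring.
Qed.

(** Different [N] come from different [A], so the polynomial has more roots than its degree
    allows. *)
Lemma poly_integral_loop_eq0 (p : {poly int}) : (forall N A, integral_loop N A -> evalC p A = 0) -> p = 0.
Proof.
move=> H; apply: (@map_inj_poly _ _ (intr : int -> algC)); [exact: intr_inj | by [] |].
rewrite rmorph0; apply/eqP; apply: contraT => p0.
have [rs [sz u Hrs]] : exists rs : seq algC, [/\ size rs = size (map_poly (intr : int -> algC) p),
    uniq rs & forall A, A \in rs -> 
      exists2 N, (N < size (map_poly (intr : int -> algC) p))%N & integral_loop N A].
  elim: (size _) => [|k [rs [sz u Hrs]]]; first by exists [::].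
  have [A gA] := integral_loop_exists k; exists (A :: rs); split=> /=.
  - by rewrite sz.
  - rewrite u andbT; apply/negP=> /Hrs[N lt_N [_ eN]].
    have [_ ek] := gA; have := etrans eN (esym ek).
    by move/eqP; rewrite eqr_nat eqSS => /eqP e; rewrite e ltnn in lt_N.
  - move=> B; rewrite inE => /orP[/eqP->|/Hrs[N lt_N gN]]; first by exists k.
    by exists N => //; apply: ltnW.
have : (size rs < size (map_poly (intr : int -> algC) p))%N.
  apply: max_poly_roots => //; apply/allP=> A /Hrs[N _ gN].
  by apply/rootP; apply: H gN.
by rewrite sz ltnn.
Qed.

(** Multiplication by A^c, with [c] bounding all exponents, clears denominators. Only the
    differences of exponents are recorded, since the common shift carries no information. *)
Lemma laurent_identity (a1 a2 a3 : int) (p1 p2 p3 : {poly int}) :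
  (forall N A, integral_loop N A ->
     A ^ a1 * evalC p1 A + A ^ a2 * evalC p2 A = A ^ a3 * evalC p3 A) ->
  exists b1 b2 b3 : nat, [/\ b1%:Z - b2%:Z = a1 - a2, b1%:Z - b3%:Z = a1 - a3 &
    'X^b1 * p1 + 'X^b2 * p2 = 'X^b3 * p3].
Proof.
move=> H; pose c := (`|a1| + `|a2| + `|a3|)%N.
have shift a : (`|a| <= c)%N -> exists b : nat, b%:Z = a + c%:Z.
  by move=> le; exists `|(a + c%:Z)%R|%N; lia.
have [|b1 e1] := shift a1; first by rewrite /c; lia.
have [|b2 e2] := shift a2; first by rewrite /c; lia.
have [|b3 e3] := shift a3; first by rewrite /c; lia.
exists b1, b2, b3; split; [lia|lia|].
apply/eqP; rewrite -subr_eq0; apply/eqP/poly_integral_loop_eq0 => N A gA.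
have A0 : A != 0 by case: gA.
have AE a b : b%:Z = a + c%:Z -> A ^+ b = A ^ a * A ^+ c.
  by move=> e; rewrite -[A ^+ b]/(A ^ b%:Z) e expfzDr.
rewrite !(evalCD, evalCN, evalCM, evalCX) (AE _ _ e1) (AE _ _ e2) (AE _ _ e3).
have := H N A gA; move: (A ^ a1) (A ^ a2) (A ^ a3) => x1 x2 x3 e.
transitivity (((x1 * evalC p1 A + x2 * evalC p2 A) - x3 * evalC p3 A) * A ^+ c); first by ring.
by rewrite e subrr mul0r.
Qed.

(** * Closed 3-braids with the polynomial of an unlink *)

(** A move with empty right side acts on strands that are already present, so its left side alone is
    not a closed diagram. *)
Lemma isotopic_nonempty (D D' : link_diagram) : isotopic D D' ->
  (slices D = [::]) <-> (slices D' = [::]).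
Proof.
elim=> {D D'} [D D' [u [v [l [r [m eD eD']]]]]|D|D D' _ IH|D1 D2 D3 _ IH1 _ IH2];
  [|by []|by split=> /IH|by rewrite IH1].
have clD := slicesP D; rewrite eD in clD *; rewrite eD'.
have l0 : l <> [::] by case: m.
have r0 : r = [::] -> closed_from 0 l = false.
  by case: m => // *; rewrite /= /next_width /=; lia.
split=> [|/(congr1 size)].
  by case: u clD {eD eD'} => [|//] _; case: l l0 {m r0}.
rewrite !size_cat /= => /eqP; rewrite !addn_eq0.
case/and3P=> /eqP/size0nil eu /eqP/size0nil er /eqP/size0nil ev.
by move: clD; rewrite eu ev cats0 /= (r0 er).
Qed.

(** The loop sum of [L] is computed from its Jones polynomial and, up to the unit of the isotopy,
    from the closed braid; a common loop value is cancelled. *)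
Lemma trace_equation (L : link_diagram) w o u :
  iso (slices L) (cl w) -> jones_unit u ->
  jones L o = u * (- half_t - half_t^-1) ^+ (components L).-1 ->
  exists (e : bool) (j : int), forall N A, integral_loop N A ->
    A ^ expo w * (A ^+ 4 + A ^- 4) + tr2 (rho A w) =
    (-1) ^+ e * A ^ j * N.+1%:R ^+ (components L).-1.
Proof.
move=> [h1 [h2 iL]] uu eqV; set m := (components L).-1 in eqV *.
have iL' : isotopic L (LinkDiagram h2) by rewrite -(link_diagram_eta h1).
have ne : slices L <> [::] by move/(isotopic_nonempty iL').
have [e [j H]] := jones_loop_sum ne uu eqV.
have [e' [j' H']] := isotopic_loop_sum iL'.
exists (e (+) e'), (j - j') => N A gA; have := H N A gA; rewrite (H' N A gA).
have [A0 eN] := gA; have cardC : #|'I_N.+1|%:R = - A ^+ 2 - A ^- 2 by rewrite card_ord.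
have := @transfer_closure _ A A0 _ (ord0 : 'I_N.+1) cardC w.
rewrite -/(loop_sum N A (cl w)) => -> E.
have n0 : N.+1%:R != 0 :> algC by rewrite pnatr_eq0.
apply: (mulfI n0); rewrite {1}eN.
set X := (_ * (_ + _)) in E *.
have s2 : (-1) ^+ e' * (-1) ^+ e' = 1 :> algC by rewrite -signr_addb addbb.
have a2 : A ^ j' * A ^ (- j') = 1 by rewrite -expfzDr // addrN expr0z.
transitivity (((-1) ^+ e' * (-1) ^+ e') * (A ^ j' * A ^ (- j')) * X).
  by rewrite s2 a2 !mul1r.
transitivity ((-1) ^+ e' * A ^ (- j') * ((-1) ^+ e' * A ^ j' * X)); first by ring.
by rewrite E signr_addb expfzDr // exprS; ring.
Qed.

Lemma polynomial_equation w (e : bool) (j : int) m (a : int) (p : {poly int}) :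
  (forall A : algC, A != 0 -> tr2 (rho A w) = A ^ a * evalC p A) ->
  (forall N A, integral_loop N A -> A ^ expo w * (A ^+ 4 + A ^- 4) + tr2 (rho A w) =
    (-1) ^+ e * A ^ j * N.+1%:R ^+ m) ->
  exists b1 b2 b3 (s : bool), b1%:Z - b2%:Z = expo w - 4 - a /\
    'X^b1 * (1 + 'X^8) + 'X^b2 * p = (-1) ^+ s * 'X^b3 * (1 + 'X^4) ^+ m.
Proof.
(* The loop value is - A^-2 (1 + A^4), whose [m]-th power contributes the sign [odd m]. *)
move=> Htr H; pose s := e (+) odd m.
have [|b1 [b2 [b3 [e12 _ E]]]] := @laurent_identity (expo w - 4) a (j - 2 * m%:Z)
    (1 + 'X^8) p ((-1) ^+ s * (1 + 'X^4) ^+ m).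
  move=> N A gA; have [A0 eN] := gA; rewrite -(Htr _ A0).
  have -> : evalC (1 + 'X^8) A = 1 + A ^+ 8 by rewrite evalCD evalC1 evalCX.
  have -> : evalC ((-1) ^+ s * (1 + 'X^4) ^+ m) A = (-1) ^+ s * (1 + A ^+ 4) ^+ m.
    rewrite evalCM; congr (_ * _).
      by case: (s); rewrite ?expr0 ?expr1 ?evalCN evalC1.
    elim: m {H s} => [|m IHm]; first by rewrite !expr0 evalC1.
    by rewrite (exprS _ m) evalCM IHm evalCD evalC1 evalCX -exprS.
  transitivity (A ^ expo w * (A ^+ 4 + A ^- 4) + tr2 (rho A w)).
    congr (_ + _); rewrite expfzDr // -mulrA; congr (_ * _).
    by rewrite -exprnN; field.
  rewrite (H _ _ gA) eN.
  have -> : - A ^+ 2 - A ^- 2 = - A ^- 2 * (1 + A ^+ 4) by field.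
  have -> : (- A ^- 2 * (1 + A ^+ 4)) ^+ m =
      (-1) ^+ odd m * A ^ (- (2 * m%:Z)) * (1 + A ^+ 4) ^+ m.
    by rewrite exprMn (exprNn (A ^- 2)) signr_odd exprVn -exprM exprnN PoszM.
  by rewrite /s signr_addb expfzDr //; ring.
exists b1, b2, b3, s; split=> //.
by rewrite E; ring.
Qed.

(** * Evaluation at a primitive eighth root of unity, where y = 1 *)

Lemma zeta8_exists : exists2 z : algC, z ^+ 4 = -1 & `|z| = 1.
Proof.
have [z] := @solve_monicpoly algC 4 (fun i => if i == 0%N then -1 else 0) isT.
rewrite !big_ord_recl big_ord0 /= !mul0r !addr0 expr0 mulr1 => ez.
exists z => //; apply/eqP; rewrite -(@pexpr_eq1 _ _ 4) // -normrX ez.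
by rewrite normrN normr1.
Qed.

(* At a primitive eighth root of unity the unlink of several components gives [0]. *)
Lemma zeta8_norm b1 b2 b3 (s : bool) m (p : {poly int}) z :
  z ^+ 4 = -1 -> `|z| = 1 ->
  'X^b1 * (1 + 'X^8) + 'X^b2 * p = (-1) ^+ s * 'X^b3 * (1 + 'X^4) ^+ m ->
  `|2 * z ^+ b1 + z ^+ b2 * evalC p z| = (m == 0%N)%:R.
Proof.
move=> z4 nz /(congr1 (evalC^~ z)).
rewrite !(evalCM, evalCD, evalCX, evalC1).
have -> : z ^+ 8 = 1 by rewrite -[8%N]/(4 * 2)%N exprM z4 sqrrN expr1n.
have -> : evalC ((1 + 'X^4) ^+ m) z = (m == 0%N)%:R.
  case: m => [|m]; first by rewrite evalC1.
  by rewrite exprS evalCM evalCD evalC1 evalCX z4 subrr mul0r.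
have -> : evalC ((-1) ^+ s) z = (-1) ^+ s.
  by case: (s); rewrite ?expr0 ?expr1 ?evalCN evalC1.
rewrite [z ^+ b1 * _]mulrC => ->; rewrite !normrM !normrX nz expr1n mulr1.
by rewrite normr_nat normrN normr1 expr1n mul1r.
Qed.

(** The reverse triangle inequality removes the unknown powers of [z], which have absolute value
    1. *)
Lemma zeta8_bound b1 b2 b3 (s : bool) m (p : {poly int}) z :
  z ^+ 4 = -1 -> `|z| = 1 ->
  'X^b1 * (1 + 'X^8) + 'X^b2 * p = (-1) ^+ s * 'X^b3 * (1 + 'X^4) ^+ m ->
  `| 2 - `|evalC p z| | <= (m == 0%N)%:R.
Proof.
move=> z4 nz E; rewrite -(zeta8_norm z4 nz E).
have n2 : `|2 * z ^+ b1| = 2 by rewrite normrM normrX nz expr1n mulr1 normr_nat.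
have np : `|z ^+ b2 * evalC p z| = `|evalC p z| by rewrite normrM normrX nz expr1n mul1r.
by rewrite -{1}n2 -np -[X in `|_ - X|]normrN -{2}[z ^+ b2 * _]opprK ler_dist_dist.
Qed.

Lemma coef_equation (p q : {poly int}) : p = q -> forall i, p`_i = q`_i.
Proof. by move=> ->. Qed.

(** The trace vanishes, so the bound at the eighth root of unity would give 2 <= 1. *)
Lemma half_twist_nontrivial k e j m : ~~ oddz k ->
  ~ (forall N A, integral_loop N A ->
    A ^ expo (half_twist true ++ twist_pow k) * (A ^+ 4 + A ^- 4) +
      tr2 (rho A (half_twist true ++ twist_pow k)) =
    (-1) ^+ nat_of_bool e * A ^ j * N.+1%:R ^+ m).
Proof.
move=> ev H.
have [|b1 [b2 [b3 [s [_ E]]]]] := @polynomial_equation _ e j m 0 0 _ H.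
  move=> A A0; rewrite tr_rho_twist // tr_rho_half_twist // mulr0.
  by rewrite /evalC rmorph0 horner0 mulr0.
have [z z4 nz] := zeta8_exists; have := zeta8_bound z4 nz E.
rewrite /evalC rmorph0 horner0 normr0 subr0 normr_nat.
by case: (m == 0%N); rewrite ler_nat.
Qed.

Lemma coxeter_trivial i (t : bool) k e j m : ~~ oddz k ->
  (forall N A, integral_loop N A ->
    A ^ expo ([:: (i, t); (~~ i, t)] ++ twist_pow k) * (A ^+ 4 + A ^- 4) +
      tr2 (rho A ([:: (i, t); (~~ i, t)] ++ twist_pow k)) =
    (-1) ^+ nat_of_bool e * A ^ j * N.+1%:R ^+ m) ->
  m = 0%N /\ k = 0.
Proof.
move=> ev H; pose a : int := - (k * 3) - sgb t *+ 2.
have [|b1 [b2 [b3 [s [e12 E]]]]] := @polynomial_equation _ e j m a (-1) _ H.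
  move=> A A0; rewrite tr_rho_twist // tr_rho_coxeter // expfzDr //.
  by rewrite evalCN evalC1 mulrN1 mulrN.
have [z z4 nz] := zeta8_exists; have := zeta8_bound z4 nz E.
rewrite evalCN evalC1 normrN normr1 (_ : 2 - 1 = 1); last by ring.
rewrite normr1; case: eqP => [m0 _|]; last by rewrite ler10.
split=> //; rewrite {}m0 expr0 mulr1 in E.
have ex : expo ([:: (i, t); (~~ i, t)] ++ twist_pow k) = sgb t *+ 2 + k * 3.
  by rewrite expo_cat expo_twist_pow /expo !big_cons big_nil addr0.
rewrite ex /a in e12.
(* Evaluation at 1 gives 2 - 1 on the left, so the sign [s] is positive. *)
have /(congr1 (fun p : {poly int} => p.[1])) := E.
rewrite !hornerE !expr1n => E1.
have C l : ((l == b1) + (l == b1 + 8)%N)%N%:Z - (l == b2)%:Z = (-1) ^+ s * (l == b3)%:Z.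
  have := coef_equation E l; rewrite mulrDr mulr1 mulrN1 -exprD coefB coefD !coefXn.
  rewrite !natz PoszD => ->; case: (s); rewrite ?expr0 ?expr1 ?mul1r ?mulN1r ?coefN coefXn natz //.
(* The negative term must cancel, so [b2] is [b1] or [b1 + 8]. As [b1 - b2] is
   [6 * k + 4 * sgb t - 4], divisibility by 6 leaves only [k = 0]. *)
have := C b2; move: E1 e12; rewrite /sgb; case: (s) (t) => [] []; rewrite ?expr0 ?expr1; lia.
Qed.

(** * Traces of words in the two letters *)

Lemma letters_mat_morph (R S : comNzRingType) (f : {rmorphism R -> S}) y al :
  letters_mat (f y) al =
  let M := letters_mat y al in Mat2 (f (m11 M)) (f (m12 M)) (f (m21 M)) (f (m22 M)).
Proof.
elim: al => [|c al /= ->]; first by rewrite /= !rmorph1 !rmorph0.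
by case: c; rewrite /mul2 /= !rmorphD !rmorphM ?rmorph0 ?rmorph1.
Qed.

Lemma tr_letters_morph (R S : comNzRingType) (f : {rmorphism R -> S}) y al :
  tr2 (letters_mat (f y) al) = f (tr2 (letters_mat y al)).
Proof. by rewrite letters_mat_morph /tr2 /= rmorphD. Qed.

Lemma tr_letters_nseq (R : comNzRingType) (y : R) n c :
  tr2 (letters_mat y (nseq n c)) = 1 + y ^+ n.
Proof.
suff [b ->] : exists b, letters_mat y (nseq n c) =
    if c then Mat2 1 b 0 (y ^+ n) else Mat2 1 0 b (y ^+ n) by case: c.
elim: n => [|n [b IHn]]; first by exists 0; rewrite expr0; case: c.
exists (if c then b + y * y ^+ n else 1 + y * b); rewrite /= IHn exprS.
by case: c {IHn}; rewrite /mul2 /=; congr Mat2; ring.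
Qed.

(** At y = 1 the letters are the unipotent matrices [[1, 1], [0, 1]] and [[1, 0], [1, 1]]: products
    have determinant 1, and every letter increases the corresponding off-diagonal entry. *)
Lemma letters_mat1_bounds al :
  let M := letters_mat (1 : int) al in
  [/\ 1 <= m11 M, 1 <= m22 M, (count_mem true al)%:Z <= m12 M,
      (count_mem false al)%:Z <= m21 M & m11 M * m22 M = 1 + m12 M * m21 M].
Proof.
elim: al => [|c al]; first by split.
rewrite [letters_mat _ (c :: al)]/=; move: (letters_mat 1 al) => -[a b c' d] /= [Ha Hd Hb Hc E].
by case: c; rewrite /mul2 /= ?mul1r ?mul0r ?add0r ?addr0; split; try lia; nia.
Qed.

(** The product of the diagonal entries is at least 1 + p q >= 2. Trace 3 means diagonal entries 1
    and 2, whence p q <= 1. *)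
Lemma tr_letters1 al : (0 < count_mem true al)%N -> (0 < count_mem false al)%N ->
  3 <= tr2 (letters_mat (1 : int) al) /\
  (tr2 (letters_mat (1 : int) al) = 3 ->
   count_mem true al = 1%N /\ count_mem false al = 1%N).
Proof.
move=> p0 q0; have /= [] := letters_mat1_bounds al; rewrite /tr2.
move: (letters_mat 1 al) => -[a b c d] /=.
move: (count_mem true al) (count_mem false al) p0 q0 => p q p0 q0 Ha Hd Hb Hc E.
have pq : p%:Z * q%:Z <= b * c by nia.
split; first by nia.
move=> s; have : p%:Z * q%:Z <= 1 by nia.
by move=> H; split; nia.
Qed.

Lemma size_count (al : seq bool) : size al = (count_mem true al + count_mem false al)%N.
Proof.
by rewrite -(count_predC (pred1 true)); congr addn; apply: eq_count => -[].
Qed.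

Lemma nseq_count c (al : seq bool) : count_mem (~~ c) al = 0%N -> al = nseq (size al) c.
Proof.
move=> c0; apply/all_pred1P/allP=> d dal /=; apply: contraT => ne.
by have /count_memPn := c0; rewrite (_ : ~~ c = d) ?dal //; case: (c) (d) ne => [] [].
Qed.

Section Letters.
Variables (al : seq bool) (k : int) (e : bool) (j : int) (m : nat).
Hypothesis even_k : ~~ oddz k.
Hypothesis equation : forall N A, integral_loop N A ->
  A ^ expo (letters al ++ twist_pow k) * (A ^+ 4 + A ^- 4) +
    tr2 (rho A (letters al ++ twist_pow k)) = (-1) ^+ e * A ^ j * N.+1%:R ^+ m.

Let p := count_mem true al.
Let q := count_mem false al.
Let trace := tr2 (letters_mat (- 'X^4 : {poly int}) al).

Lemma eval_trace z : evalC ((-1) ^+ p * trace) z =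
  (-1) ^+ p * tr2 (letters_mat (- z ^+ 4) al).
Proof.
pose f : {rmorphism {poly int} -> algC} :=
  GRing.RMorphism.clone _ _ (horner_eval z \o map_poly intr) _.
have fE r : evalC r z = f r by [].
rewrite fE rmorphM rmorphXn rmorphN1 /trace -tr_letters_morph rmorphN.
by rewrite -fE evalCX.
Qed.

Lemma letters_equation : exists b1 b2 b3 (s : bool),
  b1%:Z - b2%:Z = k * 6 - 4 + p%:Z * 4 /\
  'X^b1 * (1 + 'X^8) + 'X^b2 * ((-1) ^+ p * trace) =
    (-1) ^+ s * 'X^b3 * (1 + 'X^4) ^+ m.
Proof.
pose a : int := - (k * 3) + (p%:Z - q%:Z) - p%:Z * 4.
have [|b1 [b2 [b3 [s [e12 E]]]]] := @polynomial_equation _ e j m a ((-1) ^+ p * trace) _ equation.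
  move=> A A0; rewrite tr_rho_twist // rho_letters // tr2_scal mulrA.
  rewrite eval_trace expo_letters -/p -/q.
  have -> : (- A ^+ 4) ^- p = (-1) ^+ p * A ^ (- (p%:Z * 4)).
    by rewrite (exprNn (A ^+ 4)) -signr_odd invfM invr_sign -exprM mulnC exprnN PoszM.
  by rewrite /a !expfzDr //; ring.
exists b1, b2, b3, s; split=> //.
by rewrite e12 /a expo_cat expo_letters expo_twist_pow -/p -/q; lia.
Qed.

Lemma mixed_letters : (0 < p)%N -> (0 < q)%N -> [/\ k = 0, m = 0%N, p = 1%N & q = 1%N].
Proof.
move=> p0 q0; have [b1 [b2 [b3 [s [e12 E]]]]] := letters_equation.
have [t3 teq] := tr_letters1 p0 q0.
have [z z4 nz] := zeta8_exists; have := zeta8_bound z4 nz E.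
rewrite eval_trace z4 opprK normrM normrX normrN normr1 expr1n mul1r.
have -> : tr2 (letters_mat (1 : algC) al) = (tr2 (letters_mat (1 : int) al))%:~R.
  by rewrite -(tr_letters_morph (intr : {rmorphism int -> algC})) rmorph1.
move: t3 teq; set t := tr2 _ => t3 teq.
rewrite -intr_norm (_ : 2 - _ = (2 - `|t|)%:~R); last by rewrite rmorphB.
rewrite -intr_norm -[(m == 0%N)%:R]/((m == 0%N)%:Z%:~R) ler_int => le.
have m0 : m = 0%N by apply/eqP; move: le; case: (m == 0%N) => //; lia.
have {le}t_eq : t = 3 by move: le; rewrite m0 eqxx; lia.
have [p1 q1] := teq t_eq; split=> //.
(* For ab and ba the trace is 1 + y + y^2, at y = - X^4. *)
have trE : trace = 1 - 'X^4 + 'X^8.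
  have : al = [:: true; false] \/ al = [:: false; true].
    have := size_count al; rewrite p1 q1; move: p1 q1; rewrite /p /q.
    by case: (al) => [|[] [|[] []]] //= _ _ _; [left | right].
  by rewrite /trace => -[] ->; rewrite /tr2 /mul2 /=; ring.
move: E; rewrite trE /p p1 m0 expr0 mulr1 expr1 => E.
have C l : ((l == b1)%:Z + (l == b1 + 8)%N%:Z - (l == b2)%:Z + (l == b2 + 4)%N%:Z -
    (l == b2 + 8)%N%:Z = (-1) ^+ s * (l == b3)%:Z)%R.
  have -> : (-1) ^+ s * (l == b3)%:Z = ((-1) ^+ s * 'X^b3 : {poly int})`_l.
    by case: (s); rewrite ?expr0 ?expr1 ?mul1r ?mulN1r ?coefN coefXn natz.
  rewrite -E (_ : _ + _ = 'X^b1 + 'X^(b1 + 8) - 'X^b2 + 'X^(b2 + 4) - 'X^(b2 + 8)).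
    by rewrite !(coefD, coefN, coefXn) !natz.
  by rewrite !exprD; ring.
have ev : exists d, k = 2 * d.
  by exists (k %/ 2)%Z; move: even_k; rewrite /oddz; lia.
(* Here [b1 - b2 = 12 * d]. The coefficient at [b2 + 4] is therefore 1, so [b3 = b2 + 4]; then the
   coefficient at [b2] has to vanish, which forces [b1 = b2]. *)
have [d ed] := ev; move: (C b2) (C (b2 + 4)%N) e12; rewrite /p p1 ed.
by case: (s); rewrite ?expr0 ?expr1; lia.
Qed.

Lemma pure_letters c : count_mem (~~ c) al = 0%N ->
  k = 0 /\ (m = 1%N /\ al = [:: c] \/ m = 2%N /\ al = [::]).
Proof.
move=> c0; have al_nseq := nseq_count c0; set n := size al in al_nseq.
have [b1 [b2 [b3 [s [e12 E]]]]] := letters_equation.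
have ep : p = if c then n else 0%N by rewrite /p al_nseq count_nseq; case: (c) => /=; rewrite ?mul1n.
have {}E : 'X^b1 + 'X^(b1 + 8) + (if c then (-1) ^+ odd n * 'X^b2 + 'X^(b2 + 4 * n)
      else 'X^b2 + (-1) ^+ odd n * 'X^(b2 + 4 * n)) =
    (-1) ^+ s * 'X^b3 * (1 + 'X^4) ^+ m :> {poly int}.
  rewrite -E /trace al_nseq tr_letters_nseq ep (exprNn 'X^4) -exprM (exprD _ b1) (exprD _ b2).
  case: (c); last by rewrite expr0 signr_odd; ring.
  have s2 : (-1) ^+ odd n * (-1) ^+ odd n = 1 :> {poly int} by rewrite -signr_addb addbb.
  rewrite -(signr_odd _ n).
  transitivity ('X^b1 + 'X^b1 * 'X^8 + ((-1) ^+ odd n * 'X^b2 +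
     ((-1) ^+ odd n * (-1) ^+ odd n) * ('X^b2 * 'X^(4 * n))) : {poly int}); last by ring.
  by rewrite s2 mul1r.
(* Evaluation at 1: the left side is 2 or 4, which determines the sign and [m]. *)
have E1 : 3 + (-1) ^+ odd n = (-1) ^+ s * 2 ^+ m :> int.
  pose h : {rmorphism {poly int} -> int} := GRing.RMorphism.clone _ _ (horner_eval 1) _.
  have hX : h 'X = 1 by rewrite /h /= /horner_eval hornerX.
  have hp l : h 'X^l = 1 by rewrite rmorphXn hX expr1n.
  have := congr1 h E; rewrite [h (_ * _ ^+ m)]rmorphM [h (_ ^+ m)]rmorphXn rmorphM.
  rewrite rmorph_sign hp (rmorphD h 1) rmorph1 hp mulr1 -[1 + 1]/(2 : int) => <-.
  by case: (c); rewrite !(rmorphD, rmorphM, rmorph_sign) !hp; ring.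
have [d ed] : exists d, k = 2 * d.
  by exists (k %/ 2)%Z; move: even_k; rewrite /oddz; lia.
have m12 : s = false /\ m = (if odd n then 1 else 2)%N.
  move: E1; case: (odd n) (s) => [] []; rewrite ?expr0 ?expr1; clear;
    by case: m => [|[|[|m']]]; rewrite // !exprS; move: (2 ^+ m') (exprn_gt0 m' (isT : 0 < 2 :> int)); lia.
have [es em] := m12; clear m12 E1.
have sigma (F : comNzRingType) : (-1) ^+ odd n = (if odd n then -1 else 1) :> F.
  by case: (odd n); rewrite ?expr0 ?expr1.
rewrite es expr0 mul1r em sigma in E.
have C l : (l == b1)%:Z + (l == b1 + 8)%N%:Z +
    (if c then (if odd n then -1 else 1) * (l == b2)%:Z + (l == b2 + 4 * n)%N%:Z
     else (l == b2)%:Z + (if odd n then -1 else 1) * (l == b2 + 4 * n)%N%:Z) =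
    (l == b3)%:Z + (if odd n then (l == b3 + 4)%N%:Z
                    else 2 * (l == b3 + 4)%N%:Z + (l == b3 + 8)%N%:Z).
  have coefX b : ('X^b : {poly int})`_l = (l == b)%:Z by rewrite coefXn natz.
  have sgX b : ((if odd n then -1 else 1) * 'X^b : {poly int})`_l =
      (if odd n then -1 else 1) * (l == b)%:Z.
    by case: (odd n); rewrite ?mul1r ?mulN1r ?coefN coefX.
  transitivity (('X^b3 * (1 + 'X^4) ^+ (if odd n then 1 else 2) : {poly int})`_l).
    by rewrite -E !coefD !coefX; case: (c); rewrite !coefD !coefX sgX.
  case: (odd n).
    by rewrite expr1 mulrDr mulr1 -exprD coefD !coefX.
  rewrite (_ : _ * _ = 'X^b3 + ('X^(b3 + 4) + 'X^(b3 + 4)) + 'X^(b3 + 8)); last first.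
    by rewrite !(exprD _ b3); ring.
  by rewrite !coefD !coefX; ring.
(* For even [n] the right side is X^b3 (1 + X^4)^2, so [b1] and [b1 + 8] are its extreme exponents
   and the other two monomials coincide in the middle. For odd [n] the right side has no negative
   coefficient, so the negative monomial cancels X^b1 or X^(b1 + 8). *)
have done_n : d = 0 /\ (if odd n then n = 1%N else n = 0%N).
  move: C e12; rewrite ep ed; clear -d; case: c; case: ifP => odd_n C e12.
  - have n1 : (0 < n)%N by case: (n) odd_n.
    have F1 : b2 = b1 \/ b2 = (b1 + 8)%N by have := C b2; lia.
    have F2 : (b2 + 4 * n = b3 \/ b2 + 4 * n = b3 + 4)%N by have := C (b2 + 4 * n)%N; lia.
    have F3 : b1 = b2 \/ b1 = b3 \/ (b1 = b3 + 4)%N by have := C b1; lia.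
    have F4 : (b1 + 8 = b2 \/ b1 + 8 = b3 \/ b1 + 8 = b3 + 4)%N by have := C (b1 + 8)%N; lia.
    clear C; lia.
  - have F3 : (b1 = b3 \/ b1 = b3 + 4 \/ b1 = b3 + 8)%N by have := C b1; lia.
    have F4 : (b1 + 8 = b3 \/ b1 + 8 = b3 + 4 \/ b1 + 8 = b3 + 8)%N by have := C (b1 + 8)%N; lia.
    have e13 : b1 = b3 by clear C; lia.
    have F5 : (b2 = b3 + 4 /\ b2 + 4 * n = b3 + 4)%N by have := C (b3 + 4)%N; lia.
    clear C; lia.
  - have n1 : (0 < n)%N by case: (n) odd_n.
    have F1 : (b2 + 4 * n = b1 \/ b2 + 4 * n = b1 + 8)%N by have := C (b2 + 4 * n)%N; lia.
    have F2 : (b2 = b3 \/ b2 = b3 + 4)%N by have := C b2; lia.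
    have F3 : (b1 = b2 + 4 * n \/ b1 = b3 \/ b1 = b3 + 4)%N by have := C b1; lia.
    have F4 : (b1 + 8 = b2 + 4 * n \/ b1 + 8 = b3 \/ b1 + 8 = b3 + 4)%N.
      by have := C (b1 + 8)%N; lia.
    clear C; lia.
  - have F3 : (b1 = b3 \/ b1 = b3 + 4 \/ b1 = b3 + 8)%N by have := C b1; lia.
    have F4 : (b1 + 8 = b3 \/ b1 + 8 = b3 + 4 \/ b1 + 8 = b3 + 8)%N by have := C (b1 + 8)%N; lia.
    have e13 : b1 = b3 by clear C; lia.
    have F5 : (b2 = b3 + 4 /\ b2 + 4 * n = b3 + 4)%N by have := C (b3 + 4)%N; lia.
    clear C; lia.
have [d0 en] := done_n; split; first by rewrite ed d0.
move: em en; case: (odd n) => em en; rewrite em; [left | right]; split=> //.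
  by rewrite al_nseq en.
by rewrite al_nseq en.
Qed.
End Letters.

Lemma unlink_of_trace v k (e : bool) (j : int) m : ~~ oddz k ->
  [\/ exists al, v = letters al, v = half_twist true |
      exists i s, v = [:: (i, s); (~~ i, s)]] ->
  (forall N A, integral_loop N A ->
    A ^ expo (v ++ twist_pow k) * (A ^+ 4 + A ^- 4) + tr2 (rho A (v ++ twist_pow k)) =
    (-1) ^+ e * A ^ j * N.+1%:R ^+ m) ->
  iso (cl (v ++ twist_pow k)) (unlink_slices m.+1).
Proof.
move=> ev [[al ->]|->|[i [s ->]]] H; last 2 first.
- by case: (half_twist_nontrivial ev H).
- by have [-> ->] := coxeter_trivial ev H; apply: iso_unknot.
have [p0|p0] := posnP (count_mem true al).
  have [-> [[-> ->]|[-> ->]]] := pure_letters ev H (c := false) p0.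
    exact: iso_unlink2.
  exact: iso_unlink3.
have [q0|q0] := posnP (count_mem false al).
  have [-> [[-> ->]|[-> ->]]] := pure_letters ev H (c := true) q0.
    exact: iso_unlink2.
  exact: iso_unlink3.
have [-> -> p1 q1] := mixed_letters ev H p0 q0.
have := size_count al; rewrite p1 q1; case: al p1 q1 {H p0 q0} => [|x [|y []]] //.
by case: x; case: y => // _ _ _; [apply: (iso_unknot false) | apply: (iso_unknot true)].
Qed.

Theorem corollary6p3 (L : link_diagram) (hL : is_closed_braid 3 L) :
  semiadequate_link L /\
  forall n : nat, components L = n -> ~ isotopic L (unlink n) ->
  forall o : nat * nat -> bool, orientation L o ->
  forall u : jones_field, jones_unit u ->
    jones L o <> u * (- half_t - half_t^-1) ^+ n.-1.
Proof.
split; first exact: semiadequate_closed_braid.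
move=> n <- not_unlink o _ u uu eqV; apply: not_unlink.
have [w iLw] := closed_braid_word hL.
have [v [k [iw ev cases]]] := normal_form w.
have iL := iso_trans iLw iw.
have [e [j H]] := trace_equation iL uu eqV.
have [h1 [h2 iU]] := iso_trans iL (unlink_of_trace ev cases H).
have ne : slices L <> [::].
  by case: iL => h3 [h4 /isotopic_nonempty /= iff0] e0; have := iff0.1 e0.
(* Having a component, [L] is compared with the unlink of [(components L).-1.+1] components, which
   is the required one. *)
have n0 : (0 < components L)%N by apply: loops_gt0.
move: h2 iU; rewrite prednK // => h2 iU.
have <- : LinkDiagram h2 = unlink (components L).
  by rewrite /unlink (bool_irrelevance (unlink_closed _) h2).
by move: iU; rewrite link_diagram_eta.
Qed.
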